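(* Let $k$ be an uncountable algebraically closed field, let $A$ be an affine, finitely related, noetherian $k$-algebra, and let $Z$ be an affine subalgebra of the centre of $A$ which is a domain whose nonzero elements are not zero divisors in $A$. Assume that Gelfand-Kirillov dimension over $k$ exists for all $A$-modules, takes values in the non-negative integers, and is exact and finitely partitive. Let $n=\mathrm{GKdim}_k(A)$ and $d=\mathrm{GKdim}_k(Z)$. Suppose that $Z$ is smooth, and unruffled in $A$. Let $\mathfrak{p}$ be a prime ideal of $Z$ of height $\ell$. Then: (1) $Z/\mathfrak{p}$ is unruffled in $A/\mathfrak{p}A$. Suppose in addition that $A$ is Cohen-Macaulay, and let $F$ denote the field of fractions of $Z/\mathfrak{p}$. Then: (2) $\mathrm{GKdim}_F(A/\mathfrak{p}A\otimes_{Z/\mathfrak{p}}F)=n-d$; (3) $\mathrm{GKdim}_k(A/\mathfrak{p}A)=n-\ell$.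
   Context: Affine means finitely generated as a $k$-algebra; finitely related means isomorphic to a quotient of a free $k$-algebra of finite rank by a finitely generated two-sided ideal. Modules are left modules. $\mathrm{GKdim}_K(-)$ denotes Gelfand-Kirillov dimension over a field $K$. Exactness means $\mathrm{GKdim}(M)=\max(\mathrm{GKdim}(M'),\mathrm{GKdim}(M''))$ for every short exact sequence $0\to M'\to M\to M''\to 0$; finitely partitive means that for each finitely generated $M$ there is a bound on the lengths $t$ of chains $M=M_0\supset M_1\supset\cdots\supset M_t$ with all $\mathrm{GKdim}(M_i/M_{i+1})=\mathrm{GKdim}(M)$. The grade $j(M)$ of a finitely generated $A$-module $M$ is the least integer $j$ with $\mathrm{Ext}^j_A(M,A)\neq 0$, or $+\infty$ if there is none. $A$ is Cohen-Macaulay if $\mathrm{GKdim}_k(A)=j(M)+\mathrm{GKdim}_k(M)$ for all nonzero finitely generated (left) $A$-modules $M$. $Z$ is smooth if it has finite global dimension. For an algebra $B$ with central subalgebra $C$ that is a domain with field of fractions $Q(C)$, $C$ is unruffled in $B$ if $\mathrm{GKdim}_k(B/\mathfrak{m}B)=\mathrm{GKdim}_{Q(C)}(B\otimes_C Q(C))$ for every maximal ideal $\mathfrak{m}$ of $C$. *)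

(* Defs.v *)
From HB Require Import structures.
From mathcomp Require Import all_boot all_order all_algebra.
(* only the canonical instances: the notations clash with the analysis library *)
From mathcomp Require Import (canonicals) monalg.
From mathcomp Require Import boolp classical_sets functions cardinality.
From mathcomp Require Import reals ereal topology normedtype sequences exp.

Set Implicit Arguments.
Unset Strict Implicit.
Unset Printing Implicit Defensive.

Import Order.TTheory GRing.Theory Num.Theory.
Local Open Scope ring_scope.
Local Open Scope quotient_scope.

#[short(type="idomAlgType")]
HB.structure Definition IdomAlgebra (k : pzRingType) :=
  {V of GRing.ComUnitAlgebra k V & GRing.IntegralDomain V}.

(* A ring morphism with central image, i.e. a C-algebra structure on B.  B may
   be the zero ring, as quotients B / mB are not known to be nonzero. *)
Record central_hom (C B : pzRingType) := CentralHom {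
  chom :> {rmorphism C -> B};
  chomC : forall c b, chom c * b = b * chom c }.

Section Fiber.
Variables (C : comNzRingType) (B : pzRingType).
Variables (phi : central_hom C B) (I : idealr C).

Definition ext_ideal : {pred B} := fun b =>
  `[< exists s : seq (C * B), all (fun t => t.1 \in I) s
        /\ b = \sum_(t <- s) phi t.1 * t.2 >].

Fact ext_idealP b : reflect (exists s : seq (C * B),
  all (fun t => t.1 \in I) s /\ b = \sum_(t <- s) phi t.1 * t.2)
  (b \in ext_ideal).
Proof. exact: asboolP. Qed.

Fact ext_ideal_zmod_closed : zmod_closed ext_ideal.
Proof.
split; first by apply/ext_idealP; exists [::]; rewrite big_nil.
move=> _ _ /ext_idealP[s [sI ->]] /ext_idealP[t [tI ->]]; apply/ext_idealP.
exists (s ++ [seq (u.1, - u.2) | u <- t]); split.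
  by rewrite all_cat sI all_map.
rewrite big_cat big_map /= -sumrN; congr (_ + _).
by apply: eq_bigr => u _; rewrite mulrN.
Qed.

HB.instance Definition _ := GRing.isZmodClosed.Build B ext_ideal
  ext_ideal_zmod_closed.

Fact ext_idealMr x b : x \in ext_ideal -> x * b \in ext_ideal.
Proof.
move=> /ext_idealP[s [sI ->]]; apply/ext_idealP.
exists [seq (u.1, u.2 * b) | u <- s]; split; first by rewrite all_map.
by rewrite big_map mulr_suml; apply: eq_bigr => u _; rewrite mulrA.
Qed.

Fact ext_idealMl x b : x \in ext_ideal -> b * x \in ext_ideal.
Proof.
move=> /ext_idealP[s [sI ->]]; apply/ext_idealP.
exists [seq (u.1, b * u.2) | u <- s]; split; first by rewrite all_map.
rewrite big_map mulr_sumr; apply: eq_bigr => u _.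
by rewrite mulrA -chomC mulrA.
Qed.

Definition fiber : Type := @Quotient.quot B ext_ideal.
HB.instance Definition _ := GRing.Zmodule.on fiber.

Definition fiber_pi (b : B) : fiber := \pi_(@Quotient.quot B ext_ideal) b.
Definition fiber_repr (x : fiber) : B := repr (x : @Quotient.quot B ext_ideal).

Fact fiber_reprK x : fiber_pi (fiber_repr x) = x.
Proof. exact: reprK. Qed.

Fact fiber_piP x y : reflect (fiber_pi x = fiber_pi y) (x - y \in ext_ideal).
Proof. by rewrite Quotient.idealrBE; apply: eqP. Qed.

Fact fiber_pi_zmod_morphism : zmod_morphism fiber_pi.
Proof. by move=> x y; rewrite /fiber_pi !piE. Qed.

Definition fiber_one : fiber := fiber_pi 1.
Definition fiber_mul (x y : fiber) : fiber :=
  fiber_pi (fiber_repr x * fiber_repr y).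

Fact fiber_piM x y : fiber_pi (x * y) = fiber_mul (fiber_pi x) (fiber_pi y).
Proof.
apply/fiber_piP.
set x' := fiber_repr _; set y' := fiber_repr _.
have -> : x * y - x' * y' = (x - x') * y + x' * (y - y').
  by rewrite mulrBl mulrBr addrA subrK.
by apply: rpredD; [apply: ext_idealMr | apply: ext_idealMl];
  apply/fiber_piP; rewrite fiber_reprK.
Qed.

Fact fiber_piD x y : fiber_pi (x + y) = fiber_pi x + fiber_pi y.
Proof. by rewrite /fiber_pi !piE. Qed.

Fact fiber_mulA : associative fiber_mul.
Proof.
move=> x y z; rewrite -(fiber_reprK x) -(fiber_reprK y) -(fiber_reprK z).
by rewrite -!fiber_piM mulrA.
Qed.
Fact fiber_mul1 : left_id fiber_one fiber_mul.
Proof. by move=> x; rewrite -(fiber_reprK x) -fiber_piM mul1r. Qed.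
Fact fiber_mulr1 : right_id fiber_one fiber_mul.
Proof. by move=> x; rewrite -(fiber_reprK x) -fiber_piM mulr1. Qed.
Fact fiber_mulDl : left_distributive fiber_mul +%R.
Proof.
move=> x y z; rewrite -(fiber_reprK x) -(fiber_reprK y) -(fiber_reprK z).
by rewrite -fiber_piD -!fiber_piM mulrDl fiber_piD.
Qed.
Fact fiber_mulDr : right_distributive fiber_mul +%R.
Proof.
move=> x y z; rewrite -(fiber_reprK x) -(fiber_reprK y) -(fiber_reprK z).
by rewrite -fiber_piD -!fiber_piM mulrDr fiber_piD.
Qed.

HB.instance Definition _ := GRing.Zmodule_isPzRing.Build fiber
  fiber_mulA fiber_mul1 fiber_mulr1 fiber_mulDl fiber_mulDr.

HB.instance Definition _ :=
  GRing.isZmodMorphism.Build B fiber fiber_pi fiber_pi_zmod_morphism.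
HB.instance Definition _ :=
  GRing.isMonoidMorphism.Build B fiber fiber_pi
    (conj (erefl : fiber_pi 1 = 1) fiber_piM).

End Fiber.

Section Tensor.
Variables (C : comNzRingType) (B D : pzRingType).
Variables (phi : central_hom C B) (psi : central_hom C D).

Definition balanced (G : zmodType) (f : B -> D -> G) : Prop :=
  [/\ forall b b' d, f (b + b') d = f b d + f b' d,
      forall b d d', f b (d + d') = f b d + f b d'
    & forall c b d, f (b * phi c) d = f b (psi c * d)].

(* A list of pairs (b, d) stands for the sum of the pure tensors b (x) d; two
   such sums are equal iff no balanced biadditive map separates them. *)
Definition tensor_equiv (s t : seq (B * D)) : bool :=
  `[< forall (G : zmodType) (f : B -> D -> G), balanced f ->
        \sum_(u <- s) f u.1 u.2 = \sum_(u <- t) f u.1 u.2 >].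

Fact tensor_equiv_class : equiv_class_of tensor_equiv.
Proof.
split=> [s|s t|t s u].
- exact/asboolP.
- by apply/asboolP/asboolP => h G f hf; rewrite h.
- by move=> /asboolP h1 /asboolP h2; apply/asboolP => G f hf; rewrite h1 // h2.
Qed.

Canonical tensor_equiv_rel := EquivRelPack tensor_equiv_class.
Canonical tensor_enc := defaultEncModRel tensor_equiv.

Definition tensor : Type := {eq_quot tensor_equiv}.
HB.instance Definition _ := Choice.on tensor.

Definition tensor_pi (s : seq (B * D)) : tensor := \pi_{eq_quot tensor_equiv} s.
Definition tensor_repr (x : tensor) : seq (B * D) :=
  repr (x : {eq_quot tensor_equiv}).

Fact tensor_reprK x : tensor_pi (tensor_repr x) = x.
Proof. exact: reprK. Qed.

Fact tensor_piP s t : tensor_pi s = tensor_pi t <->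
  forall (G : zmodType) (f : B -> D -> G), balanced f ->
    \sum_(u <- s) f u.1 u.2 = \sum_(u <- t) f u.1 u.2.
Proof.
split.
  by move=> /eqP; rewrite /tensor_pi piE => /asboolP.
by move=> h; apply/eqP; rewrite /tensor_pi piE; apply/asboolP.
Qed.

Definition tensor_zero : tensor := tensor_pi [::].
Definition tensor_one : tensor := tensor_pi [:: (1, 1)].
Definition tensor_opp (x : tensor) : tensor :=
  tensor_pi [seq (- u.1, u.2) | u <- tensor_repr x].
Definition tensor_add (x y : tensor) : tensor :=
  tensor_pi (tensor_repr x ++ tensor_repr y).
Definition tensor_mul (x y : tensor) : tensor :=
  tensor_pi [seq (u.1 * v.1, u.2 * v.2) | u <- tensor_repr x, v <- tensor_repr y].

Fact balancedN (G : zmodType) (f : B -> D -> G) b d :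
  balanced f -> f (- b) d = - f b d.
Proof.
case=> fD _ _; have f0 : f 0 d = 0.
  by apply: (addrI (f 0 d)); rewrite -fD !addr0.
by apply: (addrI (f b d)); rewrite -fD !subrr.
Qed.

Fact tensor_repr_sum (G : zmodType) (f : B -> D -> G) s : balanced f ->
  \sum_(u <- tensor_repr (tensor_pi s)) f u.1 u.2 = \sum_(u <- s) f u.1 u.2.
Proof. by move: G f; apply/tensor_piP; rewrite tensor_reprK. Qed.

Fact tensor_piN s :
  tensor_pi [seq (- u.1, u.2) | u <- s] = tensor_opp (tensor_pi s).
Proof.
apply/tensor_piP => G f hf; rewrite !big_map /=.
under eq_bigr do rewrite balancedN //.
under [RHS]eq_bigr do rewrite balancedN //.
by rewrite !sumrN tensor_repr_sum.
Qed.

Fact tensor_piD s t :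
  tensor_pi (s ++ t) = tensor_add (tensor_pi s) (tensor_pi t).
Proof.
by apply/tensor_piP => G f hf; rewrite !big_cat /= !tensor_repr_sum.
Qed.

Fact balanced_mulr (G : zmodType) (f : B -> D -> G) b d :
  balanced f -> balanced (fun b' d' => f (b' * b) (d' * d)).
Proof.
case=> f1 f2 f3; split=> [x y z|x y z|c x z]; first by rewrite mulrDl f1.
- by rewrite mulrDl f2.
- by rewrite -mulrA chomC mulrA f3 mulrA.
Qed.

Fact balanced_mull (G : zmodType) (f : B -> D -> G) b d :
  balanced f -> balanced (fun b' d' => f (b * b') (d * d')).
Proof.
case=> f1 f2 f3; split=> [x y z|x y z|c x z]; first by rewrite mulrDr f1.
- by rewrite mulrDr f2.
- by rewrite mulrA f3 mulrA chomC mulrA.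
Qed.

Fact tensor_piM s t :
  tensor_pi [seq (u.1 * v.1, u.2 * v.2) | u <- s, v <- t]
  = tensor_mul (tensor_pi s) (tensor_pi t).
Proof.
apply/tensor_piP => G f hf; rewrite !big_allpairs_dep /=.
rewrite -(tensor_repr_sum s (f := fun b d => \sum_(v <- _) f (b * _) (d * _))).
  apply: eq_bigr => u _.
  exact/esym/(tensor_repr_sum t (balanced_mull u.1 u.2 hf)).
case: (hf) => f1 f2 f3; split=> [b b' d|b d d'|c b d].
- by rewrite -big_split; apply: eq_bigr => v _; rewrite mulrDl f1.
- by rewrite -big_split; apply: eq_bigr => v _; rewrite mulrDl f2.
- by apply: eq_bigr => v _; case: (balanced_mulr v.1 v.2 hf).
Qed.

Fact tensor_addA : associative tensor_add.
Proof.
move=> x y z; rewrite -(tensor_reprK x) -(tensor_reprK y) -(tensor_reprK z).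
by rewrite -!tensor_piD catA.
Qed.
Fact tensor_addC : commutative tensor_add.
Proof.
move=> x y; rewrite -(tensor_reprK x) -(tensor_reprK y) -!tensor_piD.
by apply/tensor_piP => G f hf; rewrite !big_cat /= addrC.
Qed.
Fact tensor_add0 : left_id tensor_zero tensor_add.
Proof. by move=> x; rewrite -(tensor_reprK x) -tensor_piD. Qed.
Fact tensor_addN : left_inverse tensor_zero tensor_opp tensor_add.
Proof.
move=> x; rewrite -(tensor_reprK x) -tensor_piN -tensor_piD.
apply/tensor_piP => G f hf; rewrite big_cat big_map big_nil /=.
by under eq_bigr do rewrite balancedN //; rewrite sumrN addNr.
Qed.

HB.instance Definition _ := GRing.isZmodule.Build tensor
  tensor_addA tensor_addC tensor_add0 tensor_addN.

Fact tensor_mulA : associative tensor_mul.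
Proof.
move=> x y z; rewrite -(tensor_reprK x) -(tensor_reprK y) -(tensor_reprK z).
rewrite -!tensor_piM; apply/tensor_piP => G f hf.
rewrite !big_allpairs_dep /=; apply: eq_bigr => u _.
rewrite !big_allpairs_dep /=; apply: eq_bigr => v _.
by apply: eq_bigr => w _; rewrite !mulrA.
Qed.
Fact tensor_mul1 : left_id tensor_one tensor_mul.
Proof.
move=> x; rewrite -(tensor_reprK x) -tensor_piM; apply/tensor_piP => G f hf.
rewrite big_allpairs_dep big_seq1 /=.
by apply: eq_bigr => u _; rewrite !mul1r.
Qed.
Fact tensor_mulr1 : right_id tensor_one tensor_mul.
Proof.
move=> x; rewrite -(tensor_reprK x) -tensor_piM; apply/tensor_piP => G f hf.
rewrite big_allpairs_dep /=.
by apply: eq_bigr => u _; rewrite big_seq1 !mulr1.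
Qed.
Fact tensor_mulDl : left_distributive tensor_mul +%R.
Proof.
move=> x y z; rewrite -(tensor_reprK x) -(tensor_reprK y) -(tensor_reprK z).
rewrite -[_ + _]tensor_piD -[RHS]/(tensor_add _ _) -!tensor_piM -tensor_piD.
by apply/tensor_piP => G f hf; rewrite big_cat !big_allpairs_dep big_cat.
Qed.
Fact tensor_mulDr : right_distributive tensor_mul +%R.
Proof.
move=> x y z; rewrite -(tensor_reprK x) -(tensor_reprK y) -(tensor_reprK z).
rewrite -[_ + _]tensor_piD -[RHS]/(tensor_add _ _) -!tensor_piM -tensor_piD.
apply/tensor_piP => G f hf; rewrite big_cat !big_allpairs_dep /= -big_split /=.
by apply: eq_bigr => u _; rewrite big_cat.
Qed.

HB.instance Definition _ := GRing.Zmodule_isPzRing.Build tensor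
  tensor_mulA tensor_mul1 tensor_mulr1 tensor_mulDl tensor_mulDr.

Definition tensor_inr (d : D) : tensor := tensor_pi [:: (1, d)].

Fact tensor_inr_zmod_morphism : zmod_morphism tensor_inr.
Proof.
move=> x y; rewrite /tensor_inr -[LHS](addrK (tensor_pi [:: (1, y)])).
congr (_ - _); rewrite -[LHS]tensor_piD; apply/tensor_piP => G f hf.
by case: (hf) => _ fD _; rewrite big_cat !big_seq1 /= -fD subrK.
Qed.
Fact tensor_inr_monoid_morphism : monoid_morphism tensor_inr.
Proof. by split=> // x y; rewrite -[RHS]tensor_piM /= mul1r. Qed.

HB.instance Definition _ :=
  GRing.isZmodMorphism.Build D tensor tensor_inr tensor_inr_zmod_morphism.
HB.instance Definition _ :=
  GRing.isMonoidMorphism.Build D tensor tensor_inr tensor_inr_monoid_morphism.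

End Tensor.

Definition frac_hom (C : idomainType) : central_hom C {fraction C} :=
  @CentralHom C {fraction C} (@FracField.tofrac C)
    (fun c q => mulrC (FracField.tofrac c) q).

Section PrimeQuot.
Variables (k : pzRingType) (Z : idomAlgType k) (p : prime_idealr Z).

Definition prime_quot : Type := Quotient.quot p.
HB.instance Definition _ := GRing.ComNzRing.on prime_quot.

Definition prime_pi (z : Z) : prime_quot := \pi_(Quotient.quot p) z.
Definition prime_repr (x : prime_quot) : Z := repr (x : Quotient.quot p).

Fact prime_reprK x : prime_pi (prime_repr x) = x.
Proof. exact: reprK. Qed.
Fact prime_piP x y : reflect (prime_pi x = prime_pi y) (x - y \in p).
Proof. by rewrite Quotient.idealrBE; apply: eqP. Qed.
Fact prime_piD x y : prime_pi (x + y) = prime_pi x + prime_pi y.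
Proof. by rewrite /prime_pi !piE. Qed.
Fact prime_piB x y : prime_pi (x - y) = prime_pi x - prime_pi y.
Proof. by rewrite /prime_pi !piE. Qed.
Fact prime_piM x y : prime_pi (x * y) = prime_pi x * prime_pi y.
Proof. by rewrite /prime_pi !piE. Qed.
Fact prime_pi1 : prime_pi 1 = 1.
Proof. by rewrite /prime_pi !piE. Qed.

Definition prime_scale (a : k) (x : prime_quot) : prime_quot :=
  prime_pi (a *: prime_repr x).

Fact prime_scale_pi a z : prime_scale a (prime_pi z) = prime_pi (a *: z).
Proof.
apply/prime_piP; rewrite -scalerBr -mulr_algl; apply: idealMr.
by apply/prime_piP; rewrite prime_reprK.
Qed.

Fact prime_scalerA a b v :
  prime_scale a (prime_scale b v) = prime_scale (a * b) v.
Proof. by rewrite -(prime_reprK v) !prime_scale_pi scalerA. Qed.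
Fact prime_scale1r : left_id 1 prime_scale.
Proof. by move=> v; rewrite -(prime_reprK v) prime_scale_pi scale1r. Qed.
Fact prime_scalerDr : right_distributive prime_scale +%R.
Proof.
move=> a u v; rewrite -(prime_reprK u) -(prime_reprK v) -prime_piD.
by rewrite !prime_scale_pi scalerDr prime_piD.
Qed.
Fact prime_scalerDl v : {morph prime_scale^~ v : a b / a + b}.
Proof.
by move=> a b; rewrite -(prime_reprK v) !prime_scale_pi scalerDl prime_piD.
Qed.
HB.instance Definition _ := GRing.Zmodule_isLmodule.Build k prime_quot
  prime_scalerA prime_scale1r prime_scalerDr prime_scalerDl.

Fact prime_scalerAl (a : k) (u v : prime_quot) : a *: (u * v) = (a *: u) * v.
Proof.
rewrite -(prime_reprK u) -(prime_reprK v) -prime_piM.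
by rewrite -![a *: _]/(prime_scale a _) !prime_scale_pi scalerAl prime_piM.
Qed.
HB.instance Definition _ := GRing.Lmodule_isLalgebra.Build k prime_quot
  prime_scalerAl.
HB.instance Definition _ := GRing.Lalgebra_isComAlgebra.Build k prime_quot.

Definition prime_unit : {pred prime_quot} :=
  fun x => `[< exists y, y * x = 1 >].
Definition prime_inv (x : prime_quot) : prime_quot :=
  if pselect (exists y, y * x = 1) is left h then projT1 (cid h) else x.

Fact prime_mulVr : {in prime_unit, left_inverse 1 prime_inv *%R}.
Proof.
move=> x /asboolP hx; rewrite /prime_inv; case: pselect => // h.
by case: (cid h).
Qed.
Fact prime_unitP (x y : prime_quot) : y * x = 1 -> prime_unit x.
Proof. by move=> h; apply/asboolP; exists y. Qed.
Fact prime_inv_out : {in [predC prime_unit], prime_inv =1 id}.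
Proof.
by move=> x /asboolP hx; rewrite /prime_inv; case: pselect => // /hx.
Qed.
HB.instance Definition _ := GRing.ComNzRing_hasMulInverse.Build prime_quot
  prime_mulVr prime_unitP prime_inv_out.
HB.instance Definition _ := GRing.ComUnitRing_isIntegral.Build prime_quot
  (@Quotient.rquot_IdomainAxiom Z p).

Variables (B : pzRingType) (phi : central_hom Z B).

Definition quot_map (x : prime_quot) : fiber phi p :=
  fiber_pi phi p (phi (prime_repr x)).

Fact quot_map_pi z : quot_map (prime_pi z) = fiber_pi phi p (phi z).
Proof.
apply/fiber_piP; rewrite -rmorphB; apply/ext_idealP.
exists [:: (prime_repr (prime_pi z) - z, 1)]; split.
  by rewrite /= andbT; apply/prime_piP; rewrite prime_reprK.
by rewrite big_seq1 mulr1.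
Qed.
Fact quot_map_zmod_morphism : zmod_morphism quot_map.
Proof.
move=> x y; rewrite -(prime_reprK x) -(prime_reprK y).
by rewrite -prime_piB !quot_map_pi !rmorphB.
Qed.
Fact quot_map_monoid_morphism : monoid_morphism quot_map.
Proof.
split; first by rewrite -prime_pi1 quot_map_pi !rmorph1.
move=> x y; rewrite -(prime_reprK x) -(prime_reprK y) -prime_piM.
by rewrite !quot_map_pi !rmorphM.
Qed.
HB.instance Definition _ := GRing.isZmodMorphism.Build prime_quot (fiber phi p)
  quot_map quot_map_zmod_morphism.
HB.instance Definition _ := GRing.isMonoidMorphism.Build prime_quot
  (fiber phi p) quot_map quot_map_monoid_morphism.

Fact quot_map_central (x : prime_quot) (b : fiber phi p) :
  quot_map x * b = b * quot_map x.
Proof.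
rewrite -(prime_reprK x) -(fiber_reprK b) quot_map_pi.
by rewrite -!rmorphM chomC.
Qed.

Definition quot_hom : central_hom prime_quot (fiber phi p) :=
  CentralHom quot_map_central.

End PrimeQuot.

Section Subquotient.
Variables (A : pzRingType) (M : lmodType A).

Record submod (N : submodClosed M) := Submod {
  submod_val :> M;
  submod_valP : submod_val \in N }.

Section OneSubmodule.
Variable N : submodClosed M.
HB.instance Definition _ := [isSub for @submod_val N].
HB.instance Definition _ := [Choice of submod N by <:].
HB.instance Definition _ := [SubChoice_isSubLmodule of submod N by <:].
End OneSubmodule.

Definition trace_submod (N N' : submodClosed M) : {pred submod N} :=
  fun x => submod_val x \in N'.
Fact trace_submod_closed N N' : submod_closed (@trace_submod N N').
Proof.
split; first by rewrite /in_mem /= /trace_submod rpred0.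
by move=> a x y; rewrite /in_mem /= /trace_submod => hx hy;
  rewrite -[submod_val _]/(a *: submod_val x + submod_val y) rpredD ?rpredZ.
Qed.
HB.instance Definition _ N N' := GRing.isSubmodClosed.Build A (submod N)
  (@trace_submod N N')
  (GRing.submod_closed_semi (@trace_submod_closed N N')).
End Subquotient.

Section QuotientModule.
Variables (A : pzRingType) (M : lmodType A) (N : submodClosed M).

Definition submod_pred : {pred M} := fun m => m \in N.
Fact submod_pred_zmod_closed : zmod_closed submod_pred.
Proof. exact: (GRing.submod_closedB (submodClosedP N)). Qed.
HB.instance Definition _ := GRing.isZmodClosed.Build M submod_pred
  submod_pred_zmod_closed.

Definition quotmod : Type := @Quotient.quot M submod_pred.
HB.instance Definition _ := GRing.Zmodule.on quotmod.
Definition quotmod_pi (m : M) : quotmod := \pi_(@Quotient.quot M submod_pred) m.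
Definition quotmod_repr (x : quotmod) : M := repr (x : @Quotient.quot M submod_pred).
Fact quotmod_reprK x : quotmod_pi (quotmod_repr x) = x.
Proof. exact: reprK. Qed.
Fact quotmod_piP x y : reflect (quotmod_pi x = quotmod_pi y) (x - y \in N).
Proof.
by rewrite -[_ \in N]/(x - y \in submod_pred) Quotient.idealrBE; apply: eqP.
Qed.
Fact quotmod_piD x y : quotmod_pi (x + y) = quotmod_pi x + quotmod_pi y.
Proof. by rewrite /quotmod_pi !piE. Qed.
Definition quotmod_scale (a : A) (x : quotmod) : quotmod :=
  quotmod_pi (a *: quotmod_repr x).
Fact quotmod_scale_pi a m : quotmod_scale a (quotmod_pi m) = quotmod_pi (a *: m).
Proof.
apply/quotmod_piP; rewrite -scalerBr; apply: rpredZ.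
by apply/quotmod_piP; rewrite quotmod_reprK.
Qed.
Fact quotmod_scalerA a b v :
  quotmod_scale a (quotmod_scale b v) = quotmod_scale (a * b) v.
Proof. by rewrite -(quotmod_reprK v) !quotmod_scale_pi scalerA. Qed.
Fact quotmod_scale1r : left_id 1 quotmod_scale.
Proof. by move=> v; rewrite -(quotmod_reprK v) quotmod_scale_pi scale1r. Qed.
Fact quotmod_scalerDr : right_distributive quotmod_scale +%R.
Proof.
move=> a u v; rewrite -(quotmod_reprK u) -(quotmod_reprK v) -quotmod_piD.
by rewrite !quotmod_scale_pi scalerDr quotmod_piD.
Qed.
Fact quotmod_scalerDl v : {morph quotmod_scale^~ v : a b / a + b}.
Proof.
by move=> a b; rewrite -(quotmod_reprK v) !quotmod_scale_pi scalerDl quotmod_piD.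
Qed.
HB.instance Definition _ := GRing.Zmodule_isLmodule.Build A quotmod
  quotmod_scalerA quotmod_scale1r quotmod_scalerDr quotmod_scalerDl.
End QuotientModule.

(* N / N', or rather N / (N :&: N') *)
Definition subquot (A : pzRingType) (M : lmodType A) (N N' : submodClosed M)
  : lmodType A := quotmod [the submodClosed (submod N) of @trace_submod A M N N'].

Definition fg_module (A : pzRingType) (M : lmodType A) : Prop :=
  exists s : seq M, forall x : M,
    exists a : 'I_(size s) -> A, x = \sum_(i < size s) a i *: s`_i.

Definition nonzero_module (A : pzRingType) (M : lmodType A) : Prop :=
  exists x : M, x != 0.

Definition noetherian_module (A : pzRingType) (M : lmodType A) : Prop :=
  forall N : nat -> submodClosed M,
    (forall i, {subset N i <= N i.+1}) ->
    exists n, forall i, (n <= i)%N -> N i =i N n.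

(* left and right noetherian; right ideals are left ideals of the converse ring *)
Definition noetherian_ring (A : pzRingType) : Prop :=
  noetherian_module A^o /\ noetherian_module (A^c)^o.

Definition affine (k : fieldType) (A : algType k) : Prop :=
  exists s : seq A, forall S : subalgClosed A,
    {subset s <= S} -> forall a, a \in S.

(* fmonom 'I_n is the free monoid on 'I_n; malg is the monoid algebra *)
Definition free_alg (k : fieldType) (n : nat) : lalgType k :=
  monalg.malg (monalg.fmonom 'I_n) k.

Definition in_ideal_generated_by (F : pzRingType) (r : seq F) (x : F) : Prop :=
  exists s : seq (F * F * F), all (fun t => t.1.2 \in r) s
    /\ x = \sum_(t <- s) t.1.1 * t.1.2 * t.2.

Definition finitely_related (k : fieldType) (A : algType k) : Prop :=
  exists (n : nat) (f : {lrmorphism free_alg k n -> A}) (r : seq (free_alg k n)),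
    (forall a, exists x, f x = a)
    /\ (forall x, f x = 0 <-> in_ideal_generated_by r x).

Section Homological.
Variable A : pzRingType.

Definition exact_pair (U V W : lmodType A) (f : U -> V) (g : V -> W) : Prop :=
  forall v, g v = 0 <-> exists u, v = f u.

Definition surj (X Y : Type) (f : X -> Y) : Prop := forall y, exists x, y = f x.

Definition projective_module (P : lmodType A) : Prop :=
  forall (X Y : lmodType A) (g : {linear X -> Y}) (f : {linear P -> Y}),
    surj g -> exists h : {linear P -> X}, forall x, g (h x) = f x.

Record proj_resolution (M : lmodType A) := ProjResolution {
  res_mod :> nat -> lmodType A;
  res_diff : forall i, {linear res_mod i.+1 -> res_mod i};
  res_aug : {linear res_mod 0%N -> M};
  res_proj : forall i, projective_module (res_mod i);
  res_surj : surj res_aug;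
  res_exact0 : exact_pair (res_diff 0%N) res_aug;
  res_exact : forall i, exact_pair (res_diff i.+1) (res_diff i) }.

Definition hom_cocycle (M N : lmodType A) (P : proj_resolution M) (j : nat)
    (f : {linear P j -> N}) : Prop :=
  forall x, f (res_diff P j x) = 0.

Definition hom_coboundary (M N : lmodType A) (P : proj_resolution M) (j : nat) :
    {linear P j -> N} -> Prop :=
  match j with
  | 0%N => fun f => forall x, f x = 0
  | i.+1 => fun f =>
      exists h : {linear P i -> N}, forall x, f x = h (res_diff P i x)
  end.

(* Ext^j(M, N) <> 0: the j-th cohomology of Hom(P, N) is nonzero for a
   projective resolution P of M (the choice of P being immaterial) *)
Definition Ext_neq0 (M N : lmodType A) (j : nat) : Prop :=
  exists (P : proj_resolution M) (f : {linear P j -> N}),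
    hom_cocycle f /\ ~ hom_coboundary f.

Definition finite_gldim : Prop :=
  exists n : nat, forall M : lmodType A, exists P : proj_resolution M,
    forall i, (n < i)%N -> forall x : P i, x = 0.

End Homological.

Definition maximal_ideal (C : comNzRingType) (m : idealr C) : Prop :=
  forall J : idealr C, {subset m <= J} -> {subset J <= m}.

Definition prime_chain (C : comNzRingType) (p : prime_idealr C)
    (q : nat -> prime_idealr C) (l : nat) : Prop :=
  (forall i, (i < l)%N ->
     {subset q i <= q i.+1} /\ ~ {subset q i.+1 <= q i}) /\ q l =i p.

Definition has_height (C : comNzRingType) (p : prime_idealr C) (l : nat) : Prop :=
  (exists q, prime_chain p q l)
  /\ forall l' q, prime_chain p q l' -> (l' <= l)%N.

Section GKdim.
Variables (R : realType) (K : fieldType) (B : pzRingType).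
(* the K-algebra structure of B; in all uses its image is central *)
Variable sigma : {rmorphism K -> B}.

Definition indep (M : lmodType B) (s : seq M) (J : {set 'I_(size s)}) : Prop :=
  forall c : 'I_(size s) -> K, \sum_(i in J) sigma (c i) *: s`_i = 0 ->
    forall i, i \in J -> c i = 0.

Definition span_dim (M : lmodType B) (s : seq M) : nat :=
  \max_(J : {set 'I_(size s)} | `[< indep J >]) #|J|.

(* spanning family of K + V + V^2 + ... + V^n, for V the span of the list V *)
Fixpoint words (V : seq B) (n : nat) : seq B :=
  if n is n'.+1 then [seq v * w | v <- 1 :: V, w <- words V n'] else [:: 1].

(* limsup of log_n (d n); lne 0 = -oo *)
Definition growth (d : nat -> nat) : \bar R :=
  limn_esup (fun n => (lne ((d n)%:R%:E : \bar R) * (ln (n%:R : R))^-1%:E)%E).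

(* By the convention log 0 = -oo, zero modules and the zero ring get -oo. *)
Definition gkdim_mod (M : lmodType B) : \bar R :=
  ereal_sup [set growth (fun n => span_dim [seq w *: m | w <- words V n, m <- F])
    | V in [set: seq B] & F in [set: seq M]]%classic.

Definition gkdim_alg : \bar R :=
  ereal_sup [set growth (fun n => span_dim (words V n : seq B^o))
    | V in [set: seq B]]%classic.

End GKdim.

Section Standing.
Variables (R : realType) (k : fieldType) (A : algType k).

Local Notation gk M := (gkdim_mod R (GRing.in_alg A) M).

Definition gkdim_nat_valued : Prop :=
  forall M : lmodType A, nonzero_module M -> exists n : nat, gk M = n%:R%:E.

Definition gkdim_exact : Prop :=
  forall (M' M M'' : lmodType A) (f : {linear M' -> M}) (g : {linear M -> M''}),
    injective f -> exact_pair f g -> surj g -> gk M = maxe (gk M') (gk M'').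

Definition gkdim_finitely_partitive : Prop :=
  forall M : lmodType A, fg_module M ->
    exists b : nat, forall (t : nat) (N : nat -> submodClosed M),
      (forall x, x \in N 0%N) ->
      (forall i, (i < t)%N ->
         [/\ {subset N i.+1 <= N i}, ~ {subset N i <= N i.+1}
           & gk (subquot (N i) (N i.+1)) = gk M]) ->
      (t <= b)%N.

Definition grade (M : lmodType A) : \bar R :=
  ereal_inf [set j%:R%:E | j in [set j : nat | Ext_neq0 M A^o j]]%classic.

Definition cohen_macaulay : Prop :=
  forall M : lmodType A, fg_module M -> nonzero_module M ->
    gkdim_alg R (GRing.in_alg A) = (grade M + gk M)%E.

End Standing.

Section Unruffled.
Variables (R : realType) (k : fieldType) (C : idomAlgType k) (B : pzRingType).
Variable phi : central_hom C B.

Definition gkdim_fiber (I : idealr C) : \bar R :=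
  gkdim_alg R (fiber_pi phi I \o phi \o GRing.in_alg C).

Definition gkdim_generic : \bar R :=
  gkdim_alg R (tensor_inr phi (frac_hom C)).

(* Injectivity says that C is a subalgebra of B. *)
Definition unruffled : Prop :=
  injective phi
  /\ forall m : idealr C, maximal_ideal m -> gkdim_fiber m = gkdim_generic.

End Unruffled.

(* Main.v *)
(* Since k is uncountable, an affine domain C over k has a maximal ideal avoiding any
   given countable set of nonzero elements, and for a suitable such set the fibre of an
   affine C-algebra at this ideal grows like the generic fibre. The maximal fibres of
   A/pA over Z/p are maximal fibres of A over Z, so they all have the dimension g of the
   generic fibre of A, and hence so has the generic fibre of A/pA: this is (1).

   For (2) and (3) it remains to see that GKdim(A/pA) = g + trdeg(Z/p): the case p = 0
   reads n = g + d, and trdeg(Z/p) = d - l by Noether normalization. The bound from below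
   multiplies the monomials in a transcendence basis of Z/p by words in the generators of
   A that are independent over the generic point. For the bound from above, noetherian
   induction on the annihilator in Z of a finitely generated module reduces to a module M
   that is torsion-free over Z/p, where p is not maximal, and it suffices to find h outside
   p with GKdim(M) <= GKdim(M/hM) + 1. Let j be the grade of M. By partitivity
   GKdim(M/hM) < GKdim(M), so Ext^j(M/hM, A) = 0 and h is injective on Ext^j(M, A). If the
   inequality fails, then Ext^(j+1)(M/hM, A) = 0 by the Cohen-Macaulay property and h is
   also surjective on Ext^j(M, A). If this happens for every h, then Ext^j(M, A) is a
   nonzero vector space over k(c) for some c transcendental over k, which contradicts its
   countable dimension over k. *)

Require Import Defs.
From mathcomp Require Import finmap.
From HB Require Import structures.
From mathcomp Require Import all_boot all_order all_algebra.
From mathcomp Require Import boolp classical_sets functions cardinality.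
From mathcomp Require Import reals ereal topology normedtype sequences exp.
From mathcomp Require Import ring lra zify.

Set Implicit Arguments.
Unset Strict Implicit.
Unset Printing Implicit Defensive.

Import Order.TTheory GRing.Theory Num.Theory.
Local Open Scope ring_scope.

(** * Growth of sequences *)

(** Uncountability enters through one pigeonhole statement, [uncountable_dependent], applied to
    candidates for the inverses of c - x, x in [k]. Clearing denominators in a relation among them
    leaves a nonzero polynomial in c, which splits over the algebraically closed [k] into factors c
    - z. In a residue ring this forces some c - z into the ideal, so that the residue field is [k];
    on Ext it kills a class that was chosen nonzero.

    The fibre at a generic ideal M of C needs two kinds of denominators: one per word length, to
    express all words in an independent family, and one per pair of lengths, to keep that family
    independent modulo MB. The second kind is forced because membership in MB involves elements of B
    of unbounded length.

    Height meets transcendence degree along a saturated chain of primes. The hard inequality, a drop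
    of at most one at a minimal nonzero prime, says that such a prime cannot contain a regular pair
    of a polynomial subring over which the domain is finite. The ascending chain condition does here
    the work of a going-down theorem. *)

Section Growth.
Variable R : realType.
Implicit Types d : nat -> nat.

Lemma growth_lt d (c : R) : (growth R d < c%:E)%E ->
  exists n0, forall n, (n0 <= n)%N -> (0 < d n)%N ->
    ln (d n)%:R <= c * ln n%:R.
Proof.
rewrite /growth /limn_esup /limf_esup => /ereal_inf_lt[_ [A [n1 _ An1] <-]] ltc.
(* From 2 on, ln n is positive, so the quotient can be cleared. *)
exists (maxn n1 2) => n; rewrite geq_max => /andP[n1n n2] dn0.
have lnn : 0 < ln (n%:R : R) by rewrite ln_gt0// ltr1n.
have : ((lne ((d n)%:R%:E : \bar R) * (ln (n%:R : R))^-1%:E)%E < c%:E)%E.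
  apply: le_lt_trans ltc; apply: ereal_sup_ubound; exists n => //.
  exact: An1.
rewrite lne_EFin ?ltr0n// -EFinM lte_fin => /ltW.
by rewrite ler_pdivrMr.
Qed.

Lemma ln_nat_ge (M : R) : exists n0, forall n, (n0 <= n)%N -> M <= ln n%:R.
Proof.
exists (Num.bound (expR M)) => n hn.
have h : expR M < n%:R.
  apply: lt_le_trans (archi_boundP (ltW (expR_gt0 M))) _.
  by rewrite ler_nat.
by rewrite -(expRK M) ler_ln ?posrE ?expR_gt0 ?(ltW h)// (lt_trans _ h) ?expR_gt0.
Qed.

Lemma growth_le d (c : R) :
  (forall e : R, 0 < e -> exists n0, forall n, (n0 <= n)%N -> (0 < d n)%N ->
    ln (d n)%:R <= (c + e) * ln n%:R) -> (growth R d <= c%:E)%E.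
Proof.
move=> h; apply/lee_addgt0Pr => e e0; rewrite -EFinD.
have [n0 hn0] := h _ e0; rewrite /growth /limn_esup /limf_esup.
apply: le_trans (ereal_inf_lbound _) _.
  by exists [set n | (maxn n0 2 <= n)%N]%classic; [exists (maxn n0 2)|].
apply: ge_ereal_sup => _ [n nn <-].
have /andP[n0n n2] : (n0 <= n)%N && (2 <= n)%N by rewrite -geq_max.
have lnn : 0 < ln (n%:R : R) by rewrite ln_gt0// ltr1n.
have [dn0|dn0] := posnP (d n).
  by rewrite dn0 le0_lneNy// gt0_mulNye ?lte_fin ?invr_gt0// leNye.
by rewrite lne_EFin ?ltr0n// -EFinM lee_fin ler_pdivrMr// hn0.
Qed.

(** Divided by ln n, the factor [K] and the dilation [c] vanish in the limit, and only the exponents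
    [a] and [b] survive. They appear as summands on opposite sides because either growth may be
    infinite. *)
Lemma growth_compare d d' (K a b c n0 : nat) :
  (0 < c)%N -> (forall n, (n0 <= n)%N -> (d n * n ^ a <= K * n ^ b * d' (c * n))%N) ->
  (growth R d + a%:R%:E <= growth R d' + b%:R%:E)%E.
Proof.
move=> c0 h.
have key (g : R) : (growth R d' < g%:E)%E ->
    (growth R d <= (g + (b%:R - a%:R))%:E)%E.
  move=> /growth_lt[n1 hn1]; apply: growth_le => e e0.
  (* Beyond [n2] the constant error ln K + g ln c is absorbed by e ln n. *)
  have [n2 hn2] := ln_nat_ge ((ln K%:R + g * ln c%:R) / e).
  exists (maxn (maxn n0 1) (maxn n1 n2)) => n.
  rewrite !geq_max => /andP[/andP[n0n n_gt0] /andP[n1n n2n]] dn0.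
  have hn := h _ n0n.
  have : (0 < d n * n ^ a)%N by rewrite muln_gt0 dn0 expn_gt0 n_gt0.
  move=> /leq_trans/(_ hn); rewrite !muln_gt0 => /andP[/andP[K0 nb] d'0].
  have {}hd : ln (d n)%:R + a%:R * ln (n%:R : R) <=
      ln K%:R + b%:R * ln n%:R + ln (d' (c * n)%N)%:R.
    have : ln ((d n * n ^ a)%N%:R : R) <= ln (K * n ^ b * d' (c * n))%N%:R.
      by rewrite ler_ln ?ler_nat// posrE ltr0n !muln_gt0 ?dn0 ?K0 ?nb ?d'0 ?expn_gt0 ?n_gt0.
    rewrite !natrM !lnM ?posrE -?natrM ?ltr0n ?muln_gt0 ?K0 ?nb ?expn_gt0 ?n_gt0//.
    by rewrite !natrX !lnXn ?ltr0n// !mulr_natl.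
  have : ln (d' (c * n)%N)%:R <= g * ln (c * n)%:R.
    by apply: hn1 => //; apply: leq_trans n1n _; rewrite leq_pmull.
  rewrite natrM lnM ?posrE ?ltr0n// => hg.
  have := hn2 _ n2n; rewrite ler_pdivrMr// => he.
  move: hd hg he; set L := ln (n%:R : R); set D := ln (d n)%:R.
  by lra.
case E : (growth R d') => [y| |].
- have h1 : (growth R d <= (y + (b%:R - a%:R))%:E)%E.
    apply/lee_addgt0Pr => e e0; have := key (y + e).
    rewrite E lte_fin ltrDl => /(_ e0) /le_trans; apply.
    by rewrite -EFinD lee_fin; clear; lra.
  apply: (le_trans (leeD2r _ h1)); rewrite -!EFinD lee_fin.
  by rewrite -addrA subrK.
- by rewrite addye// leey.
- case E' : (growth R d) => [x| |]; last by rewrite addNye.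
    exfalso; have := key (x - 1 - (b%:R - a%:R)).
    by rewrite E E' ltNyr lee_fin => /(_ isT); clear; lra.
  by have := key 0; rewrite E E' ltNyr => /(_ isT).
Qed.

Lemma growth_mono d d' : (forall n, (d n <= d' n)%N) ->
  (growth R d <= growth R d')%E.
Proof.
move=> h; rewrite -[leLHS]adde0 -[leRHS]adde0.
apply: (@growth_compare d d' 1 0 0 1 0) => // n _.
by rewrite expn0 muln1 !mul1n.
Qed.

Lemma growth0 : growth R (fun=> 0%N) = -oo%E.
Proof.
have h (c : R) : (growth R (fun=> 0%N) <= c%:E)%E.
  by apply: growth_le => e _; exists 0%N.
case E : (growth _ _) => [x| |//]; last by have := h 0; rewrite E.
exfalso; have := h (x - 1); rewrite E lee_fin; clear; lra.
Qed.

Lemma growth1 : growth R (fun=> 1%N) = 0%E.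
Proof.
apply/eqP; rewrite eq_le; apply/andP; split.
  apply: growth_le => e e0; exists 1%N => n n0 _.
  by rewrite ln1 add0r mulr_ge0 ?(ltW e0)// ln_ge0// ler1n.
rewrite leNgt; apply/negP => h.
have [c c0 hc] : exists2 c : R, c < 0 & (growth R (fun=> 1%N) < c%:E)%E.
  case E : (growth _ _) h => [x|//|] h.
    by exists (x / 2); move: h; rewrite !lte_fin; clear; lra.
  by exists (-1); rewrite ?ltNyr// oppr_lt0.
have [n0 h0] := growth_lt hc; have [n1 h1] := ln_nat_ge 1.
have := h0 (maxn n0 n1) (leq_maxl _ _) isT; rewrite ln1.
have := h1 (maxn n0 n1) (leq_maxr _ _); nra.
Qed.

End Growth.

(** * Spans and dimension *)

Section LinearAlgebra.
Variables (K : fieldType) (B : pzRingType) (sigma : {rmorphism K -> B}).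

Section Span.
Variable M : lmodType B.

Definition lin_indep (T : finType) (e : T -> M) : Prop :=
  forall c : T -> K, \sum_t sigma (c t) *: e t = 0 -> forall t, c t = 0.

Definition in_span (T : finType) (e : T -> M) (x : M) : Prop :=
  exists c : T -> K, x = \sum_t sigma (c t) *: e t.

Definition fam (s : seq M) : 'I_(size s) -> M := fun i => s`_i.

Lemma in_span0 (T : finType) (e : T -> M) : in_span e 0.
Proof.
by exists (fun=> 0); rewrite big1// => t _; rewrite rmorph0 scale0r.
Qed.

Lemma in_spanD (T : finType) (e : T -> M) x y :
  in_span e x -> in_span e y -> in_span e (x + y).
Proof.
move=> [c ->] [d ->]; exists (fun t => c t + d t); rewrite -big_split.
by apply: eq_bigr => t _; rewrite rmorphD scalerDl.
Qed.

Lemma in_spanZ (T : finType) (e : T -> M) a x :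
  in_span e x -> in_span e (sigma a *: x).
Proof.
move=> [c ->]; exists (fun t => a * c t); rewrite scaler_sumr.
by apply: eq_bigr => t _; rewrite rmorphM scalerA.
Qed.

Lemma in_span_sum (T : finType) (e : T -> M) (I : Type) (r : seq I)
    (P : pred I) (F : I -> M) :
  (forall i, P i -> in_span e (F i)) -> in_span e (\sum_(i <- r | P i) F i).
Proof.
move=> h; apply: (big_ind (in_span e)) => //; first exact: in_span0.
exact: in_spanD.
Qed.

Lemma in_span_trans (T U : finType) (e : T -> M) (f : U -> M) x :
  (forall t, in_span f (e t)) -> in_span e x -> in_span f x.
Proof. by move=> h [c ->]; apply: in_span_sum => t _; apply: in_spanZ. Qed.

Lemma in_span_self (T : finType) (e : T -> M) t : in_span e (e t).
Proof.
exists (fun u => (u == t)%:R); rewrite (bigD1 t)//= eqxx rmorph1 scale1r.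
by rewrite big1 ?addr0// => u /negPf ->; rewrite rmorph0 scale0r.
Qed.

Lemma in_span_mem (s : seq M) x : x \in s -> in_span (fam (s := s)) x.
Proof.
move=> xs; have hi : (index x s < size s)%N by rewrite index_mem.
have -> : x = fam (Ordinal hi) by rewrite /fam /= nth_index.
exact: in_span_self.
Qed.

Lemma span_fam (T : finType) (f : T -> M) (s : seq M) :
  {in s, forall x, in_span f x} -> forall i, in_span f (fam (s := s) i).
Proof. by move=> h i; apply: h; apply: mem_nth. Qed.

Lemma in_span_sub (s t : seq M) x : {subset s <= t} ->
  in_span (fam (s := s)) x -> in_span (fam (s := t)) x.
Proof.
by move=> st; apply: in_span_trans; apply: span_fam => y /st; exact: in_span_mem.
Qed.

(** If T were larger than U, the matrix of coefficients of [e] over [f] would have more rows than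
    columns; a nonzero vector of its left kernel is a relation among the [e t]. *)
Lemma steinitz (T U : finType) (e : T -> M) (f : U -> M) :
  lin_indep e -> (forall t, in_span f (e t)) -> (#|T| <= #|U|)%N.
Proof.
move=> ie /choice[C hC]; rewrite leqNgt; apply/negP => hlt.
pose X := \matrix_(i < #|T|, j < #|U|) C (enum_val i) (enum_val j).
have : kermx X != 0.
  rewrite kermx_eq0 /row_free; apply/negP => /eqP hr.
  by have := rank_leq_col X; rewrite hr leqNgt hlt.
move=> /rowV0Pn[v /sub_kermxP vX /negP]; apply; apply/eqP/rowP => i.
suff h t : v 0 (enum_rank t) = 0 by rewrite mxE -(enum_valK i) h.
move: t; apply: (ie (fun t => v 0 (enum_rank t))).
under eq_bigr do rewrite hC scaler_sumr.
rewrite exchange_big big1//= => u _.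
under eq_bigr do rewrite scalerA -rmorphM.
have h0 : \sum_t v 0 (enum_rank t) * C t u = 0.
  have /rowP/(_ (enum_rank u)) := vX; rewrite !mxE; apply: etrans.
  rewrite [RHS](reindex (@enum_rank T))/=.
    by apply: eq_bigr => t _; rewrite mxE !enum_rankK.
  by exists enum_val => t _; rewrite ?enum_rankK ?enum_valK.
by rewrite -scaler_suml -rmorph_sum h0 rmorph0 scale0r.
Qed.

(** A largest independent set of positions spans: the relation created by one more position has a
    nonzero coefficient there and can be solved for it. *)
Lemma span_dim_basis (s : seq M) : exists J : {set 'I_(size s)},
  [/\ #|{: {j | j \in J}}| = span_dim sigma s,
      lin_indep (fun j : {j | j \in J} => s`_(val j)) &
      {in s, forall x, in_span (fun j : {j | j \in J} => s`_(val j)) x}].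
Proof.
have sumJ (J : {set 'I_(size s)}) (c : 'I_(size s) -> K) :
    \sum_(i in J) sigma (c i) *: s`_i =
    \sum_(j : {j | j \in J}) sigma (c (val j)) *: s`_(val j).
  by rewrite (big_sub (mem J)).
have ind0 : `[< indep sigma (finset.set0 : {set 'I_(size s)}) >].
  by apply/asboolP => c _ i; rewrite inE.
have cP : (0 < #|(fun J : {set 'I_(size s)} => `[< indep sigma J >])|)%N.
  by apply/card_gt0P; exists finset.set0.
have [J /asboolP iJ hJ'] := eq_bigmax_cond (fun J : {set 'I_(size s)} => #|J|) cP.
have hJ : span_dim sigma s = #|J| := hJ'.
have iJ' : lin_indep (fun j : {j | j \in J} => s`_(val j)).
  move=> c hc j; pose d i := if insub i is Some j then c j else 0.
  have dE (i : {j | j \in J}) : d (val i) = c i by rewrite /d valK.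
  rewrite -dE; apply: (iJ d); last exact: (valP j).
  by rewrite sumJ -[RHS]hc; apply: eq_bigr => i _; rewrite dE.
exists J; split => //; first by rewrite hJ card_sig.
move=> x xs; have hx : (index x s < size s)%N by rewrite index_mem.
pose i0 := Ordinal hx; have xE : x = s`_i0 by rewrite /= nth_index.
have [i0J|i0J] := boolP (i0 \in J).
  by rewrite xE; apply: (in_span_self _ (Sub i0 i0J : {j | j \in J})).
have : ~ indep sigma (i0 |: J).
  move=> h; have : (#|i0 |: J| <= #|J|)%N.
    rewrite -hJ /span_dim.
    apply: (@bigop.leq_bigmax_cond _ _ (fun J : {set 'I_(size s)} => #|J|) (i0 |: J)).
    exact/asboolP.
  by rewrite cardsU1 i0J add1n ltnn.
move=> /existsNP[c /not_implyP[hc /existsNP[i /not_implyP[]]]].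
rewrite big_setU1//= -xE in hc.
have [c0|c0 _ _] := eqVneq (c i0) 0.
  rewrite c0 rmorph0 scale0r add0r in hc.
  rewrite !inE => /orP[/eqP -> //|iJi] []; exact: (iJ c hc).
have -> : x = sigma (- (c i0)^-1) *: \sum_(i in J) sigma (c i) *: s`_i.
  apply/eqP; rewrite rmorphN scaleNr -addr_eq0; apply/eqP.
  by rewrite -[x in x + _]scale1r -(rmorph1 sigma) -(mulVf c0) rmorphM -scalerA
    -scalerDr hc scaler0.
by apply: in_spanZ; rewrite sumJ; exists (fun j => c (val j)).
Qed.

Lemma span_dim_ge (s : seq M) (T : finType) (e : T -> M) :
  lin_indep e -> (forall t, in_span (fam (s := s)) (e t)) ->
  (#|T| <= span_dim sigma s)%N.
Proof.
move=> ie hs; have [J [<- iJ hJ]] := span_dim_basis s.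
apply: (steinitz ie) => t.
exact: in_span_trans (span_fam hJ) (hs t).
Qed.

Lemma span_dim_le (s : seq M) (T : finType) (f : T -> M) :
  {in s, forall x, in_span f x} -> (span_dim sigma s <= #|T|)%N.
Proof.
move=> hs; have [J [<- iJ hJ]] := span_dim_basis s.
apply: (steinitz iJ) => t.
by apply: hs; apply: mem_nth.
Qed.

Lemma span_dim_mono (s t : seq M) :
  {in s, forall x, in_span (fam (s := t)) x} ->
  (span_dim sigma s <= span_dim sigma t)%N.
Proof.
move=> h; have [J [<- iJ hJ]] := span_dim_basis s.
apply: span_dim_ge iJ _ => j.
by apply: h; apply: mem_nth.
Qed.

End Span.
End LinearAlgebra.

(** * Words and Gelfand-Kirillov dimension *)

Arguments words : simpl never.

Section Words.

Lemma wordsP (B : pzRingType) (V : seq B) n w :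
  reflect (exists p, [/\ p.1 \in 1 :: V, p.2 \in words V n & w = p.1 * p.2])
    (w \in words V n.+1).
Proof. exact: allpairsP. Qed.

Lemma words_map (B B' : pzRingType) (f : {rmorphism B -> B'}) V n :
  words (map f V) n = map f (words V n).
Proof.
elim: n => [|n IH]; first by rewrite /= rmorph1.
transitivity [seq v * w | v <- map f (1 :: V), w <- map f (words V n)].
  by rewrite -IH /= rmorph1.
rewrite [RHS]map_allpairs allpairs_mapl allpairs_mapr.
by apply: eq_allpairs => v w; rewrite rmorphM.
Qed.

Lemma words_mem (B : pzRingType) (V : seq B) n w :
  w \in words V n -> w \in words V n.+1.
Proof.
move=> hw; apply/wordsP; exists (1, w).
by rewrite /= mem_head hw mul1r.
Qed.

Lemma words_leq (B : pzRingType) (V : seq B) n m :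
  (n <= m)%N -> {subset words V n <= words V m}.
Proof.
move=> /subnKC <-; elim: (m - n)%N => [|j IH] w hw; first by rewrite addn0.
by rewrite addnS; apply: words_mem; apply: IH.
Qed.

Lemma words_sub (B : pzRingType) (V V' : seq B) n :
  {subset V <= V'} -> {subset words V n <= words V' n}.
Proof.
move=> h; elim: n => [|n IH] w; first by [].
move=> /wordsP[[v u] /= [hv hu ->]].
apply/wordsP; exists (v, u); split=> //=; last exact: IH.
by move: hv; rewrite !inE => /orP[->//|/h ->]; rewrite orbT.
Qed.

Lemma words_mulr (B : pzRingType) (V : seq B) n u :
  u \in V -> {in words V n, forall w, u * w \in words V n.+1}.
Proof.
move=> uV w hw; apply/wordsP; exists (u, w).
by rewrite /= inE uV orbT hw.
Qed.

Lemma words_mul (B : pzRingType) (V : seq B) n m :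
  {in words V n & words V m, forall u w, u * w \in words V (n + m)}.
Proof.
elim: n => [|n IH] u w; first by rewrite inE => /eqP -> hw; rewrite mul1r.
move=> /wordsP[[v u'] /= [hv hu' ->]] hw; rewrite -mulrA addSn.
by apply/wordsP; exists (v, u' * w); rewrite /= hv IH.
Qed.

End Words.

Section Filtration.
Variables (K : fieldType) (B : pzRingType) (sigma : {rmorphism K -> B}).
Hypothesis sigmaC : forall c b, sigma c * b = b * sigma c.

Definition wspan (V : seq B) n (x : B) :=
  in_span sigma (fam (s := words V n : seq B^o)) x.

Lemma in_span_mul (T U W : finType) (e : T -> B^o) (f : U -> B^o)
    (h : W -> B^o) (x y : B) :
  (forall t u, in_span sigma h ((e t : B) * f u)) ->
  in_span sigma e x -> in_span sigma f y -> in_span sigma h (x * y).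
Proof.
move=> hh [c ->] [d ->]; rewrite mulr_suml; apply: in_span_sum => t _.
rewrite -[_ *: e t]/(sigma (c t) * e t) -mulrA.
apply: in_spanZ; rewrite mulr_sumr; apply: in_span_sum => u _.
rewrite -[_ *: f u]/(sigma (d u) * f u) mulrA -sigmaC -mulrA.
exact: in_spanZ.
Qed.

Lemma wspan_word V n w : w \in words V n -> wspan V n w.
Proof. exact: (@in_span_mem _ _ _ B^o). Qed.

Lemma wspan_leq V n m x : (n <= m)%N -> wspan V n x -> wspan V m x.
Proof. by move=> nm; apply: in_span_sub; apply: words_leq. Qed.

Lemma wspanM V n m x y : wspan V n x -> wspan V m y -> wspan V (n + m) (x * y).
Proof.
apply: in_span_mul => t u; apply: wspan_word.
by apply: words_mul; apply: mem_nth.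
Qed.

Lemma wspanD V n m x y : wspan V n x -> wspan V m y -> wspan V (maxn n m) (x + y).
Proof.
by move=> hx hy; apply: in_spanD; [apply: wspan_leq hx | apply: wspan_leq hy];
  rewrite ?leq_maxl ?leq_maxr.
Qed.

Lemma wspan_sigma V n c : wspan V n (sigma c).
Proof.
rewrite -[sigma c]mulr1; apply: (@in_spanZ _ _ _ B^o).
by apply: (wspan_leq (leq0n n)); apply: wspan_word; rewrite inE.
Qed.

Definition generating (V : seq B) := forall b, exists n, wspan V n b.

(** All of [V'] lies in the span of words in [V] of one length [m], so passing from [V'] to [V] only
    dilates lengths, which growth does not see. *)
Lemma generating_words V V' : generating V ->
  exists2 m, (0 < m)%N &
    forall n, {in words V' n, forall w, wspan V (m * n) w}.
Proof.
move=> gV; have [m m0 hm] : exists2 m, (0 < m)%N & {in V', forall v, wspan V m v}.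
  elim: V' => [|v V' [m m0 hm]]; first by exists 1%N.
  have [n hn] := gV v; exists (maxn m n); first by rewrite leq_max m0.
  move=> u; rewrite inE => /orP[/eqP ->|/hm hu].
    exact: wspan_leq (leq_maxr _ _) hn.
  exact: wspan_leq (leq_maxl _ _) hu.
exists m => //; elim=> [|n IH] w; first by
  rewrite inE => /eqP ->; rewrite muln0; apply: wspan_word; rewrite inE.
move=> /wordsP[[v u] /= [+ hu ->]]; rewrite mulnS inE => /orP[/eqP ->|hv].
  by rewrite mul1r; apply: wspan_leq (IH _ hu); rewrite leq_addl.
by apply: wspanM; [apply: hm | apply: IH].
Qed.

Variable R : realType.

Lemma gkdim_alg_generating V : generating V ->
  gkdim_alg R sigma = growth R (fun n => span_dim sigma (words V n : seq B^o)).
Proof.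
move=> gV; apply/eqP; rewrite eq_le; apply/andP; split; last first.
  by apply: ereal_sup_ubound; exists V.
apply: ge_ereal_sup => _ [V' _ <-].
have [m m0 hm] := generating_words V' gV.
rewrite -[leLHS]adde0 -[leRHS]adde0.
apply: (@growth_compare R _ _ 1 0 0 m 0) => // n _.
rewrite expn0 muln1 !mul1n; apply: span_dim_mono => w; exact: hm.
Qed.

End Filtration.

Lemma affine_generating (k : fieldType) (A : algType k) :
  affine A -> exists V, generating (GRing.in_alg A) V.
Proof.
move=> [s hs]; exists s.
have sC (c : k) (b : A) : GRing.in_alg A c * b = b * GRing.in_alg A c.
  by rewrite /= mulr_algl mulr_algr.
pose S : {pred A} := fun b => `[< exists n, wspan (GRing.in_alg A) s n b >].
have Sc : subalg_closed S.
  split; first by apply/asboolP; exists 0%N; apply: wspan_word; rewrite inE.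
    move=> c x y /asboolP[n hn] /asboolP[m hm]; apply/asboolP.
    exists (maxn (0 + n) m); apply: wspanD hm; rewrite -mulr_algl.
    by apply: wspanM => //; exact: wspan_sigma.
  move=> x y /asboolP[n hn] /asboolP[m hm]; apply/asboolP.
  by exists (n + m)%N; apply: wspanM.
pose S' : subalgClosed A := HB.pack S (GRing.isSubalgClosed.Build _ _ S Sc).
move=> b; suff /asboolP : b \in S' by [].
apply: hs => v vs; apply/asboolP; exists 1%N; apply: wspan_word.
by apply/wordsP; exists (v, 1); rewrite /= !inE vs orbT mulr1.
Qed.

(** * Comparing dimensions over different rings *)

Section Compare.
Variables (K : fieldType) (B1 B2 : pzRingType).
Variables (s1 : {rmorphism K -> B1}) (s2 : {rmorphism K -> B2}).

(** A relation among the [f1]-images is one among the [f2]-images, so a basis chosen among the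
    [f2]-images comes from elements whose [f1]-images are independent. *)
Lemma span_dim_transfer (X : eqType) (M1 : lmodType B1) (M2 : lmodType B2)
    (f1 : X -> M1) (f2 : X -> M2) (s : seq X) :
  (forall (T : finType) (x : T -> X) (c : T -> K),
    \sum_t s1 (c t) *: f1 (x t) = 0 -> \sum_t s2 (c t) *: f2 (x t) = 0) ->
  (span_dim s2 (map f2 s) <= span_dim s1 (map f1 s))%N.
Proof.
move=> h; have [J [<- iJ _]] := span_dim_basis s2 (map f2 s).
have lt (j : {j | j \in J}) : (val j < size s)%N.
  by rewrite -[size s](size_map f2).
case: s J iJ lt => [|x0 s'] J iJ lt.
  rewrite (_ : #|_| = 0%N)//; apply/eqP; rewrite -leqn0 leqNgt; apply/negP.
  by move=> /card_gt0P[j _]; have := lt j.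
set s := x0 :: s' in J iJ lt *.
apply: (@span_dim_ge _ _ _ M1 _ _ (fun j : {j | j \in J} => f1 (nth x0 s (val j)))).
  move=> c /h hc t; apply: iJ; rewrite -[RHS]hc.
  by apply: eq_bigr => j _; rewrite (nth_map x0).
by move=> t; apply: in_span_mem; apply: map_f; apply: mem_nth.
Qed.

Lemma lift_seq (X Y : Type) (f : X -> Y) (hf : forall y, exists x, y = f x) s :
  exists t, s = map f t.
Proof.
elim: s => [|y s [t ->]]; first by exists [::].
by have [x ->] := hf y; exists (x :: t).
Qed.

End Compare.

Section CompareGK.
Variables (K : fieldType) (B1 B2 : pzRingType).
Variables (s1 : {rmorphism K -> B1}) (s2 : {rmorphism K -> B2}).
Variables (R : realType) (A : pzRingType) (sigma : {rmorphism K -> A}).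

(** [B2] is a quotient of the image of [A] in [B1]. Comparing both through common preimages in [A]
    avoids constructing that quotient map. *)
Lemma gkdim_alg_le (p1 : {rmorphism A -> B1}) (p2 : {rmorphism A -> B2}) :
  (forall c, s1 c = p1 (sigma c)) -> (forall c, s2 c = p2 (sigma c)) ->
  (forall b, exists a, b = p2 a) -> (forall a, p1 a = 0 -> p2 a = 0) ->
  (gkdim_alg R s2 <= gkdim_alg R s1)%E.
Proof.
move=> e1 e2 surj ker; apply: ge_ereal_sup => _ [V2 _ <-].
have [V ->] := lift_seq surj V2.
apply: le_trans (ereal_sup_ubound _); last by exists (map p1 V).
apply: growth_mono => n; rewrite !words_map.
apply: (@span_dim_transfer _ _ _ s1 s2 _ B1^o B2^o) => T x c hc.
rewrite -[RHS](ker (\sum_t sigma (c t) * x t)).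
  by rewrite rmorph_sum; apply: eq_bigr => t _; rewrite rmorphM -e2.
by rewrite rmorph_sum -[RHS]hc; apply: eq_bigr => t _; rewrite rmorphM -e1.
Qed.

(** [N] is a module over the image of [A] in [B1]; letting a basis of the words act on the list [F]
    costs only the constant factor [size F]. *)
Lemma gkdim_mod_le_alg (p1 : {rmorphism A -> B1}) (N : lmodType A) :
  (forall c, s1 c = p1 (sigma c)) ->
  (forall a, p1 a = 0 -> forall x : N, a *: x = 0) ->
  (gkdim_mod R sigma N <= gkdim_alg R s1)%E.
Proof.
move=> e1 ker; apply: ge_ereal_sup => _ [V _ [F _ <-]].
apply: le_trans (ereal_sup_ubound _); last by exists (map p1 V).
rewrite -[leLHS]adde0 -[leRHS]adde0.
apply: (@growth_compare R _ _ (size F) 0 0 1 0) => // n _.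
rewrite !expn0 !muln1 mul1n words_map.
set W := words V n.
have [J [<- _ hJ]] := span_dim_basis s1 (map p1 W : seq B1^o).
have lt (j : {j | j \in J}) : (val j < size W)%N.
  by rewrite -[size W](size_map p1).
pose e (u : 'I_(size F) * {j | j \in J}) : N := W`_(val u.2) *: F`_(u.1).
have -> : (size F * #|{: {j | j \in J}}| = #|{: 'I_(size F) * {j | j \in J}}|)%N.
  by rewrite card_prod card_ord.
apply: (span_dim_le (f := e)) => _ /allpairsP[[w m] /= [hw hm ->]].
have [c hc] := hJ _ (map_f p1 hw).
have -> : w *: m = \sum_j sigma (c j) *: (W`_(val j) *: m).
  apply/eqP; rewrite -subr_eq0.
  under eq_bigr do rewrite scalerA.
  rewrite -scaler_suml -scalerBl ker// rmorphB hc rmorph_sum.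
  apply/eqP; rewrite subr_eq0; apply/eqP; apply: eq_bigr => j _.
  by rewrite rmorphM -e1 (nth_map 0).
have lm : (index m F < size F)%N by rewrite index_mem.
apply: in_span_sum => j _; apply: in_spanZ.
have -> : W`_(val j) *: m = e (Ordinal lm, j) by rewrite /e /= nth_index.
exact: in_span_self.
Qed.

(** The cyclic submodule generated by [x] maps onto [B2], so words applied to the single vector [x]
    already grow as fast. *)
Lemma gkdim_alg_le_mod (p2 : {rmorphism A -> B2}) (N : lmodType A) (x : N) :
  (forall c, s2 c = p2 (sigma c)) ->
  (forall b, exists a, b = p2 a) -> (forall a, a *: x = 0 -> p2 a = 0) ->
  (gkdim_alg R s2 <= gkdim_mod R sigma N)%E.
Proof.
move=> e2 surj ker; apply: ge_ereal_sup => _ [V2 _ <-].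
have [V ->] := lift_seq surj V2.
apply: le_trans (ereal_sup_ubound _); last by exists V => //; exists [:: x].
apply: growth_mono => n; rewrite words_map.
have -> : [seq w *: m | w <- words V n, m <- [:: x]] =
    map (fun w => w *: x) (words V n).
  by elim: (words V n) => //= w W ->.
apply: (@span_dim_transfer _ A B2 sigma s2 _ N B2^o) => T e c hc.
rewrite -[RHS](ker (\sum_t sigma (c t) * e t)).
  by rewrite rmorph_sum; apply: eq_bigr => t _; rewrite rmorphM -e2.
by rewrite scaler_suml -[RHS]hc; apply: eq_bigr => t _; rewrite scalerA.
Qed.

End CompareGK.

(** * Resolutions and Ext *)

Section Linear.
Variable A : pzRingType.

Section Mk.
Variables (U V : lmodType A) (f : U -> V) (hf : linear f).
Definition mk_linear : {linear U -> V} :=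
  HB.pack f (GRing.isLinear.Build A U V *:%R f hf).
Lemma mk_linearE x : mk_linear x = f x. Proof. by []. Qed.
End Mk.

Section Image.
Variables (U V : lmodType A) (g : {linear U -> V}).
Definition image_pred : {pred V} := fun y => `[< exists x, y = g x >].
Fact image_closed : submod_closed image_pred.
Proof.
split; first by apply/asboolP; exists 0; rewrite linear0.
move=> a _ _ /asboolP[x ->] /asboolP[y ->]; apply/asboolP.
by exists (a *: x + y); rewrite linearP.
Qed.
Definition image_submod : submodClosed V :=
  HB.pack image_pred (GRing.isSubmodClosed.Build A V image_pred
    (GRing.submod_closed_semi image_closed)).
Lemma image_submodP y : reflect (exists x, y = g x) (y \in image_submod).
Proof. exact: asboolP. Qed.

Definition ker_pred : {pred U} := fun x => g x == 0.
Fact ker_closed : submod_closed ker_pred.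
Proof.
split; first by rewrite /in_mem /= /ker_pred linear0.
by move=> a x y; rewrite /in_mem /= /ker_pred => /eqP hx /eqP hy;
  rewrite linearP hx hy scaler0 addr0.
Qed.
Definition ker_submod : submodClosed U :=
  HB.pack ker_pred (GRing.isSubmodClosed.Build A U ker_pred
    (GRing.submod_closed_semi ker_closed)).
Lemma ker_submodP x : reflect (g x = 0) (x \in ker_submod).
Proof. exact: eqP. Qed.
End Image.

Section Corestriction.
Variables (U V : lmodType A) (f : {linear U -> V}) (N : submodClosed V).
Hypothesis fN : forall u, f u \in N.
Fact corestr_subproof : linear (fun u => Submod (fN u)).
Proof. by move=> a x y; apply: val_inj; rewrite /= linearP. Qed.
Definition corestr : {linear U -> submod N} := mk_linear corestr_subproof.
End Corestriction.

Fact submod_val_linear (V : lmodType A) (N : submodClosed V) :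
  linear (@submod_val A V N).
Proof. by []. Qed.
Definition submod_incl (V : lmodType A) (N : submodClosed V) :
  {linear submod N -> V} := mk_linear (@submod_val_linear V N).

(** Projectivity is stated for surjections only; corestricting both maps to the image of [g] makes
    it applicable. *)
Lemma proj_lift (P X Y : lmodType A) (g : {linear X -> Y}) (f : {linear P -> Y}) :
  projective_module P -> (forall p, exists x, f p = g x) ->
  exists h : {linear P -> X}, forall p, g (h p) = f p.
Proof.
move=> pP fg.
have gI x : g x \in image_submod g by apply/image_submodP; exists x.
have fI p : f p \in image_submod g by apply/image_submodP.
have [|h hh] := pP _ _ (corestr gI) (corestr fI).
  by case=> y yN; have [x xE] := image_submodP _ _ yN; exists x; apply: val_inj.
by exists h => p; have := congr1 (@submod_val _ _ _) (hh p).
Qed.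

Section QuotientMap.
Variables (M : lmodType A) (N : submodClosed M).
Fact quotmod_pi_linear : linear (@quotmod_pi A M N).
Proof.
move=> a x y; rewrite quotmod_piD; congr (_ + _).
by rewrite -[RHS]/(quotmod_scale a _) quotmod_scale_pi.
Qed.
Definition quotmod_lin : {linear M -> quotmod N} := mk_linear quotmod_pi_linear.
Lemma quotmod_lin_surj : Defs.surj quotmod_lin.
Proof. by move=> y; exists (quotmod_repr y); rewrite mk_linearE quotmod_reprK. Qed.
Lemma quotmod_lin0 x : quotmod_lin x = 0 <-> x \in N.
Proof.
have e0 : quotmod_pi N 0 = 0 := linear0 quotmod_lin.
rewrite mk_linearE -e0 -[x in x \in N]subr0; split => h; exact/quotmod_piP.
Qed.
End QuotientMap.

Section CentralScaling.
Variables (h : A) (hC : forall a, h * a = a * h) (M : lmodType A).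
Fact scaling_subproof : linear (fun x : M => h *: x).
Proof. by move=> a x y; rewrite scalerDr !scalerA hC. Qed.
Definition scaling : {linear M -> M} := mk_linear scaling_subproof.
End CentralScaling.

End Linear.

Section Homotopy.
Variable A : pzRingType.

Lemma res_diff2 (M : lmodType A) (P : proj_resolution M) i x :
  res_diff P i (res_diff P i.+1 x) = 0.
Proof. by apply/res_exact; exists x. Qed.

Lemma res_aug_diff (M : lmodType A) (P : proj_resolution M) x :
  res_aug P (res_diff P 0 x) = 0.
Proof. by apply/res_exact0; exists x. Qed.

Variables (M M' : lmodType A) (P : proj_resolution M) (Q : proj_resolution M').

Definition chain_map (u : forall i, {linear P i -> Q i}) : Prop :=
  forall i x, u i (res_diff P i x) = res_diff Q i (u i.+1 x).

Lemma chain_lift (f : {linear M -> M'}) :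
  exists2 u, chain_map u & forall x, res_aug Q (u 0%N x) = f (res_aug P x).
Proof.
(* The invariant: [v] carries boundaries to cycles, which by exactness lift through the next
   differential of [Q]. *)
pose ok i (v : {linear P i -> Q i}) : Prop :=
  match i return {linear P i -> Q i} -> Prop with
  | 0%N => fun v => forall x, res_aug Q (v (res_diff P 0 x)) = 0
  | i.+1 => fun v => forall x, res_diff Q i (v (res_diff P i.+1 x)) = 0
  end v.
have step i (v : {linear P i -> Q i}) : ok i v ->
    exists w : {linear P i.+1 -> Q i.+1},
      ok i.+1 w /\ (forall x, v (res_diff P i x) = res_diff Q i (w x)).
  move=> okv.
  have [p|w hw] := @proj_lift A _ _ _ (res_diff Q i) (v \o res_diff P i)
    (@res_proj _ _ P i.+1).
    by case: i v okv p => [|i] v okv p; [apply/res_exact0|apply/res_exact];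
      apply: okv.
  exists w; split => //= x; by rewrite hw /= res_diff2 linear0.
have [u0 hu0] : exists u0 : {linear P 0%N -> Q 0%N},
    forall x, res_aug Q (u0 x) = f (res_aug P x).
  apply: (@proj_lift A _ _ _ (res_aug Q) (f \o res_aug P) (@res_proj _ _ P 0)) => p.
  exact: res_surj.
have ok0 : ok 0%N u0 by move=> x; rewrite hu0 res_aug_diff linear0.
pose next i (s : {v | ok i v}) := cid (step i (projT1 s) (projT2 s)).
(* Each stage is stored with its invariant, on which the choice of the next stage depends. *)
pose fix build i : {v | ok i v} :=
  match i return {v | ok i v} with
  | 0%N => exist _ u0 ok0
  | j.+1 => exist _ (projT1 (next j (build j))) (projT2 (next j (build j))).1
  end.
exists (fun i => projT1 (build i)); last exact: hu0.
by move=> i x /=; have [_ ->] := projT2 (next i (build i)).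
Qed.

Lemma null_homotopy (u : forall i, {linear P i -> Q i}) : chain_map u ->
  (forall x, res_aug Q (u 0%N x) = 0) ->
  exists s : forall i, {linear P i -> Q i.+1},
    (forall x, u 0%N x = res_diff Q 0 (s 0%N x)) /\
    (forall i x, u i.+1 x = res_diff Q i.+1 (s i.+1 x) + s i (res_diff P i x)).
Proof.
move=> cu u0.
(* This condition makes [u i.+1] minus [v] after the differential take values in cycles, so that the
   next homotopy component exists. *)
pose ok i (v : {linear P i -> Q i.+1}) : Prop :=
  forall x, res_diff Q i (v (res_diff P i x)) = u i (res_diff P i x).
have step i (v : {linear P i -> Q i.+1}) : ok i v ->
    exists w : {linear P i.+1 -> Q i.+2}, ok i.+1 w /\
      (forall x, u i.+1 x = res_diff Q i.+1 (w x) + v (res_diff P i x)).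
  move=> okv.
  have [p|w hw] := @proj_lift A _ _ _ (res_diff Q i.+1)
    (u i.+1 \- (v \o res_diff P i)) (@res_proj _ _ P i.+1).
    by apply/res_exact => /=; rewrite linearB /= okv cu subrr.
  have hw' x : u i.+1 x = res_diff Q i.+1 (w x) + v (res_diff P i x).
    by rewrite hw /= subrK.
  exists w; split => // x; rewrite hw' res_diff2 linear0 addr0 //.
have [s0 hs0] : exists s0 : {linear P 0%N -> Q 1%N},
    forall x, res_diff Q 0 (s0 x) = u 0%N x.
  apply: (@proj_lift A _ _ _ (res_diff Q 0) (u 0%N) (@res_proj _ _ P 0)) => p.
  by apply/res_exact0.
have ok0 : ok 0%N s0 by move=> x; rewrite hs0.
pose next i (s : {v | ok i v}) := cid (step i (projT1 s) (projT2 s)).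
pose fix build i : {v | ok i v} :=
  match i return {v | ok i v} with
  | 0%N => exist _ s0 ok0
  | j.+1 => exist _ (projT1 (next j (build j))) (projT2 (next j (build j))).1
  end.
exists (fun i => projT1 (build i)); split=> [x|i x] /=; first by rewrite hs0.
by have [_ <-] := projT2 (next i (build i)).
Qed.

End Homotopy.

(** * The mapping cone of a central element *)

Section Cone.
Variables (A : pzRingType) (h : A) (hC : forall a, h * a = a * h).
Variables (M : lmodType A) (P : proj_resolution M).
Hypothesis h_inj : forall x : M, h *: x = 0 -> x = 0.

Definition mod_by : lmodType A := quotmod (image_submod (scaling hC M)).

(** The cone of multiplication by [h] on [P]. As [h] is injective on [M], it resolves M/hM, and the
    two connecting statements [ext_cone_surj] and [ext_cone_inj] come from explicit cochains on it
    rather than from a long exact sequence. *)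
Definition cone_mod (i : nat) : lmodType A :=
  if i is j.+1 then (P j.+1 * P j)%type : lmodType A else P 0%N.

Fact cone_diff0_linear :
  linear (fun z : cone_mod 1 => (res_diff P 0 z.1 + h *: z.2 : cone_mod 0)).
Proof.
move=> a x y; rewrite /= !linearP /= !scalerDr !scalerA hC.
by rewrite -!addrA; congr (_ + _); rewrite addrCA.
Qed.

Fact cone_diffS_linear i : linear (fun z : cone_mod i.+2 =>
  ((res_diff P i.+1 z.1 + h *: z.2, - res_diff P i z.2) : cone_mod i.+1)).
Proof.
move=> a x y; apply: injective_projections; rewrite /= !linearP /=.
  rewrite !scalerDr !scalerA hC -!addrA; congr (_ + _).
  by rewrite addrCA.
by rewrite ?opprD ?scalerN.
Qed.

Definition cone_diff (i : nat) : {linear cone_mod i.+1 -> cone_mod i} :=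
  match i return {linear cone_mod i.+1 -> cone_mod i} with
  | 0%N => mk_linear cone_diff0_linear
  | j.+1 => mk_linear (cone_diffS_linear (i := j))
  end.

Definition cone_aug : {linear cone_mod 0 -> mod_by} :=
  (quotmod_lin _ \o res_aug P)%FUN.

Lemma projective_pair (U V : lmodType A) :
  projective_module U -> projective_module V ->
  projective_module ((U * V)%type : lmodType A).
Proof.
move=> pU pV X Y g f sg.
have lU : linear (fun u : U => f (u, 0)).
  by move=> a x y; rewrite -linearP; congr (f _); apply: injective_projections;
    rewrite /= ?scaler0 ?addr0.
have lV : linear (fun v : V => f (0, v)).
  by move=> a x y; rewrite -linearP; congr (f _); apply: injective_projections;
    rewrite /= ?scaler0 ?addr0.
have [hU eU] := pU _ _ g (mk_linear lU) sg.
have [hV eV] := pV _ _ g (mk_linear lV) sg.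
have lh : linear (fun z : U * V => hU z.1 + hV z.2).
  by move=> a x y; rewrite /= !linearP scalerDr addrACA.
exists (mk_linear lh) => -[u v]; rewrite /= linearD eU eV !mk_linearE -linearD.
by congr (f _); apply: injective_projections; rewrite /= ?addr0 ?add0r.
Qed.

Lemma cone_proj i : projective_module (cone_mod i).
Proof.
case: i => [|i]; first exact: res_proj.
by apply: projective_pair; apply: res_proj.
Qed.

Lemma cone_surj : Defs.surj cone_aug.
Proof.
move=> y; have [m ->] := quotmod_lin_surj y.
by have [x ->] := res_surj P m; exists x.
Qed.

Lemma cone_exact0 : exact_pair (cone_diff 0) cone_aug.
Proof.
move=> x; split.
  move/(quotmod_lin0 _ _) => /image_submodP[m hm].
  have [y yE] := res_surj P m.
  have /res_exact0[z zE] : res_aug P (x - h *: y) = 0.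
    by rewrite linearB linearZ /= -yE hm subrr.
  by exists (z, y); rewrite /= -zE subrK.
move=> [[z y] ->]; apply/(quotmod_lin0 _ _)/image_submodP.
by exists (res_aug P y); rewrite /= linearD linearZ /= res_aug_diff add0r.
Qed.

Lemma cone_exact i : exact_pair (cone_diff i.+1) (cone_diff i).
Proof.
move=> [x y]; split; last first.
  move=> [[z w] [-> ->]]; case: i {x y} z w => [|i] z w /=.
    by rewrite linearD linearZ /= res_diff2 scalerN add0r subrr.
  apply: injective_projections; rewrite /= ?linearD ?linearZ /= ?res_diff2.
    by rewrite scalerN add0r subrr.
  by rewrite linearN res_diff2 !oppr0.
(* Once [y] is the boundary of [y'], the element x + h y' is a cycle; if it bounds [z], then (z,
   -y') is the required preimage. *)
suff fin (y' : P i.+1) : y = res_diff P i y' -> res_diff P i x + h *: y = 0 ->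
    exists u, (x, y) = cone_diff i.+1 u.
  case: i x y fin => [|i] x y fin /=.
    (* In lowest degree [y] need not be a cycle of [P] a priori; injectivity of [h] on [M] enters
       here. *)
    move=> e; have /res_exact0[y' hy'] : res_aug P y = 0.
      apply: h_inj; rewrite -linearZ -[RHS](linear0 (res_aug P)) -e linearD.
      by rewrite /= res_aug_diff add0r.
    exact: (fin y').
  by case=> e /eqP; rewrite oppr_eq0 => /eqP/res_exact[y' hy']; apply: (fin y').
move=> yE e; have /res_exact[z zE] : res_diff P i (x + h *: y') = 0.
  by rewrite linearD linearZ /= -yE.
exists (z, - y'); apply: injective_projections; rewrite /= ?linearN ?opprK//.
by rewrite scalerN -zE addrK.
Qed.

Definition cone : proj_resolution mod_by :=
  ProjResolution cone_proj cone_surj cone_exact0 cone_exact.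

Variable W : lmodType A.

(** Exactness of Ext^i(M, W) -h-> Ext^i(M, W) -> Ext^(i+1)(M/hM, W) in the middle: the cocycle [f],
    put on the second component of the cone, bounds some [H], whose two components give [a] and
    [b]. *)
Lemma ext_cone_surj i (f : {linear P i -> W}) :
  hom_cocycle f -> ~ Ext_neq0 mod_by W i.+1 ->
  exists2 a : {linear P i -> W}, hom_cocycle a &
    exists2 b : {linear P i -> W}, hom_coboundary b &
      forall x, f x = h *: a x + b x.
Proof.
move=> cf nE.
have lF : linear (fun z : cone i.+1 => f z.2).
  by move=> a x y; rewrite linearP.
pose F : {linear cone i.+1 -> W} := mk_linear lF.
have cF : hom_cocycle F.
  by case=> z w; rewrite /F /= linearN cf oppr0.
have : hom_coboundary F by apply: contra_notP nE => nF; exists cone, F.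
(* Degree 0 is separate because the cone has a single component there. *)
case: i f cf nE lF @F cF => [|i] f cf nE lF F cF [H hH].
  exists H => [x|].
    by have := hH (x, 0); rewrite /F /= scaler0 addr0 linear0.
  exists \0 => // y; rewrite addr0.
  by have := hH (0, y); rewrite /F /= linear0 add0r linearZ.
have la : linear (fun u : P i.+1 => H (u, 0)).
  by move=> a x y; rewrite -linearP; congr (H _); apply: injective_projections;
    rewrite /= ?scaler0 ?addr0.
have lb : linear (fun u : P i => H (0, u)).
  by move=> a x y; rewrite -linearP; congr (H _); apply: injective_projections;
    rewrite /= ?scaler0 ?addr0.
have HE u v : H (u, v) = mk_linear la u + mk_linear lb v.
  by rewrite !mk_linearE -linearD; congr (H _); apply: injective_projections;
    rewrite /= ?addr0 ?add0r.
exists (mk_linear la) => [x|].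
  by have := hH (x, 0); rewrite /F /= HE !linear0 scaler0 !addr0.
exists (\- (mk_linear lb \o res_diff P i)).
  by exists (\- mk_linear lb) => x.
move=> y; have := hH (0, y); rewrite /F /= HE linear0 add0r => ->.
by rewrite linearZ linearN.
Qed.

(** If h f is the coboundary of [b], the pair (f, b) is a cocycle on the cone. It bounds when
    Ext^i(M/hM, W) vanishes, and the first component of a bounding cochain shows that [f] is a
    coboundary. *)
Lemma ext_cone_inj i (f : {linear P i -> W}) :
  hom_cocycle f -> ~ Ext_neq0 mod_by W i ->
  hom_coboundary (scaling hC W \o f : {linear P i -> W}) -> hom_coboundary f.
Proof.
case: i f => [|i] f cf nE /=.
  move=> hf; apply: contrapT => nf; apply: nE; exists cone, f; split => //.
  by case=> z w; rewrite /= linearD linearZ /= cf hf addr0.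
move=> [b hb].
have lF : linear (fun z : cone i.+1 => f z.1 + b z.2).
  by move=> a x y; rewrite !linearP scalerDr addrACA.
pose F : {linear cone i.+1 -> W} := mk_linear lF.
have cF : hom_cocycle F.
  case=> z w; rewrite /F /= linearD cf add0r linearN -hb linearZ /=.
  by rewrite subrr.
have : hom_coboundary F by apply: contra_notP nE => nF; exists cone, F.
case: i f b cf nE hb lF @F cF => [|i] f b cf nE hb lF F cF [H hH].
  exists H => x; have := hH (x, 0).
  by rewrite /F /= scaler0 addr0 linear0 addr0.
have la : linear (fun u : P i.+1 => H (u, 0)).
  by move=> a x y; rewrite -linearP; congr (H _); apply: injective_projections;
    rewrite /= ?scaler0 ?addr0.
exists (mk_linear la) => x; have := hH (x, 0).
by rewrite /F /= scaler0 (linear0 b) (linear0 (res_diff P i)) oppr0 !addr0.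
Qed.

End Cone.

Section Independence.
Variables (A : pzRingType) (M W : lmodType A).

(** A nonzero Ext class comes with an arbitrary resolution [P]. This transports the question whether
    a cocycle bounds to a resolution [L] of choice. *)
Lemma ext_compare (P L : proj_resolution M) :
  exists2 u : forall i, {linear L i -> P i}, chain_map u &
    forall i (f : {linear P i -> W}), hom_cocycle f ->
      hom_coboundary (f \o u i : {linear L i -> W}) -> hom_coboundary f.
Proof.
have [u cu u0] := chain_lift L P (idfun : {linear M -> M}).
have [v cv v0] := chain_lift P L (idfun : {linear M -> M}).
exists u => // i f cf.
(* A homotopy from the identity of [P] to the composite of [v] and [u], since both cover the
   identity of [M]. *)
have [s [s0 sS]] : exists s : forall i, {linear P i -> P i.+1},
    (forall x, u 0%N (v 0%N x) - x = res_diff P 0 (s 0%N x)) /\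
    (forall i x, u i.+1 (v i.+1 x) - x =
       res_diff P i.+1 (s i.+1 x) + s i (res_diff P i x)).
  apply: (@null_homotopy _ _ _ P P (fun i => (u i \o v i) \- idfun)).
    by move=> j x; rewrite /= linearB cv cu.
  by move=> x; rewrite /= linearB /= u0 v0 subrr.
case: i f cf => [|i] f cf /= => [h x|[b hb]].
  have := congr1 f (s0 x); rewrite linearB h cf sub0r => /eqP.
  by rewrite oppr_eq0 => /eqP.
exists ((b \o v i) \- (f \o s i)) => x.
have := congr1 f (sS i x); rewrite linearB hb linearD cf add0r -cv /= => <-.
by rewrite opprB addrC subrK.
Qed.

(** Over the zero module the identity of any resolution covers zero, hence is null-homotopic. *)
Lemma Ext_neq0_zero j : (forall x : M, x = 0) -> ~ Ext_neq0 M W j.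
Proof.
move=> M0 [P [f [cf]]]; apply.
have [s [s0 sS]] : exists s : forall i, {linear P i -> P i.+1},
    (forall x, x = res_diff P 0 (s 0%N x)) /\
    (forall i x, x = res_diff P i.+1 (s i.+1 x) + s i (res_diff P i x)).
  exact: (@null_homotopy _ _ _ P P (fun i => idfun)).
case: j f cf => [|j] f cf => [x|]; first by rewrite (s0 x) cf.
by exists (f \o s j) => x; rewrite /= [in LHS](sS j x) linearD cf add0r.
Qed.

End Independence.

(** * Noetherian modules *)

Lemma submodB (A : pzRingType) (M : lmodType A) (N : submodClosed M) x y :
  x \in N -> y \in N -> x - y \in N.
Proof. by move=> xN yN; rewrite -scaleN1r rpredD ?rpredZ. Qed.

Section Noetherian.
Variable A : pzRingType.

Section Mspan.
Variable M : lmodType A.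
Implicit Types (s t : seq M) (x y : M).

Fixpoint mspan s x : Prop :=
  if s is y :: s' then exists a : A, mspan s' (x - a *: y) else x = 0.

Lemma mspan0 s : mspan s 0.
Proof. by elim: s => //= y s IH; exists 0; rewrite scale0r subr0. Qed.

Lemma mspanD s x y : mspan s x -> mspan s y -> mspan s (x + y).
Proof.
elim: s x y => [|z s IH] x y /=; first by move=> -> ->; rewrite addr0.
move=> [a ha] [b hb]; exists (a + b).
by rewrite scalerDl opprD addrACA; apply: IH.
Qed.

Lemma mspanZ s a x : mspan s x -> mspan s (a *: x).
Proof.
elim: s x => [|z s IH] x /=; first by move=> ->; rewrite scaler0.
by move=> [b hb]; exists (a * b); rewrite -scalerA -scalerBr; apply: IH.
Qed.

Lemma mspan_mem s x : x \in s -> mspan s x.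
Proof.
elim: s => //= y s IH; rewrite inE => /orP[/eqP ->|/IH hx].
  by exists 1; rewrite scale1r subrr; apply: mspan0.
by exists 0; rewrite scale0r subr0.
Qed.

Lemma mspan_trans s t x : (forall y, y \in s -> mspan t y) ->
  mspan s x -> mspan t x.
Proof.
elim: s x => [|z s IH] x h /=; first by move=> ->; apply: mspan0.
move=> [a ha]; rewrite -[x](subrK (a *: z)); apply: mspanD.
  by apply: IH => // y ys; apply: h; rewrite inE ys orbT.
by apply: mspanZ; apply: h; rewrite mem_head.
Qed.

Lemma mspanP s x :
  mspan s x <-> exists a : 'I_(size s) -> A, x = \sum_(i < size s) a i *: s`_i.
Proof.
elim: s x => [|z s IH] x /=.
  split=> [->|[a ->]]; last by rewrite big_ord0.
  by exists (fun=> 0); rewrite big_ord0.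
split=> [[a /IH[b hb]]|[b ->]].
  exists (fun i => if unlift ord0 i is Some j then b j else a).
  rewrite big_ord_recl unlift_none /= -[LHS](subrK (a *: z)) hb addrC.
  by congr (_ + _); apply: eq_bigr => i _; rewrite liftK.
exists (b ord0); apply/IH; exists (fun i => b (lift ord0 i)).
by rewrite big_ord_recl /= addrAC subrr add0r.
Qed.

Definition mspan_pred s : {pred M} := fun x => `[< mspan s x >].
Fact mspan_closed s : submod_closed (mspan_pred s).
Proof.
split; first by apply/asboolP; apply: mspan0.
move=> a x y /asboolP hx /asboolP hy; apply/asboolP.
by apply: mspanD hy; apply: mspanZ.
Qed.
Definition mspan_submod s : submodClosed M :=
  HB.pack (mspan_pred s) (GRing.isSubmodClosed.Build A M (mspan_pred s)
    (GRing.submod_closed_semi (mspan_closed s))).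
Lemma mspan_submodP s x : reflect (mspan s x) (x \in mspan_submod s).
Proof. exact: asboolP. Qed.

Definition fg_submod (N : submodClosed M) : Prop :=
  exists2 s, {subset s <= N} & forall x, x \in N -> mspan s x.

Lemma noetherian_fg : noetherian_module M -> forall N, fg_submod N.
Proof.
move=> nM N; apply: contrapT => nfg.
have step (s : {s : seq M | {subset s <= N}}) :
    exists x, x \in N /\ ~ mspan (sval s) x.
  apply: contrapT => h; apply: nfg; exists (sval s); first exact: (svalP s).
  by move=> x xN; apply: contrapT => hx; apply: h; exists x.
have [f hf] := choice step.
have ext (s : {s : seq M | {subset s <= N}}) : {subset f s :: sval s <= N}.
  by move=> x; rewrite inE => /orP[/eqP ->|]; [case: (hf s) | apply: (svalP s)].
have sub0 : {subset [::] <= N} by [].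
pose fix c n : {s : seq M | {subset s <= N}} :=
  if n is m.+1 then exist (fun s : seq M => {subset s <= N}) _ (ext (c m))
  else exist (fun s : seq M => {subset s <= N}) [::] sub0.
have [|n hn] := nM (fun i => mspan_submod (sval (c i))).
  move=> i x /mspan_submodP hx; apply/mspan_submodP.
  by apply: mspan_trans hx => y ys; apply: mspan_mem; rewrite inE ys orbT.
have [_] := hf (c n); apply; apply/mspan_submodP.
by rewrite -(hn n.+1)//; apply/mspan_submodP; apply: mspan_mem; rewrite mem_head.
Qed.

End Mspan.

Hypothesis nA : forall I : submodClosed A^o, fg_submod I.

(** Induction on [s]: the coefficients of the first generator [z] on [N] form a left ideal [I],
    finitely generated by hypothesis, and the elements of [N] in the span of the remaining
    generators form a submodule [J] covered by induction. *)
Lemma fg_submod_mspan (M : lmodType A) (s : seq M) (N : submodClosed M) :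
  (forall x, x \in N -> mspan s x) -> fg_submod N.
Proof.
elim: s N => [|z s IH] N hN.
  by exists [::] => // x /hN.
pose I : {pred A^o} := fun a : A => `[< exists2 y, mspan s y & a *: z + y \in N >].
have Ic : submod_closed I.
  split; first by apply/asboolP; exists 0; rewrite ?scale0r ?addr0 ?rpred0//; apply: mspan0.
  move=> a b c /asboolP[y hy yN] /asboolP[y' hy' yN']; apply/asboolP.
  exists (a *: y + y'); first by apply: mspanD hy'; apply: mspanZ.
  rewrite scalerDl -[((a *: b : A^o) : A) *: z]/((a * b) *: z) -scalerA addrACA -scalerDr.
  by rewrite rpredD ?rpredZ.
pose I' : submodClosed A^o := HB.pack I (GRing.isSubmodClosed.Build A A^o I
    (GRing.submod_closed_semi Ic)).
have [ia iaI iaG] := nA I'.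
pose J : {pred M} := fun x => (x \in N) && `[< mspan s x >].
have Jc : submod_closed J.
  split; first by apply/andP; split; [apply: rpred0 | apply/asboolP; apply: mspan0].
  move=> a x y /andP[xN /asboolP hx] /andP[yN /asboolP hy]; apply/andP.
  by split; [rewrite rpredD ?rpredZ | apply/asboolP; apply: mspanD hy; apply: mspanZ].
pose J' : submodClosed M := HB.pack J (GRing.isSubmodClosed.Build A M J
    (GRing.submod_closed_semi Jc)).
have [|t tJ tG] := IH J'; first by move=> x /andP[_ /asboolP].
(* Lifts to [N] of the generators of the coefficient ideal; subtracting a combination of them moves
   any element of [N] into [J]. *)
have [u uN hu] : exists2 u : seq M, {subset u <= N} &
    forall a : A, @mspan A^o ia a -> exists x, mspan u x /\ mspan s (a *: z - x).
  elim: ia iaI {iaG} => [|b ia IHa] iaI.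
    exists [::] => // a /= ->; exists 0; split=> //.
    by rewrite scale0r subr0; apply: mspan0.
  have [|u uN hu] := IHa; first by move=> a ha; apply: iaI; rewrite inE ha orbT.
  have /asboolP[y hy yN] := iaI b (mem_head _ _).
  exists (((b : A) *: z + y) :: u).
    by move=> x; rewrite inE => /orP[/eqP ->//|/uN].
  move=> a /= [c /hu[x [xu hx]]]; exists (x + (c : A) *: ((b : A) *: z + y)); split.
    by exists c; rewrite addrK.
  have -> : a *: z - (x + (c : A) *: ((b : A) *: z + y)) =
      ((a - (c : A) * (b : A)) *: z - x) - (c : A) *: y.
    rewrite scalerBl scalerDr -scalerA !opprD.
    by rewrite !addrA; congr (_ - _); rewrite -!addrA; congr (_ + _); rewrite addrC.
  by apply: mspanD hx _; rewrite -scaleNr; apply: mspanZ.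
exists (u ++ t).
  by move=> x; rewrite mem_cat => /orP[/uN//|/tJ/andP[]].
move=> x xN; have [a /= ha] := hN _ xN.
have aI : a \in I'.
  apply/asboolP; exists (x - a *: z) => //; by rewrite addrC subrK.
have [y [yu hy]] := hu _ (iaG _ aI).
have usub v : mspan u v -> mspan (u ++ t) v.
  by apply: mspan_trans => w wu; apply: mspan_mem; rewrite mem_cat wu.
have yN : y \in N.
  have hN' : {subset u <= N} := uN.
  suff : y \in mspan_submod u -> y \in N by apply; apply/mspan_submodP.
  move=> _; elim: (u) y yu hN' {hy} => [|v w IHw] y /=; first by move=> -> _; apply: rpred0.
  move=> [c hc] hN'; rewrite -[y](subrK (c *: v)) rpredD//.
    by apply: IHw => // v' hv'; apply: hN'; rewrite inE hv' orbT.
  by rewrite rpredZ// hN'// mem_head.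
rewrite -[x](subrK y); apply: mspanD (usub _ yu).
have : mspan t (x - y).
  apply: tG; apply/andP; split; first exact: submodB.
  apply/asboolP; rewrite (_ : x - y = (x - a *: z) + (a *: z - y)).
    exact: mspanD.
  by rewrite addrA subrK.
by apply: mspan_trans => w wt; apply: mspan_mem; rewrite mem_cat wt orbT.
Qed.

Lemma fg_moduleP (M : lmodType A) :
  fg_module M <-> exists s : seq M, forall x, mspan s x.
Proof.
by split=> -[s hs]; exists s => x; apply/mspanP.
Qed.

Lemma fg_submodule (M : lmodType A) (N : submodClosed M) :
  fg_module M -> fg_module (submod N).
Proof.
move=> /fg_moduleP[s hs]; have [|t tN tG] := @fg_submod_mspan M s N.
  by move=> x _; apply: hs.
apply/fg_moduleP.
have [t' tE] : exists t', t = map (@submod_val _ _ N) t'.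
  elim: t tN {tG} => [|x t IH] tN; first by exists [::].
  have [|t' ->] := IH; first by move=> y yt; apply: tN; rewrite inE yt orbT.
  by exists (Submod (tN x (mem_head _ _)) :: t').
exists t' => -[x xN]; have := tG _ xN; rewrite tE {tE tN tG}.
elim: t' x xN => [|y t' IH] x xN /=; first by move=> x0; apply: val_inj.
by move=> [a ha]; exists a; have := IH _ _ ha; apply; apply: submodB => //;
  apply: rpredZ; case: (y).
Qed.

Lemma fg_image (M M' : lmodType A) (g : {linear M -> M'}) :
  Defs.surj g -> fg_module M -> fg_module M'.
Proof.
move=> sg /fg_moduleP[s hs]; apply/fg_moduleP; exists (map g s) => y.
have [x ->] := sg y; have := hs x; elim: s x {hs} => [|z s IH] x /=.
  by move=> ->; rewrite linear0.
by move=> [a ha]; exists a; rewrite -linearZ -linearB; apply: IH.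
Qed.

Lemma fg_row r : fg_module ('rV[A]_r : lmodType A).
Proof.
apply/fg_moduleP; exists [seq delta_mx 0 i | i <- enum 'I_r] => v.
rewrite (row_sum_delta v); apply: (big_ind (mspan _)).
- exact: mspan0.
- exact: mspanD.
- by move=> i _; apply: mspanZ; apply: mspan_mem; rewrite map_f ?mem_enum.
Qed.

Lemma row_projective r : projective_module ('rV[A]_r : lmodType A).
Proof.
move=> X Y g f sg.
have [x hx] := choice (fun i => sg (f (delta_mx 0 i))).
have lh : linear (fun v : 'rV[A]_r => \sum_i v 0 i *: x i).
  move=> a u v; rewrite scaler_sumr -big_split; apply: eq_bigr => i _.
  by rewrite !mxE scalerDl scalerA.
exists (mk_linear lh) => v; rewrite mk_linearE linear_sum.
rewrite [in RHS](row_sum_delta v) linear_sum; apply: eq_bigr => i _.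
by rewrite !linearZ /= hx.
Qed.

Lemma row_cover (M : lmodType A) : fg_module M ->
  exists r, exists g : {linear 'rV[A]_r -> M}, Defs.surj g.
Proof.
move=> [s hs]; exists (size s).
have lh : linear (fun v : 'rV[A]_(size s) => \sum_i v 0 i *: s`_i).
  move=> a u v; rewrite scaler_sumr -big_split; apply: eq_bigr => i _.
  by rewrite !mxE scalerDl scalerA.
exists (mk_linear lh) => y; have [a ->] := hs y.
by exists (\row_i a i); rewrite mk_linearE; apply: eq_bigr => i _; rewrite mxE.
Qed.

(** Finite ranks are the point: a cochain into [A] is then determined by finitely many values, so
    cochains live in a space of countable dimension over [k]. *)
Lemma free_resolution (M : lmodType A) : fg_module M ->
  exists P : proj_resolution M, forall i, exists r, P i = 'rV[A]_r :> lmodType A.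
Proof.
move=> fgM.
pose st := {N : lmodType A | fg_module N}.
pose rk (N : st) := projT1 (cid (row_cover (svalP N))).
pose cov (N : st) : {linear 'rV[A]_(rk N) -> sval N} :=
  projT1 (cid (projT2 (cid (row_cover (svalP N))))).
have cov_surj (N : st) : Defs.surj (cov N) :=
  projT2 (cid (projT2 (cid (row_cover (svalP N))))).
pose next (N : st) : st :=
  exist (fun N : lmodType A => fg_module N) _
    (@fg_submodule _ (ker_submod (cov N)) (fg_row (rk N))).
pose fix K n : st := if n is m.+1 then next (K m) else exist _ M fgM.
pose L i : lmodType A := 'rV[A]_(rk (K i)).
pose d i : {linear L i.+1 -> L i} := (submod_incl _ \o cov (K i.+1))%FUN.
have ex0 : exact_pair (d 0%N) (cov (K 0%N)).
  move=> v; split => [v0|[u ->]]; last first.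
    by rewrite /d /=; case: (cov _ u) => w wK; apply/ker_submodP.
  have vK : v \in ker_submod (cov (K 0%N)) by apply/ker_submodP.
  have [u hu] := cov_surj (K 1%N) (Submod vK).
  by exists u; rewrite /d /= -hu.
have exS i : exact_pair (d i.+1) (d i).
  move=> v; split => [v0|[u ->]].
    have vK : v \in ker_submod (cov (K i.+1)).
      by apply/ker_submodP; apply: val_inj.
    have [u hu] := cov_surj (K i.+2) (Submod vK).
    by exists u; rewrite /d /= -hu.
  rewrite /d /=; case: (cov (K i.+2) u) => w wK /=.
  by have /ker_submodP -> := wK.
exists (@ProjResolution A M L d (cov (K 0%N)) (fun i => @row_projective _)
  (cov_surj (K 0%N)) ex0 exS) => i.
by exists (rk (K i)).
Qed.

End Noetherian.

Section NoetherianInduction.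
Variables (A : pzRingType) (M : lmodType A).
Hypothesis fgM : forall N : submodClosed M, fg_submod N.

(** Otherwise choice yields a strictly ascending chain, whose union is generated by finitely many
    elements that already lie in one of its terms. *)
Lemma noetherian_ind (Q : submodClosed M -> Prop) :
  (forall N : submodClosed M, (forall N' : submodClosed M,
     {subset N <= N'} -> ~ {subset N' <= N} -> Q N') -> Q N) ->
  forall N, Q N.
Proof.
move=> ind N0; apply: contrapT => nQ0.
have step (N : {N : submodClosed M | ~ Q N}) :
      exists N' : {N : submodClosed M | ~ Q N},
    {subset sval N <= sval N'} /\ ~ {subset sval N' <= sval N}.
  case: N => N nQ /=; apply: contrapT => h; apply: nQ; apply: ind => N' s1 s2.
  by apply: contrapT => nQ'; apply: h; exists (exist (fun N : submodClosed M => ~ Q N) N' nQ').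
have [f hf] := choice step.
pose c n := sval (iter n f (exist (fun N : submodClosed M => ~ Q N) N0 nQ0)).
have cS n m : (n <= m)%N -> {subset c n <= c m}.
  move=> /subnKC <-; elim: (m - n)%N => [|j IH] x; first by rewrite addn0.
  by rewrite addnS => /IH; apply: (hf _).1.
pose U : {pred M} := fun x => `[< exists n, x \in c n >].
have Uc : submod_closed U.
  split; first by apply/asboolP; exists 0%N; apply: rpred0.
  move=> a x y /asboolP[n hx] /asboolP[m hy]; apply/asboolP.
  exists (maxn n m); rewrite rpredD ?rpredZ//.
    by apply: cS hx; rewrite leq_maxl.
  by apply: cS hy; rewrite leq_maxr.
pose U' : submodClosed M := HB.pack U (GRing.isSubmodClosed.Build A M U
    (GRing.submod_closed_semi Uc)).
have [s sU sG] := fgM U'.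
have [n hn] : exists n, {subset s <= c n}.
  elim: s sU {sG} => [|x s IH] sU; first by exists 0%N.
  have [|n hn] := IH; first by move=> y ys; apply: sU; rewrite inE ys orbT.
  have /asboolP[m hm] := sU x (mem_head _ _).
  exists (maxn n m) => y; rewrite inE => /orP[/eqP ->|/hn hy].
    by apply: cS hm; rewrite leq_maxr.
  by apply: cS hy; rewrite leq_maxl.
have [_] := hf (iter n f (exist (fun N : submodClosed M => ~ Q N) N0 nQ0)); apply => x hx.
have : mspan s x by apply: sG; apply/asboolP; exists n.+1.
rewrite -/(c n); elim: s hn x {sU sG hx} => [|y s IH] hn x /=.
  by move=> ->; apply: rpred0.
move=> [a ha]; rewrite -[x](subrK (a *: y)) rpredD ?rpredZ//.
  by apply: IH => // z zs; apply: hn; rewrite inE zs orbT.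
by apply: hn; rewrite mem_head.
Qed.

End NoetherianInduction.

Definition fg_ideals (C : pzRingType) := forall I : submodClosed C^o, fg_submod I.

Lemma mspan_sub (A : pzRingType) (M : lmodType A) (N : submodClosed M) s x :
  {subset s <= N} -> mspan s x -> x \in N.
Proof.
elim: s x => [|y s IH] x /= sN; first by move=> ->; apply: rpred0.
move=> [a ha]; rewrite -[x](subrK (a *: y)) rpredD ?rpredZ//.
  by apply: IH => // z zs; apply: sN; rewrite inE zs orbT.
by apply: sN; rewrite mem_head.
Qed.

Lemma fg_ideals_field (k : fieldType) : fg_ideals k.
Proof.
move=> I; have [[x xI x0]|h] := pselect (exists2 x, x \in I & x != 0 :> k).
  exists [:: x] => [y|y _]; first by rewrite inE => /eqP ->.
  exists ((y : k) / x) => /=.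
  by rewrite -[_ *: _]/((y : k) / x * x) divfK// subrr.
exists [::] => // y yI /=; apply: contrapT => /eqP y0; apply: h.
by exists y.
Qed.

Lemma fg_ideals_surj (C D : pzRingType) (f : {rmorphism C -> D}) :
  (forall y, exists x, y = f x) -> fg_ideals C -> fg_ideals D.
Proof.
move=> sf fgC I.
pose J : {pred C^o} := fun x => (f x : D^o) \in I.
have Jc : submod_closed J.
  split; first by rewrite /in_mem /= /J rmorph0 rpred0.
  move=> a x y hx hy; rewrite /in_mem /= /J rmorphD rpredD// rmorphM.
  exact: (@rpredZ D D^o).
pose J' : submodClosed C^o := HB.pack J (GRing.isSubmodClosed.Build C C^o J
    (GRing.submod_closed_semi Jc)).
have [s sJ sG] := fgC J'.
exists (map f s) => [y /mapP[x xs ->]|y yI]; first exact: sJ xs.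
have [x xE] := sf y; have : mspan s x by apply: sG; rewrite /in_mem /= /J -xE.
rewrite xE; elim: s x {sJ sG y yI xE} => [|z s IH] x /=.
  by move=> ->; rewrite rmorph0.
by move=> [a /IH]; rewrite rmorphB rmorphM => h; exists (f a).
Qed.

(** Division by polynomials realizing all leading coefficients reduces to size at most [N]; the
    elements of [I] of that size form a submodule of a finitely generated [C]-module. *)
Lemma hilbert_basis (C : comNzRingType) : fg_ideals C -> fg_ideals {poly C}.
Proof.
move=> fgC I.
pose inI (p : {poly C}) : bool := (p : {poly C}^o) \in I.
have inI0 : inI 0 by apply: rpred0.
have inID p q : inI p -> inI q -> inI (p + q) by apply: rpredD.
have inIM q p : inI p -> inI (q * p) by apply: (@rpredZ _ {poly C}^o).
pose L : {pred C^o} := fun a : C => `[< exists p n, [/\ inI p, (size p <= n.+1)%N & p`_n = a] >].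
have Lc : submod_closed L.
  split; first by apply/asboolP; exists 0, 0%N; rewrite size_poly0 coef0.
  move=> a _ _ /asboolP[p [n [pI sp <-]]] /asboolP[q [m [qI sq <-]]].
  apply/asboolP; exists ((a%:P * 'X^m) * p + 'X^n * q), (m + n)%N; split.
  - by apply: inID; apply: inIM.
  - apply: leq_trans (size_polyD _ _) _; rewrite geq_max; apply/andP; split.
      apply: leq_trans (size_polyMleq _ _) _.
      have : (size (a%:P * 'X^m)%R <= m.+1)%N.
        apply: leq_trans (size_polyMleq _ _) _; rewrite size_polyXn addnS /=.
        by rewrite -addn1 addnC leq_add2l size_polyC leq_b1.
      by move: sp; lia.
    apply: leq_trans (size_polyMleq _ _) _; rewrite size_polyXn.
    by move: sq; lia.
  - rewrite coefD -mulrA coefCM coefXnM coefXnM.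
    by rewrite ltnNge leq_addr ltnNge leq_addl /= addKn addnK.
pose L' : submodClosed C^o := HB.pack L (GRing.isSubmodClosed.Build C C^o L
    (GRing.submod_closed_semi Lc)).
have [ls lsL lsG] := fgC L'.
(* Beyond [N] every leading coefficient is attained by an element of the span of [g] of exactly the
   prescribed degree. *)
have [g [N [gI gN]]] : exists g : seq {poly C}, exists N,
    (forall p, p \in g -> inI p) /\
    forall (a : C), @mspan C C^o ls a -> forall n, (N <= n)%N ->
      exists q : {poly C}, [/\ mspan (g : seq {poly C}^o) q, (size q <= n.+1)%N & q`_n = a].
  elim: ls lsL {lsG} => [|b ls IH] lsL.
    exists [::], 0%N; split=> // a /= -> n _; exists 0; split=> //.
      by rewrite size_poly0.
    by rewrite coef0.
  have [|g [N [gI gN]]] := IH; first by move=> a ha; apply: lsL; rewrite inE ha orbT.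
  have /asboolP[p [m [pI sp pb]]] := lsL b (mem_head _ _).
  exists (p :: g), (maxn N m); split.
    by move=> q; rewrite inE => /orP[/eqP ->|/gI].
  move=> a [c hc] n; rewrite geq_max => /andP[nN mn].
  have [q [qg sq qa]] := gN _ hc n nN.
  exists (q + (c%:P * 'X^(n - m)) * p); split.
  - by exists (c%:P * 'X^(n - m)); rewrite addrK.
  - apply: leq_trans (size_polyD _ _) _; rewrite geq_max sq /=.
    apply: leq_trans (size_polyMleq _ _) _.
    have : (size (c%:P * 'X^(n - m))%R <= (n - m).+1)%N.
      apply: leq_trans (size_polyMleq _ _) _; rewrite size_polyXn addnS /=.
      by rewrite -addn1 addnC leq_add2l size_polyC leq_b1.
    by move: sp; lia.
  - rewrite coefD qa -mulrA coefCM coefXnM ltnNge leq_subr /= subKn// pb.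
    exact: subrK.
pose S : {pred {poly C}} := fun p => inI p && (size p <= N)%N.
have Sc : submod_closed S.
  split; first by apply/andP; rewrite size_poly0.
  move=> a p q /andP[pI sp] /andP[qI sq]; apply/andP; split.
    by apply: inID => //; rewrite -mul_polyC; apply: inIM.
  apply: leq_trans (size_polyD _ _) _; rewrite geq_max sq andbT.
  exact: leq_trans (size_scale_leq _ _) sp.
pose S' : submodClosed {poly C} := HB.pack S (GRing.isSubmodClosed.Build C _ S
    (GRing.submod_closed_semi Sc)).
have [|t tS tG] := @fg_submod_mspan C fgC {poly C} [seq 'X^(nat_of_ord i) | i <- enum 'I_N] S'.
  move=> p /andP[_ sp].
  rewrite -(coefK p) poly_def.
  apply: (big_ind (mspan _)); [exact: mspan0|exact: mspanD|move=> i _].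
  apply: mspanZ; apply: mspan_mem; apply/mapP.
  by exists (widen_ord sp i); rewrite ?mem_enum.
have tG' p : mspan t p -> mspan ((g ++ t) : seq {poly C}^o) p.
  have : forall q, q \in t -> mspan ((g ++ t) : seq {poly C}^o) q.
    by move=> q qt; apply: mspan_mem; rewrite mem_cat qt orbT.
  move: (g ++ t) => G; elim: (t) p => [|q t' IH] p h /=; first by move=> ->; apply: mspan0.
  move=> [a ha]; rewrite -[p](subrK (a *: q)); apply: mspanD.
    by apply: IH => // q' hq'; apply: h; rewrite inE hq' orbT.
  by rewrite -mul_polyC; apply: (@mspanZ {poly C} {poly C}^o); apply: h; rewrite mem_head.
exists (g ++ t).
  by move=> p; rewrite mem_cat => /orP[/gI //|/tS /andP[]].
move=> p; have [n] := ubnP (size (p : {poly C})).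
elim: n p => // n IH p sp pI.
have [sN|Ns] := leqP (size (p : {poly C})) N.
  by apply: tG'; apply: tG; apply/andP.
have s0 : (0 < size (p : {poly C}))%N by apply: leq_ltn_trans Ns.
have [||q [qg sq qa]] := gN (lead_coef p) _ (size (p : {poly C})).-1.
- by apply: lsG; apply/asboolP; exists p, (size (p : {poly C})).-1; rewrite prednK.
- by rewrite -ltnS prednK.
rewrite -[p](subrK q); apply: mspanD; last first.
  by apply: mspan_trans qg => y yg; apply: mspan_mem; rewrite mem_cat yg.
have qI : inI q by apply: (mspan_sub (N := I)) qg.
apply: IH; last by rewrite -mulN1r; apply: inID pI (inIM _ _ qI).
rewrite prednK// in sq.
apply: leq_trans (_ : size (p : {poly C}) <= n)%N; last by rewrite -ltnS.
rewrite -(prednK s0) ltnS; apply/leq_sizeP => j hj.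
rewrite coefB; have [<-|hne] := eqVneq (size (p : {poly C})).-1 j.
  by rewrite qa lead_coefE subrr.
have hj' : (size (p : {poly C}) <= j)%N.
  by rewrite -(prednK s0) ltn_neqAle hne hj.
by rewrite !nth_default ?subrr//; apply: leq_trans hj'.
Qed.

(** * Generic maximal ideals *)

Lemma infinite_fibre (T : choiceType) (I : countType) (f : T -> I) :
  ~ countable [set: T] -> exists i, infinite_set [set x | f x = i]%classic.
Proof.
move=> nT; apply: contrapT => h; apply: nT.
have -> : [set: T]%classic = (\bigcup_(i in [set: I]) [set x | f x = i])%classic.
  by apply/seteqP; split=> x // _; exists (f x).
apply: bigcup_countable => [|i _]; first exact: countableP.
apply: finite_set_countable; apply: contrapT => hi; apply: h; by exists i.
Qed.

Section Uncountable.
Variables (k : closedFieldType) (k_uncountable : ~ countable [set: k]).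

(** Sorting [k] by the label [idx x] and a stage [l m] whose span contains [e x] gives countably
    many classes. One of them is infinite, and [size (l m)] plus one of its vectors must be
    dependent. *)
Lemma uncountable_dependent (W : lmodType k) (l : nat -> seq W)
    (I : countType) (idx : k -> I) (e : k -> W) :
  (forall w, exists n, in_span (idfun : {rmorphism k -> k}) (fam (s := l n)) w) ->
  exists (s : seq k) (i : I) (a : k -> k),
    [/\ uniq s, {in s, forall x, idx x = i}, exists2 x, x \in s & a x != 0 &
      \sum_(x <- s) a x *: e x = 0].
Proof.
move=> hl; have [n hn] := choice (fun x => hl (e x)).
have [[i m] hF] := infinite_fibre (fun x => (idx x, n x)) k_uncountable.
have [B BF hB] := infinite_set_fset (size (l m)).+1 hF.
pose s : seq k := B; exists s, i.
have [c c0 [j cj]] : exists2 c : 'I_(size s) -> k,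
    \sum_j c j *: e s`_j = 0 & exists j, c j != 0.
  apply: contrapT => h.
  have ind : lin_indep (idfun : {rmorphism k -> k}) (fun j : 'I_(size s) => e s`_j).
    move=> c hc j; apply: contrapT => /eqP cj; apply: h.
    by exists c => //; exists j.
  have := steinitz (f := fam (s := l m)) ind; rewrite !card_ord.
  move=> /(_ _)/leq_trans-/(_ (size (l m))) h1.
  suff : (size s <= size (l m))%N by rewrite leqNgt hB.
  apply: h1 => // t; have := hn s`_t.
  by have [_ <-] := BF _ (mem_nth 0 (ltn_ord t)).
exists (fun x => if insub (index x s) is Some j' then c j' else 0).
have us : uniq s := fset_uniq B.
have aE (t : 'I_(size s)) :
    (if insub (index s`_t s) is Some j' then c j' else 0) = c t.
  by rewrite index_uniq// valK.
split=> //.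
- by move=> x /BF[].
- by exists s`_j; [apply: mem_nth | rewrite aE].
by rewrite (big_nth 0) big_mkord -[RHS]c0; apply: eq_bigr => t _; rewrite aE.
Qed.

(** The left side is a combination of the inverses of c - x with cleared denominators. It is the
    value at [c] of a polynomial [Q] over [k] that is nonzero, because at [x0] only the term of [x0]
    survives; [Q] then splits. *)
Lemma partial_fractions (C : idomAlgType k) (c : C) (s : seq k) (a : k -> k) :
  uniq s -> (exists2 x, x \in s & a x != 0) ->
  exists (u : k) (r : seq k), u != 0 /\
    \sum_(x <- s) a x *: \prod_(y <- s | y != x) (c - y%:A) =
    u *: \prod_(z <- r) (c - z%:A).
Proof.
move=> us [x0 x0s ax0].
pose Q := \sum_(x <- s) a x *: \prod_(y <- s | y != x) ('X - y%:P).
have Q0 : Q != 0.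
  apply/eqP => /(congr1 (fun p => p.[x0])); rewrite horner0 /Q horner_sum.
  have hz x : x \in s -> x != x0 ->
      (a x *: \prod_(y <- s | y != x) ('X - y%:P)).[x0] = 0.
    move=> xs xx0; apply/eqP; rewrite hornerZ horner_prod mulf_eq0.
    apply/orP; right; rewrite prodf_seq_eq0; apply/hasP; exists x0 => //.
    by rewrite hornerXsubC subrr eqxx eq_sym xx0.
  rewrite (bigD1_seq x0)//= [X in _ + X]big1_seq => [|x /andP[xx0 xs]]; last exact: hz.
  rewrite addr0.
  rewrite hornerZ horner_prod => /eqP; rewrite mulf_eq0 (negPf ax0) /=.
  apply/negP; rewrite prodf_seq_neq0; apply/allP => y _; apply/implyP => hy.
  by rewrite hornerXsubC subr_eq0 eq_sym.
have [r rE] := closed_field_poly_normal Q.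
exists (lead_coef Q), r; split; first by rewrite lead_coef_eq0.
pose g := map_poly (GRing.in_alg C).
have hX (y : k) : (g ('X - y%:P)).[c] = c - y%:A.
  by rewrite /g rmorphB /= map_polyX map_polyC hornerXsubC.
have hP (t : seq k) (P : pred k) :
    (g (\prod_(z <- t | P z) ('X - z%:P))).[c] = \prod_(z <- t | P z) (c - z%:A).
  by rewrite /g rmorph_prod horner_prod; apply: eq_bigr => z _; apply: hX.
have hZ u p : (g (u *: p)).[c] = u *: (g p).[c].
  by rewrite /g map_polyZ hornerZ /= mulr_algl.
have := congr1 (fun p => (g p).[c]) rE; rewrite hZ hP => <-.
rewrite /Q /g rmorph_sum horner_sum; apply: eq_bigr => x _.
by rewrite -/g hZ hP.
Qed.

End Uncountable.

(** * Ideals avoiding a multiplicative set *)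

Section Primes.
Variable (C : comNzRingType).

Definition mk_prime (S : {pred C}) (h0 : 0 \in S) (h1 : 1 \notin S)
    (hM : forall a, {in S &, forall u v, a * u + v \in S})
    (hP : prime_idealr_closed S) : prime_idealr C :=
  HB.pack S (isIdealr.Build C S (And3 h0 h1 hM)) (isPrimeIdealrClosed.Build C S hP).

Definition mk_ideal (S : {pred C}) (h0 : 0 \in S) (h1 : 1 \notin S)
    (hM : forall a, {in S &, forall u v, a * u + v \in S}) : idealr C :=
  HB.pack S (isIdealr.Build C S (And3 h0 h1 hM)).

Section AddElt.
Variables (I : submodClosed C^o) (c : C).
Definition add_elt_pred : {pred C^o} := fun x : C => `[< exists b : C, (x - b * c : C^o) \in I >].
Fact add_elt_closed : submod_closed add_elt_pred.
Proof.
split; first by apply/asboolP; exists 0; rewrite mul0r subr0 rpred0.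
move=> a x y /asboolP[b hb] /asboolP[d hd]; apply/asboolP.
exists ((a : C) * b + d).
rewrite (_ : _ - _ = a *: (x - b * c : C^o) + (y - d * c)).
  by rewrite rpredD ?rpredZ.
rewrite scalerBr -[a *: (b * c : C^o)]/((a : C) * (b * c)) mulrDl mulrA opprD.
by rewrite addrACA.
Qed.
Definition add_elt : submodClosed C^o :=
  HB.pack add_elt_pred (GRing.isSubmodClosed.Build C C^o add_elt_pred
    (GRing.submod_closed_semi add_elt_closed)).
Lemma add_eltP (x : C) :
  reflect (exists b : C, (x - b * c : C^o) \in I) ((x : C^o) \in add_elt).
Proof. exact: asboolP. Qed.
Lemma add_elt_sub : {subset I <= add_elt}.
Proof. by move=> x xI; apply/add_eltP; exists 0; rewrite mul0r subr0. Qed.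
Lemma mem_add_elt : (c : C^o) \in add_elt.
Proof. by apply/add_eltP; exists 1; rewrite mul1r subrr rpred0. Qed.
End AddElt.

(** An ideal maximal among those missing [H] is prime; noetherian induction provides it. The last
    clause is maximality made elementary: inverting [H] turns C/M into a field. *)
Lemma prime_avoiding (H : C -> Prop) (I : submodClosed C^o) : fg_ideals C ->
  H 1 -> (forall x y, H x -> H y -> H (x * y)) ->
  (forall x : C, (x : C^o) \in I -> ~ H x) ->
  exists M : prime_idealr C,
    [/\ forall x : C, (x : C^o) \in I -> x \in M, forall x, x \in M -> ~ H x &
      forall c, c \notin M -> exists b h, H h /\ h - b * c \in M].
Proof.
move=> fgC H1 HM; move: I; apply: (noetherian_ind fgC) => I IH dI.
have [[c [cI dc]]|max] := pselect (exists c : C, (c : C^o) \notin I /\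
    forall x : C, (x : C^o) \in add_elt I c -> ~ H x).
  have [|M [IM dM mM]] := IH (add_elt I c) (@add_elt_sub I c) _ dc.
    by move=> h; move/negP: cI; apply; apply: h; apply: mem_add_elt.
  by exists M; split=> // x xI; apply: IM; apply: add_elt_sub.
have {}max c : (c : C^o) \notin I -> exists b h, H h /\ (h - b * c : C^o) \in I.
  move=> cI; apply: contrapT => h; apply: max; exists c; split=> // x.
  by move=> /add_eltP[b hb] Hx; apply: h; exists b, x.
pose S : {pred C} := fun x => (x : C^o) \in I.
have S0 : 0 \in S by apply: (@rpred0 C^o).
have S1 : 1 \notin S by apply/negP => /dI.
have SM a : {in S &, forall u v, a * u + v \in S}.
  by move=> u v hu hv; apply: (@rpredD C^o) => //; apply: (@rpredZ C C^o).
have SP : prime_idealr_closed S.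
  move=> x y hxy; apply: contrapT => /negP; rewrite negb_or => /andP[hx hy].
  have [b [h [Hh hb]]] := max _ hx; have [b' [h' [Hh' hb']]] := max _ hy.
  apply: (dI (h * h')); last exact: HM.
  have -> : h * h' = h' * (h - b * x) + (b * x * (h' - b' * y) +
      (b * b' * (x * y) + 0)) by ring.
  by apply: (SM h') => //; apply: (SM (b * x)) => //; apply: (SM (b * b')).
by exists (mk_prime S0 S1 SM SP); split.
Qed.

End Primes.

Section GenericPoint.
Variables (k : closedFieldType) (k_uncountable : ~ countable [set: k]).
Variables (C : idomAlgType k) (fgC : fg_ideals C) (l : nat -> seq C).
Hypothesis hl :
  forall w : C, exists n, in_span (idfun : {rmorphism k -> k}) (fam (s := l n)) w.

Lemma idealZ (M : idealr C) (a : k) x : x \in M -> a *: x \in M.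
Proof. by move=> xM; rewrite -mulr_algl idealMr. Qed.

Lemma residue_maximal (M : idealr C) :
  (forall c : C, exists x : k, c - x%:A \in M) -> maximal_ideal M.
Proof.
move=> res J MJ c cJ; have [x hx] := res c.
have [x0|x0] := eqVneq x 0; first by move: hx; rewrite x0 scale0r subr0.
have : x%:A \in J.
  by rewrite -[x%:A](subKr c) rpredB// MJ.
move=> /(idealMr x^-1%:A); rewrite -scalerAl mul1r scalerA mulVf// scale1r.
by rewrite idealr1.
Qed.

(** Choose [M] maximal among ideals missing all products of the [h i]. If no c - x lies in [M], each
    divides some such product modulo [M]. There are countably many products, so the cofactors
    satisfy a relation for one common product, and partial fractions put a factor c - z into [M]
    after all. *)
Lemma generic_point (h : nat -> C) : (forall i, h i != 0) ->
  exists M : prime_idealr C,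
    (forall i, h i \notin M) /\ forall c : C, exists x : k, c - x%:A \in M.
Proof.
move=> h0; pose H x := exists s : seq nat, x = \prod_(i <- s) h i.
pose I0 : submodClosed C^o := mspan_submod ([::] : seq C^o).
have [||| M [_ dM maxM]] := @prime_avoiding C H I0 fgC.
- by exists [::]; rewrite big_nil.
- by move=> _ _ [s ->] [t ->]; exists (s ++ t); rewrite big_cat.
- move=> x /mspan_submodP /= -> [s] /esym/eqP; apply/negP.
  by rewrite prodf_seq_neq0; apply/allP => i _; rewrite h0.
exists M; split=> [i|c].
  by apply/negP => /dM; apply; exists [:: i]; rewrite big_seq1.
apply: contrapT => hc.
have {}maxM (x : k) : exists bs : C * seq nat,
    (\prod_(i <- bs.2) h i) - bs.1 * (c - x%:A) \in M.
  have [|b [_ [[s ->] hb]]] := maxM (c - x%:A).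
    by apply/negP => hx; apply: hc; exists x.
  by exists (b, s).
have [bs hbs] := choice maxM.
pose lq n := map (@prime_pi k C M) (l n).
have hlq (w : prime_quot M) : exists n,
    in_span (idfun : {rmorphism k -> k}) (fam (s := lq n)) w.
  have [n [a ha]] := hl (prime_repr w); exists n.
  rewrite -(prime_reprK w) ha.
  have lin : linear (@prime_pi k C M).
    by move=> x u v; rewrite prime_piD -prime_scale_pi.
  rewrite -[prime_pi M _](mk_linearE lin) linear_sum; apply: in_span_sum => i _.
  rewrite linearZ /=; apply: (@in_spanZ _ _ (idfun : {rmorphism k -> k})).
  by apply: in_span_mem; apply: map_f; apply: mem_nth.
have [s [i [a [us si ax e0]]]] := uncountable_dependent k_uncountable
  (fun x => (bs x).2) (fun x => prime_pi M (bs x).1) hlq.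
(* The common product: b_x (c - x) equals [eta] modulo [M] for every [x] in [s]. *)
set eta := \prod_(j <- i) h j.
have etaM : eta \notin M by apply/negP => /dM; apply; exists i.
have e1 : \sum_(x <- s) a x *: (bs x).1 \in M.
  have lin : linear (@prime_pi k C M).
    by move=> x u v; rewrite prime_piD -prime_scale_pi.
  rewrite -[X in X \in M]subr0; apply/prime_piP.
  rewrite -![prime_pi _ _](mk_linearE lin) linear0 linear_sum -[RHS]e0.
  by apply: eq_bigr => x _; rewrite linearZ.
have [u [r [u0 hr]]] := partial_fractions c us ax.
(* Multiply the relation among the b_x by the product of all c - y; in the term of [x] the factor c
   - x turns b_x into [eta]. *)
have : (\sum_(x <- s) a x *: \prod_(y <- s | y != x) (c - y%:A)) * eta \in M.
  rewrite -[X in X \in M](subrK ((\prod_(y <- s) (c - y%:A)) * \sum_(x <- s) a x *: (bs x).1)).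
  rewrite rpredD ?idealMr// mulr_suml mulr_sumr -sumrB.
  rewrite big_seq rpred_sum// => x xs.
  rewrite (bigD1_seq x)//= -scalerAl -scalerAr -scalerBr idealZ//.
  rewrite -mulrA [_ * (_ * (bs x).1)]mulrCA -mulrBr idealMr// mulrC.
  by rewrite /eta -(si x xs) hbs.
rewrite hr prime_idealrM (negPf etaM) orbF -[u *: _]mulr_algl prime_idealrM.
case/orP => [hu|].
  have := idealMr u^-1%:A hu; rewrite -scalerAl mul1r scalerA mulVf// scale1r.
  by rewrite idealr1.
elim: r {hr} => [|z r IH]; first by rewrite big_nil idealr1.
by rewrite big_cons prime_idealrM => /orP[hz|/IH//]; apply: hc; exists z.
Qed.

End GenericPoint.

(** * The generic fibre *)

Local Open Scope quotient_scope.

Lemma frac_denom (C : idomainType) (q : {fraction C}) :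
  exists2 ab : C * C, ab.2 != 0 &
    FracField.tofrac ab.2 * q = FracField.tofrac ab.1.
Proof.
elim/quotW: q => x; exists (frac x); first exact: denom_ratioP.
apply/eqP; rewrite -[_ * _]/(FracField.mul _ _) !piE /FracField.mulf.
rewrite FracField.equivfE !numden_Ratio ?oner_eq0 ?mulf_neq0 ?oner_eq0 ?denom_ratioP//.
by rewrite mulr1 mul1r mulrC.
Qed.

Section TensorFraction.
Variables (C : idomainType) (B : pzRingType) (phi : central_hom C B).
Local Notation F := {fraction C}.
Local Notation frac := (@FracField.tofrac C).
Local Notation T := (tensor phi (frac_hom C)).
Local Notation inr := (tensor_inr phi (frac_hom C)).

Definition tensor_inl (b : B) : T := tensor_pi phi (frac_hom C) [:: (b, 1)].

Fact tensor_inl_zmod_morphism : zmod_morphism tensor_inl.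
Proof.
move=> x y; rewrite /tensor_inl -[LHS](addrK (tensor_pi phi (frac_hom C) [:: (y, 1)])).
congr (_ - _); rewrite -[LHS]tensor_piD; apply/tensor_piP => G f hf.
by case: (hf) => fD _ _; rewrite big_cat !big_seq1 /= -fD subrK.
Qed.
Fact tensor_inl_monoid_morphism : monoid_morphism tensor_inl.
Proof. by split=> // x y; rewrite -[RHS]tensor_piM /= mul1r. Qed.

HB.instance Definition _ :=
  GRing.isZmodMorphism.Build B T tensor_inl tensor_inl_zmod_morphism.
HB.instance Definition _ :=
  GRing.isMonoidMorphism.Build B T tensor_inl tensor_inl_monoid_morphism.

Lemma tensor_inrl f b : inr f * tensor_inl b = tensor_pi phi (frac_hom C) [:: (b, f)].
Proof. by rewrite -[LHS]tensor_piM /= mul1r mulr1. Qed.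

Lemma tensor_inr_central f (x : T) : inr f * x = x * inr f.
Proof.
rewrite -(tensor_reprK x) /tensor_inr -![_ * _]tensor_piM.
apply/tensor_piP => G g hg; rewrite !big_allpairs_dep big_seq1.
by apply: eq_bigr => u _; rewrite big_seq1 /= mul1r mulr1 mulrC.
Qed.

Lemma tensor_inl_phi c : tensor_inl (phi c) = inr (frac c).
Proof.
apply/tensor_piP => G g [_ _ hg]; rewrite !big_seq1 /=.
by rewrite -[phi c]mul1r hg mulr1.
Qed.

Lemma tensor_sum (x : T) : exists s : seq (F * B),
  x = \sum_(u <- s) inr u.1 * tensor_inl u.2.
Proof.
rewrite -(tensor_reprK x); exists [seq (u.2, u.1) | u <- tensor_repr x].
elim: (tensor_repr x) => [|u s IH]; first by rewrite big_nil.
rewrite big_cons -IH tensor_inrl -[RHS]tensor_piD.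
by rewrite -cat1s; case: u.
Qed.

(* Separation of non-torsion elements: the balanced map sends b (x) q to the
   germ of h |-> (h q) b on multiples h of a denominator of q. *)
Lemma tensor_inl_torsion b : tensor_inl b = 0 ->
  exists2 h : C, h != 0 & phi h * b = 0.
Proof.
(* The functions with zero germ: they vanish on all nonzero multiples of some nonzero [h0]. *)
pose E : {pred C -> B} := fun g => `[< exists2 h0 : C, h0 != 0 &
  forall h, h != 0 -> g (h * h0) = 0 >].
have Ec : zmod_closed E.
  split; first by apply/asboolP; exists 1 => //; exact: oner_neq0.
  move=> f g /asboolP[h0 h00 hf] /asboolP[h1 h10 hg]; apply/asboolP.
  exists (h0 * h1) => [|h h_neq0]; first exact: mulf_neq0.
  rewrite -[LHS]/(f _ - g _) [X in f X]mulrA [X in g X]mulrA.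
  by rewrite hg ?mulf_neq0// -mulrA [h0 * h1]mulrC mulrA hf ?mulf_neq0// subrr.
pose E' : zmodClosed (C -> B) := HB.pack E (GRing.isZmodClosed.Build _ E Ec).
(* The default 0 is taken when [h] is not a denominator of [q]; germs only see multiples of a
   denominator. *)
pose num (h : C) (q : F) : C :=
  if pselect (exists c, frac c = frac h * q) is left e then projT1 (cid e) else 0.
have numP h q c : frac h * q = frac c -> num h q = c.
  move=> e; rewrite /num; case: pselect => [e'|[]]; last by exists c.
  by apply/eqP; rewrite -tofrac_eq; case: (cid e') => c' /= ->; rewrite e.
pose G := @Quotient.quot (C -> B) E'.
pose f (b : B) (q : F) : G := \pi_G (fun h => phi (num h q) * b).
have piG u v : E (u - v) -> \pi_G u = \pi_G v.
  by move=> h; apply/eqP; rewrite -Quotient.idealrBE.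
have piD u v : \pi_G (u + v) = \pi_G u + \pi_G v by rewrite !piE.
have bf : balanced phi (frac_hom C) f.
  split=> [x y q|x q r|c x q].
  - rewrite -piD; congr (\pi_G _); apply/funext => h.
    by rewrite -[RHS]/(_ * _ + _ * _) mulrDr.
  - rewrite -piD; apply: piG; apply/asboolP.
    have [[a0 a] /= a_neq0 ha] := frac_denom q.
    have [[b0 b'] /= b_neq0 hb] := frac_denom r.
    exists (a * b') => [|h _]; first exact: mulf_neq0.
    set h' := h * (a * b').
    have e1 : frac h' * q = frac (h * b' * a0).
      by rewrite /h' -mulrA [a * b']mulrC !rmorphM /= -!mulrA ha.
    have e2 : frac h' * r = frac (h * a * b0).
      by rewrite /h' !rmorphM /= -!mulrA hb.
    rewrite -[LHS]/(_ * _ - (_ * _ + _ * _)) (numP _ _ _ e1) (numP _ _ _ e2).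
    rewrite (numP _ _ (h * b' * a0 + h * a * b0)); last by rewrite mulrDr e1 e2 rmorphD.
    by rewrite rmorphD mulrDl subrr.
  - apply: piG; apply/asboolP.
    have [[a0 a] /= a_neq0 ha] := frac_denom q.
    exists a => // h _; set h' := h * a.
    have e1 : frac h' * q = frac (h * a0) by rewrite /h' !rmorphM /= -mulrA ha.
    rewrite -[LHS]/(_ * _ - _ * _) (numP _ _ _ e1).
    rewrite (numP _ _ (h * a0 * c)); last first.
      by rewrite mulrCA e1 -rmorphM mulrC.
    by rewrite [phi (_ * c)]rmorphM -[in X in _ - X]mulrA (chomC phi c x) subrr.
move=> /(@tensor_piP _ _ _ _ _ _ [::])/(_ G f bf); rewrite big_seq1 big_nil /=.
rewrite -[RHS](_ : \pi_G 0 = 0); last by rewrite !piE.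
move=> /eqP; rewrite -Quotient.idealrBE subr0 => /asboolP[h0 h00 /(_ 1)].
rewrite mul1r (numP _ _ h0) ?mulr1// => /(_ (oner_neq0 _)) e.
by exists h0.
Qed.

End TensorFraction.

Section GenericFibre.
Variables (k : closedFieldType) (C : idomAlgType k) (B : pzRingType).
Variable phi : central_hom C B.
Local Notation F := {fraction C}.
Local Notation frac := (@FracField.tofrac C).
Local Notation T := (tensor phi (frac_hom C)).
Local Notation inr := (tensor_inr phi (frac_hom C)).
Local Notation inl := (tensor_inl phi).
Local Notation sigma := (phi \o GRing.in_alg C).

(** Coefficients are functions on all of [nat], so that lists can be extended without changing index
    types. *)
Definition comb (e : seq B) (c : nat -> C) : B :=
  \sum_(i < size e) phi (c i) * e`_i.

Definition comb_indep (e : seq B) : Prop :=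
  forall c, comb e c = 0 -> forall i, (i < size e)%N -> c i = 0.

Lemma comb_cons x e c : comb (x :: e) c = phi (c 0%N) * x + comb e (c \o succn).
Proof. by rewrite /comb big_ord_recl. Qed.

Lemma combD e c d : comb e c + comb e d = comb e (fun i => c i + d i).
Proof.
by rewrite /comb -big_split; apply: eq_bigr => i _; rewrite rmorphD mulrDl.
Qed.

Lemma combZ e a c : phi a * comb e c = comb e (fun i => a * c i).
Proof.
by rewrite /comb mulr_sumr; apply: eq_bigr => i _; rewrite rmorphM mulrA.
Qed.

Lemma comb0 e : comb e (fun=> 0) = 0.
Proof. by rewrite /comb big1// => i _; rewrite rmorph0 mul0r. Qed.

Lemma comb_cat0 e1 e c :
  comb e c = comb (e1 ++ e) (fun i => if (i < size e1)%N then 0 else c (i - size e1)%N).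
Proof.
elim: e1 => [|x e1 IH]; first by apply: eq_bigr => i _; rewrite subn0.
by rewrite comb_cons /= rmorph0 mul0r add0r IH.
Qed.

Definition comb_indep_in (S : {pred C}) (e : seq B) : Prop :=
  forall c, (forall i, c i \in S) -> comb e c = 0 ->
    forall i, (i < size e)%N -> c i = 0.

(** A maximal independent extension of [e0] by members of [W], with one denominator [h] for all of
    [W]. The subring [S] is all of [C] for generic fibres and a polynomial subring in the height
    argument. *)
Lemma comb_extend_in (S : subringClosed C) e0 (W : seq B) : comb_indep_in S e0 ->
  exists (e1 : seq B) (h : C),
    [/\ comb_indep_in S (e1 ++ e0), {subset e1 <= W}, h \in S, h != 0 &
       {in W, forall w, exists2 c, forall i, c i \in S & phi h * w = comb (e1 ++ e0) c}].
Proof.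
move=> i0; elim: W => [|w W [e1 [h [ie sW hS h0 hW]]]].
  by exists [::], 1; split; rewrite ?rpred1 ?oner_neq0.
have [iw|nw] := pselect (comb_indep_in S (w :: e1 ++ e0)).
  exists (w :: e1), h; split=> // [x|x]; rewrite inE => /orP[/eqP ->|].
  - exact: mem_head.
  - by move/sW; rewrite inE => ->; rewrite orbT.
  - exists (fun i => if i is 0%N then h else 0); first by case; rewrite ?rpred0.
    rewrite comb_cons /=.
    by rewrite -[comb _ _]/(comb (e1 ++ e0) (fun=> 0)) comb0 addr0.
  - move=> /hW[c cS hc]; exists (fun i => if i is j.+1 then c j else 0).
      by case; rewrite ?rpred0.
    by rewrite comb_cons rmorph0 mul0r add0r hc.
(* A relation on [w :: e1 ++ e0] must involve [w]; its coefficient [c 0] clears the denominator of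
   [w]. *)
have [c cS [hc c0]] : exists2 c, forall i, c i \in S &
    comb (w :: e1 ++ e0) c = 0 /\ c 0%N != 0.
  apply: contrapT => h'; apply: nw => c cS hc.
  have c0 : c 0%N = 0.
    by apply: contrapT => /eqP c0; apply: h'; exists c.
  move=> [//|i] /= hi; apply: (ie (c \o succn)) => //; first by move=> j; apply: cS.
  by move: hc; rewrite comb_cons c0 rmorph0 mul0r add0r.
exists e1, (c 0%N * h); split=> //.
- by move=> x /sW; rewrite inE orbC => ->.
- by rewrite rpredM.
- exact: mulf_neq0.
move=> x; rewrite inE => /orP[/eqP ->|/hW[d dS hd]]; last first.
  exists (fun i => c 0%N * d i); first by move=> i; rewrite rpredM.
  by rewrite rmorphM -mulrA hd combZ.
exists (fun i => - h * c i.+1); first by move=> i; rewrite rpredM ?rpredN.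
rewrite -combZ mulrC rmorphM -mulrA.
move: hc; rewrite comb_cons => /eqP; rewrite addr_eq0 => /eqP ->.
by rewrite rmorphN mulrN mulNr.
Qed.

Lemma comb_extend e0 (W : seq B) : comb_indep e0 ->
  exists (e1 : seq B) (h : C),
    [/\ comb_indep (e1 ++ e0), {subset e1 <= W}, h != 0 &
       {in W, forall w, exists c, phi h * w = comb (e1 ++ e0) c}].
Proof.
have fullc : subring_closed (predT : {pred C}) by [].
pose full : subringClosed C :=
  HB.pack (predT : {pred C}) (GRing.isSubringClosed.Build C _ fullc).
have iE e : comb_indep_in full e <-> comb_indep e.
  by split=> h c; [exact: h | move=> _; exact: h].
move=> /iE/(comb_extend_in W)[e1 [h [/iE ie sW _ h0 hW]]].
exists e1, h; split=> // w /hW[c _ hc]; by exists c.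
Qed.

Lemma common_denom (n : nat) (q : 'I_n -> F) : exists2 b : C, b != 0 &
  exists a : 'I_n -> C, forall i, frac b * q i = frac (a i).
Proof.
have [ab hab] := choice (fun i => let: ex_intro2 x h1 h2 := frac_denom (q i) in
   ex_intro (fun x => x.2 != 0 /\ frac x.2 * q i = frac x.1) x (conj h1 h2)).
exists (\prod_i (ab i).2).
  by apply/prodf_neq0 => i _; case: (hab i).
exists (fun i => (\prod_(j | j != i) (ab j).2) * (ab i).1) => i.
rewrite (bigD1 i)//= [X in frac X * _]mulrC 2!rmorphM /= -mulrA; congr (_ * _).
by case: (hab i).
Qed.

(** A relation over the fraction field becomes one over [C] in the image of [B] after clearing
    denominators, and one in [B] after multiplying by an annihilator of the torsion. *)
Lemma generic_indep e : comb_indep e ->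
  lin_indep inr (fun i : 'I_(size e) => inl e`_i : T^o).
Proof.
move=> ie q hq.
have [b b0 [a ha]] := common_denom q.
have : inl (comb e (fun i => if insub i is Some j then a j else 0)) = 0.
  rewrite rmorph_sum -[RHS](mulr0 (inr (frac b))) -[in RHS]hq mulr_sumr.
  apply: eq_bigr => i _; rewrite rmorphM /= tensor_inl_phi valK -ha rmorphM.
  by rewrite mulrA.
move=> /tensor_inl_torsion[h h0]; rewrite combZ => /ie he i.
have := he i (ltn_ord i); rewrite /= valK => /eqP.
rewrite mulf_eq0 (negPf h0) /= => /eqP ai0.
have /eqP := ha i; rewrite ai0 rmorph0 mulf_eq0 tofrac_eq0 (negPf b0) /=.
by move/eqP.
Qed.

Lemma generic_span_dim e (W : seq B) h : comb_indep e -> {subset e <= W} ->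
  h != 0 -> {in W, forall w, exists c, phi h * w = comb e c} ->
  span_dim inr (map inl W : seq T^o) = size e.
Proof.
move=> ie eW h0 hW; apply/eqP; rewrite eqn_leq -[size e]card_ord.
apply/andP; split.
  apply: (span_dim_le (f := fun i : 'I_(size e) => inl e`_i : T^o)).
  move=> _ /mapP[w wW ->]; have [c hc] := hW _ wW.
  exists (fun i : 'I_(size e) => (frac h)^-1 * frac (c i)).
  have -> : inl w = inr (frac h)^-1 * (inr (frac h) * inl w).
    by rewrite mulrA -rmorphM mulVf ?tofrac_eq0// rmorph1 mul1r.
  rewrite -tensor_inl_phi -rmorphM hc rmorph_sum mulr_sumr.
  apply: eq_bigr => i _; rewrite rmorphM /= tensor_inl_phi mulrA.
  by rewrite -rmorphM.
apply: (span_dim_ge (generic_indep ie)) => i; apply: in_span_mem.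
by apply: map_f; apply: eW; apply: mem_nth.
Qed.

Variables (V : seq B).
Hypothesis gV : generating sigma V.

Let sigmaC c b : sigma c * b = b * sigma c. Proof. exact: chomC. Qed.

Lemma tensor_generating : generating inr (map inl V).
Proof.
move=> x; have [s ->] := tensor_sum x.
have gen b : exists n, wspan inr (map inl V) n (inl b).
  have [n [c ->]] := gV b; exists n; rewrite rmorph_sum; apply: in_span_sum => i _.
  rewrite rmorphM /= tensor_inl_phi; apply: (@in_spanZ _ _ _ T^o).
  by apply: wspan_word; rewrite words_map; apply: map_f; apply: mem_nth.
elim: s => [|[f b] s [n IH]].
  by exists 0%N; rewrite big_nil; apply: in_span0.
have [m hm] := gen b; exists (maxn m n); rewrite big_cons; apply: wspanD IH.
exact: (@in_spanZ _ _ _ T^o).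
Qed.

Variable R : realType.

Lemma gkdim_generic_words : gkdim_generic R phi =
  growth R (fun n => span_dim inr (map inl (words V n) : seq T^o)).
Proof.
rewrite /gkdim_generic (gkdim_alg_generating (@tensor_inr_central _ _ phi) _ tensor_generating).
by congr (growth R _); apply/funext => n; rewrite words_map.
Qed.

Lemma gkdim_fiber_words (M : idealr C) : gkdim_fiber R phi M =
  growth R (fun n => span_dim (fiber_pi phi M \o sigma)
    (map (fiber_pi phi M) (words V n) : seq (fiber phi M)^o)).
Proof.
have sC c b : (fiber_pi phi M \o sigma) c * b = b * (fiber_pi phi M \o sigma) c.
  by rewrite -(fiber_reprK b) /= -!rmorphM sigmaC.
have gen : generating (fiber_pi phi M \o sigma) (map (fiber_pi phi M) V).
  move=> b; have [n [c hc]] := gV (fiber_repr b); exists n.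
  rewrite -(fiber_reprK b) hc rmorph_sum; apply: in_span_sum => i _.
  rewrite rmorphM; apply: (@in_spanZ _ _ (fiber_pi phi M \o sigma) (fiber phi M)^o).
  by apply: wspan_word; rewrite words_map; apply: map_f; apply: mem_nth.
rewrite -[LHS]/(gkdim_alg R (fiber_pi phi M \o sigma)).
rewrite (gkdim_alg_generating sC _ gen).
by congr (growth R _); apply/funext => n; rewrite words_map.
Qed.

Lemma comb_words n : exists e h,
  [/\ comb_indep e, {subset e <= words V n}, h != 0 &
    {in words V n, forall w, exists c, phi h * w = comb e c}].
Proof.
have i0 : comb_indep [::] by [].
have [e [h [h1 h2 h3 h4]]] := comb_extend (words V n) i0.
by exists e, h; rewrite cats0 in h1 h4.
Qed.

(** Since [h] becomes a nonzero scalar modulo [M], the family [e] spans the words. If a scalar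
    combination of [e] lies in MB, its witnesses are words of some length [N]; a denominator for
    that length rewrites it over [e1 ++ e] with coefficients in [M], and comparing coefficients puts
    the scalars into [M]. *)
Lemma fibre_span_dim (M : prime_idealr C) e n h :
  (forall c : C, exists x : k, c - x%:A \in M) ->
  comb_indep e -> {subset e <= words V n} -> h \notin M ->
  {in words V n, forall w, exists c, phi h * w = comb e c} ->
  (forall N, exists e1 h', h' \notin M /\ comb_indep (e1 ++ e) /\
    {in words V N, forall w, exists c, phi h' * w = comb (e1 ++ e) c}) ->
  span_dim (fiber_pi phi M \o sigma)
    (map (fiber_pi phi M) (words V n) : seq (fiber phi M)^o) = size e.
Proof.
move=> res ie eW hM hW ext.
have piM c : c \in M -> fiber_pi phi M (phi c) = 0.
  move=> cM; rewrite -(rmorph0 (fiber_pi phi M)); apply/fiber_piP; rewrite subr0.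
  by apply/ext_idealP; exists [:: (c, 1)]; rewrite /= cM big_seq1 mulr1.
have resE c : exists x : k, fiber_pi phi M (phi c) = (fiber_pi phi M \o sigma) x.
  have [x hx] := res c; exists x; apply/eqP; rewrite -subr_eq0 -!rmorphB.
  by apply/eqP; apply: piM.
apply/eqP; rewrite eqn_leq -[size e]card_ord; apply/andP; split.
  apply: (span_dim_le (f := fun i : 'I_(size e) => fiber_pi phi M e`_i : (fiber phi M)^o)).
  move=> _ /mapP[w wW ->]; have [c hc] := hW _ wW.
  have [x hx] := res h.
  have x0 : x != 0.
    by apply: contraNN hM => /eqP x0; move: hx; rewrite x0 scale0r subr0.
  have -> : fiber_pi phi M w = (fiber_pi phi M \o sigma) x^-1 *
      fiber_pi phi M (phi h * w).
    have hx' : fiber_pi phi M (phi h) = (fiber_pi phi M \o sigma) x.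
      by apply/eqP; rewrite -subr_eq0 -!rmorphB; apply/eqP; apply: piM.
    pose sM : {rmorphism k -> fiber phi M} := fiber_pi phi M \o sigma.
    have hv : sM x^-1 * sM x = 1 by rewrite -(rmorphM sM) mulVf// (rmorph1 sM).
    by rewrite rmorphM [X in _ * (X * _)]hx' mulrA hv mul1r.
  apply: (@in_spanZ _ _ (fiber_pi phi M \o sigma) (fiber phi M)^o).
  rewrite hc rmorph_sum; apply: in_span_sum => i _; rewrite rmorphM /=.
  have [y ->] := resE (c i).
  apply: (@in_spanZ _ _ (fiber_pi phi M \o sigma) (fiber phi M)^o).
  exact: (@in_span_self _ _ _ (fiber phi M)^o _ (fun i : 'I_(size e) => fiber_pi phi M e`_i)).
have ind : lin_indep (fiber_pi phi M \o sigma)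
    (fun i : 'I_(size e) => fiber_pi phi M e`_i : (fiber phi M)^o).
  move=> a ha.
  pose a' (i : nat) : C := if insub i is Some j then (a j)%:A else 0.
  have : fiber_pi phi M (comb e a') = fiber_pi phi M 0.
    rewrite rmorph0 -[RHS]ha rmorph_sum; apply: eq_bigr => i _.
    by rewrite rmorphM /a' valK.
  move=> /fiber_piP; rewrite subr0 => /ext_idealP[s [sM sE]].
  (* No bound on [N] in terms of [n] is available, which is why [ext] quantifies over every [N]. *)
  have [N hN] : exists N, all (fun t => `[< wspan sigma V N t.2 >]) s.
    elim: (s) => [|t s' [N hN]]; first by exists 0%N.
    have [m hm] := gV t.2; exists (maxn N m) => /=; apply/andP; split.
      by apply/asboolP; apply: wspan_leq hm; rewrite leq_maxr.
    apply: sub_all hN => u /asboolP hu; apply/asboolP.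
    by apply: wspan_leq hu; rewrite leq_maxl.
  have [e1 [h' [h'M [ie1 hW']]]] := ext N.
  have spanN b : wspan sigma V N b -> exists c, phi h' * b = comb (e1 ++ e) c.
    move=> [c ->]; rewrite mulr_sumr.
    apply: (big_ind (fun b => exists c, b = comb (e1 ++ e) c)).
    - by exists (fun=> 0); rewrite comb0.
    - by move=> _ _ [c1 ->] [c2 ->]; eexists; apply: combD.
    move=> i _; have [d hd] := hW' _ (mem_nth 0 (ltn_ord i)).
    rewrite mulrA chomC -mulrA hd combZ; by eexists.
  have [c cM hc] : exists2 c, forall i, c i \in M & phi h' * comb e a' = comb (e1 ++ e) c.
    rewrite sE; elim: s sM hN {sE} => [|t s IH] /=.
      exists (fun=> 0) => [i|]; first exact: rpred0.
      by rewrite big_nil mulr0 comb0.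
    move=> /andP[tM sM] /andP[/asboolP/spanN[d hd] hN].
    have [c cM hc] := IH sM hN.
    exists (fun i => t.1 * d i + c i) => [i|].
      by rewrite rpredD// mulrC idealMr.
    by rewrite big_cons mulrDr hc mulrA chomC -mulrA hd combZ combD.
  (* Coefficients are compared at position [size e1 + i]: they give h' times the scalar [a i] as an
     element of [M], while neither factor lies in [M] if [a i] is nonzero. *)
  move=> i; apply: contrapT => /eqP ai.
  have e2 : comb (e1 ++ e) (fun j =>
      (if (j < size e1)%N then 0 else h' * a' (j - size e1)%N) - c j) = 0.
    have -> : 0 = phi h' * comb e a' + phi (-1) * comb (e1 ++ e) c.
      by rewrite rmorphN rmorph1 mulN1r -hc subrr.
    rewrite combZ (comb_cat0 e1 e) combZ combD; congr (comb _ _).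
    by apply/funext => j; rewrite mulN1r.
  have := ie1 _ e2 (size e1 + i)%N; rewrite size_cat ltn_add2l => /(_ (ltn_ord i)).
  rewrite ltnNge leq_addr /= addKn /a' valK => /eqP; rewrite subr_eq0 => /eqP e3.
  have : h' * (a i)%:A \in M by rewrite e3.
  rewrite prime_idealrM (negPf h'M) /= => /(idealZ (a i)^-1).
  by rewrite scalerA mulVf// scale1r idealr1.
apply: (span_dim_ge ind) => i; apply: in_span_mem.
by apply: map_f; apply: eW; apply: mem_nth.
Qed.

Theorem very_generic_fibre (k_uncountable : ~ countable [set: k])
    (fgC : fg_ideals C) (l : nat -> seq C) :
  (forall w : C, exists n, in_span (idfun : {rmorphism k -> k}) (fam (s := l n)) w) ->
  exists M : prime_idealr C, maximal_ideal M /\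
    gkdim_fiber R phi M = gkdim_generic R phi.
Proof.
move=> hl.
have [eh heh] := choice (fun n => let: ex_intro e (ex_intro h H) := comb_words n in
  ex_intro (fun eh : seq B * C => [/\ comb_indep eh.1, {subset eh.1 <= words V n},
    eh.2 != 0 & {in words V n, forall w, exists c, phi eh.2 * w = comb eh.1 c}])
    (e, h) H).
have ext (nN : nat * nat) : exists eh1 : seq B * C,
    [/\ comb_indep (eh1.1 ++ (eh nN.1).1), eh1.2 != 0 &
      {in words V nN.2, forall w, exists c, phi eh1.2 * w = comb (eh1.1 ++ (eh nN.1).1) c}].
  have [ie _ _ _] := heh nN.1.
  have [e1 [h [h1 h2 h3 h4]]] := comb_extend (words V nN.2) ie.
  by exists (e1, h).
have [eh1 heh1] := choice ext.
(* One sequence enumerates both kinds of denominators over all pairs of lengths; 1 fills the indices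
   that code no pair. *)
pose h i := if unpickle i is Some nN then (eh nN.1).2 * (eh1 nN).2 else 1.
have [i|M [hM res]] := @generic_point _ k_uncountable C fgC l hl h.
  rewrite /h; case: (unpickle i) => [nN|]; last exact: oner_neq0.
  by apply: mulf_neq0; [case: (heh nN.1) | case: (heh1 nN)].
have hM' nN : (eh nN.1).2 \notin M /\ (eh1 nN).2 \notin M.
  have := hM (pickle nN); rewrite /h pickleK prime_idealrM negb_or.
  by move/andP.
exists M; split; first exact: residue_maximal.
rewrite gkdim_fiber_words gkdim_generic_words; congr (growth R _).
apply/funext => n; have [ie eW h0 hW] := heh n.
rewrite (generic_span_dim ie eW h0 hW); apply: (fibre_span_dim res ie eW _ hW).
  by have [] := hM' (n, 0%N).
move=> N; have [i1 _ hW1] := heh1 (n, N).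
by exists (eh1 (n, N)).1, (eh1 (n, N)).2; split=> //; have [] := hM' (n, N).
Qed.

(** The products of the elements [m n x] of [C] with generically independent words are independent
    over [k]: collect the coefficients in [C] of each word, then use independence of the [m n x].
    This multiplies the count of words by at least n^t. *)
Theorem gkdim_generic_add (t c0 : nat) (V' : seq B) (X : nat -> finType)
    (m : forall n, X n -> C) :
  (forall n, (n ^ t <= #|X n|)%N) ->
  (forall n, lin_indep (idfun : {rmorphism k -> k}) (m n)) ->
  (forall n x, wspan sigma V' (c0 * n) (phi (m n x))) ->
  (gkdim_generic R phi + t%:R%:E <= gkdim_alg R sigma)%E.
Proof.
move=> cX im hm.
apply: le_trans (ereal_sup_ubound _); last by exists (V ++ V').
rewrite gkdim_generic_words -[leRHS]adde0.
(* A word of length n times an element of length c0 n has length (c0 + 1) n. *)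
apply: (@growth_compare R _ _ 1 t 0 c0.+1 0) => // n _; rewrite expn0 !mul1n.
have [e [h [ie eW h0 hW]]] := comb_words n.
rewrite (generic_span_dim ie eW h0 hW).
apply: leq_trans (leq_mul (leqnn _) (cX n)) _.
rewrite -[size e]card_ord -card_prod.
apply: (@span_dim_ge _ _ sigma B^o _ _ (fun u : 'I_(size e) * X n => phi (m n u.2) * e`_(u.1))).
  move=> c hc [i x].
  pose d (i : nat) := if insub i is Some j then \sum_x c (j, x) *: m n x else 0.
  have : comb e d = 0.
    transitivity (\sum_(j < size e) \sum_y
        (sigma (c (j, y)) *: (phi (m n y) * e`_j : B^o) : B^o)).
      apply: eq_bigr => j _; rewrite /d valK rmorph_sum mulr_suml.
      by apply: eq_bigr => y _; rewrite -[_ *: m n y]mulr_algl rmorphM -mulrA.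
    by rewrite pair_bigA -[RHS]hc; apply: eq_bigr => -[j y] _.
  move=> /ie/(_ i (ltn_ord i)); rewrite /d valK => /im/(_ x); exact.
move=> [i x] /=; rewrite mulSn addnC.
have sub W : wspan sigma W n =1 wspan sigma W n by [].
apply: wspanM => //.
  by apply: in_span_sub (hm n x); apply: words_sub => v; rewrite mem_cat orbC => ->.
apply: in_span_sub (_ : wspan sigma V n _).
  by apply: words_sub => v; rewrite mem_cat => ->.
by apply: wspan_word; apply: eW; apply: mem_nth.
Qed.

End GenericFibre.

(** * Algebraic independence and Noether normalization *)

Section Gen.
Variables (k : fieldType) (C : idomAlgType k).

Section Adjoin.
Variables (S : subringClosed C) (x : C).
Definition adj_pred : {pred C} :=
  fun a => `[< exists2 P : {poly C}, P \is a polyOver S & a = P.[x] >].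
Fact adj_closed : subring_closed adj_pred.
Proof.
split; first by apply/asboolP; exists 1; rewrite ?hornerC// rpred1.
- move=> _ _ /asboolP[P PS ->] /asboolP[Q QS ->]; apply/asboolP.
  by exists (P - Q); rewrite ?hornerD ?hornerN// rpredB.
- move=> _ _ /asboolP[P PS ->] /asboolP[Q QS ->]; apply/asboolP.
  by exists (P * Q); rewrite ?hornerM// rpredM.
Qed.
Definition adj : subringClosed C :=
  HB.pack adj_pred (GRing.isSubringClosed.Build C adj_pred adj_closed).
Lemma adjP a :
  reflect (exists2 P : {poly C}, P \is a polyOver S & a = P.[x]) (a \in adj).
Proof. exact: asboolP. Qed.
End Adjoin.

Definition scalars_pred : {pred C} := fun a => `[< exists c : k, a = c%:A >].
Fact scalars_closed : subring_closed scalars_pred.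
Proof.
split; first by apply/asboolP; exists 1; rewrite scale1r.
- by move=> _ _ /asboolP[c ->] /asboolP[d ->]; apply/asboolP; exists (c - d);
    rewrite scalerBl.
- by move=> _ _ /asboolP[c ->] /asboolP[d ->]; apply/asboolP; exists (c * d);
    rewrite mulr_algl scalerA.
Qed.
Definition scalars : subringClosed C :=
  HB.pack scalars_pred (GRing.isSubringClosed.Build C scalars_pred scalars_closed).
Lemma scalarsP a : reflect (exists c : k, a = c%:A) (a \in scalars).
Proof. exact: asboolP. Qed.

Fixpoint gen (s : seq C) : subringClosed C :=
  if s is x :: s' then adj (gen s') x else scalars.

Lemma gen_tail x s a : a \in gen s -> a \in gen (x :: s).
Proof. by move=> h; apply/adjP; exists a%:P; rewrite ?polyOverC ?hornerC. Qed.

Lemma gen_head x s : x \in gen (x :: s).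
Proof. by apply/adjP; exists 'X; rewrite ?polyOverX ?hornerX. Qed.

Lemma gen_scalar s c : c%:A \in gen s.
Proof.
elim: s => [|x s IH]; first by apply/scalarsP; exists c.
exact: gen_tail.
Qed.

Lemma gen_mem s x : x \in s -> x \in gen s.
Proof.
elim: s => // y s IH; rewrite inE => /orP[/eqP ->|/IH]; first exact: gen_head.
exact: gen_tail.
Qed.

Lemma horner_closed (S : subringClosed C) (P : {poly C}) x :
  P \is a polyOver S -> x \in S -> P.[x] \in S.
Proof. by move=> PS xS; apply: rpred_horner. Qed.

Lemma gen_min (S : subringClosed C) s : (forall c : k, c%:A \in S) ->
  {subset s <= S} -> {subset gen s <= S}.
Proof.
move=> Sk; elim: s => [|x s IH] sS a; first by case/scalarsP => c ->.
case/adjP => P /polyOverP PS ->; apply: horner_closed.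
  apply/polyOverP => i; apply: IH (PS i) => y ys.
  by apply: sS; rewrite inE ys orbT.
by apply: sS; rewrite mem_head.
Qed.

Lemma gen_sub s t : {subset s <= gen t} -> {subset gen s <= gen t}.
Proof. by apply: gen_min => c; apply: gen_scalar. Qed.

(* For an ideal I: s is algebraically independent over k modulo I, each entry
   being transcendental over the subalgebra generated by the later ones. *)
Fixpoint rind (I : {pred C}) (s : seq C) : Prop :=
  if s is x :: s' then rind I s' /\
    forall P : {poly C}, P \is a polyOver (gen s') -> P.[x] \in I -> P = 0
  else forall c : k, c%:A \in I -> c = 0.

Lemma rind_gen I s a : rind I s -> a \in gen s -> a \in I -> a = 0.
Proof.
case: s => [|x s] /= => [h /scalarsP[c ->] /h ->|[_ h] /adjP[P PS ->] /(h _ PS) ->].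
  by rewrite scale0r.
by rewrite horner0.
Qed.

Local Notation free := (rind (pred1 0)).

Lemma free_nil : free [::].
Proof.
by move=> c; rewrite inE scaler_eq0 oner_eq0 orbF => /eqP.
Qed.

Lemma rind_of_free (I : {pred C}) s : free s ->
  (forall a, a \in gen s -> a \in I -> a = 0) -> rind I s.
Proof.
elim: s => [|x s IH] /= => [h hI c cI|[fs fx] hI].
  by apply: h; rewrite inE (hI _ _ cI)//; apply/scalarsP; exists c.
split; first by apply: IH => // a /(gen_tail x); apply: hI.
move=> P PS PI; apply: fx => //; rewrite inE; apply/eqP; apply: hI => //.
by apply/adjP; exists P.
Qed.

(** Coefficients come from a mere predicate, since besides subrings it is used with spaces of
    polynomials of bounded degree, closed only under addition. *)
Fixpoint sp (S : C -> Prop) (e : seq C) (c : C) : Prop :=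
  if e is y :: e' then exists a, S a /\ sp S e' (c - a * y) else c = 0.

Section Sp.
Variable S : C -> Prop.
Hypothesis S0 : S 0.
Hypothesis SD : forall a b, S a -> S b -> S (a + b).

Lemma sp0 e : sp S e 0.
Proof. by elim: e => //= y e IH; exists 0; rewrite mul0r subr0. Qed.

Lemma spD e a b : sp S e a -> sp S e b -> sp S e (a + b).
Proof.
elim: e a b => [|y e IH] a b /=; first by move=> -> ->; rewrite addr0.
move=> [u [Su hu]] [v [Sv hv]]; exists (u + v); split; first exact: SD.
by rewrite mulrDl opprD addrACA; apply: IH.
Qed.

Lemma sp_term e a i : S a -> (i < size e)%N -> sp S e (a * e`_i).
Proof.
move=> Sa; elim: e i => // y e IH [_|i] /=.
  by exists a; rewrite subrr; split=> //; apply: sp0.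
by rewrite ltnS => /IH h; exists 0; rewrite mul0r subr0.
Qed.

Lemma sp_cat e f a b : sp S e a -> sp S f b -> sp S (e ++ f) (a + b).
Proof.
elim: e a => [|y e IH] a /=; first by move=> ->; rewrite add0r.
by move=> [u [Su hu]] hb; exists u; split=> //; rewrite addrAC; apply: IH.
Qed.

Lemma sp_sum (I : Type) (r : seq I) (P : pred I) (F : I -> C) e :
  (forall i, P i -> sp S e (F i)) -> sp S e (\sum_(i <- r | P i) F i).
Proof.
by move=> h; apply: (big_ind (sp S e)) => //; [apply: sp0 | apply: spD].
Qed.

End Sp.

Lemma sp_map (S S' : C -> Prop) z e c :
  (forall a, S a -> S' (z * a)) -> sp S e c -> sp S' e (z * c).
Proof.
move=> h; elim: e c => [|y e IH] c /=; first by move=> ->; rewrite mulr0.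
by move=> [a [Sa /IH hc]]; exists (z * a); rewrite -mulrA -mulrBr; split; auto.
Qed.

Lemma sp_sub (S S' : C -> Prop) e c :
  (forall a, S a -> S' a) -> sp S e c -> sp S' e c.
Proof.
by move=> h; rewrite -[in X in _ -> X](mul1r c); apply: sp_map => a; rewrite mul1r; apply: h.
Qed.

Lemma sp_mulr (S : C -> Prop) z e c : sp S e c -> sp S [seq y * z | y <- e] (c * z).
Proof.
elim: e c => [|y e IH] c /=; first by move=> ->; rewrite mul0r.
by move=> [a [Sa /IH hc]]; exists a; rewrite mulrA -mulrBl.
Qed.

Definition in_sub (S : {pred C}) (a : C) : Prop := a \in S.

Definition finite_over (S : {pred C}) : Prop :=
  exists e, forall c, sp (in_sub S) e c.

Lemma sp_trans (S R : C -> Prop) f e c : (forall a, S a -> sp R f a) ->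
  sp S e c -> sp R [seq x * y | y <- e, x <- f] c.
Proof.
move=> h; elim: e c => [|y e IH] c //= [a [/h/(sp_mulr y) ha /IH hc]].
by rewrite -[c](subrK (a * y)) addrC; apply: sp_cat.
Qed.

Lemma finite_over_trans (S R : {pred C}) f :
  {in S, forall a, sp (in_sub R) f a} -> finite_over S -> finite_over R.
Proof.
by move=> h [e he]; eexists => c; apply: sp_trans (he c) => a; apply: h.
Qed.

Lemma finite_over_sub (S R : {pred C}) : {subset S <= R} ->
  finite_over S -> finite_over R.
Proof. by move=> SR [e he]; exists e => c; apply: sp_sub (he c) => a; apply: SR. Qed.

Lemma monic_div (S : subringClosed C) (G P : {poly C}) :
  G \is monic -> G \is a polyOver S -> P \is a polyOver S ->
  exists Q Rm, [/\ Q \is a polyOver S, Rm \is a polyOver S,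
    P = Q * G + Rm & (size Rm < size G)%N].
Proof.
move=> mG GS; have [n] := ubnP (size P); elim: n P => // n IH P sP PS.
have [lt|ge] := ltnP (size P) (size G).
  by exists 0, P; rewrite mul0r add0r; split=> //; apply: rpred0.
have sG : (0 < size G)%N by rewrite size_poly_gt0 monic_neq0.
pose T := lead_coef P *: 'X^(size P - size G).
have TS : T \is a polyOver S.
  by apply: polyOverZ; [apply: (polyOverP PS) | apply: rpredX; apply: polyOverX].
have [||Q [Rm [QS RS e sR]]] := IH (P - T * G).
- apply: (@leq_ltn_trans (size P).-1); last first.
    by move: sP ge sG; case: (size P) => [|m]; lia.
  apply/leq_sizeP => j hj; rewrite coefB /T -scalerAl coefZ coefXnM.
  have [e|ne] := eqVneq j (size P).-1.
    rewrite ifF; last by apply/negbTE; rewrite -leqNgt e; lia.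
    rewrite (_ : (j - _)%N = (size G).-1); last by rewrite e; lia.
    by rewrite e -!lead_coefE (monicP mG) mulr1 subrr.
  have hj' : (size P <= j)%N by move: hj ne; lia.
  rewrite (nth_default _ hj') ifF; last by apply/negbTE; rewrite -leqNgt; lia.
  have hs : (size G <= j - (size P - size G))%N.
    by rewrite leq_subRL ?subnK// (leq_trans (leq_subr _ _)).
  by rewrite [X in _ * X]nth_default ?mulr0 ?subrr.
- by rewrite rpredB// rpredM.
exists (T + Q), Rm; split=> //; first by rewrite rpredD.
by rewrite mulrDl -addrA -e addrC subrK.
Qed.

Lemma adj_finite (S : subringClosed C) (y : C) (G : {poly C}) (c : k) :
  (forall c : k, c%:A \in S) ->
  G \is a polyOver S -> c != 0 -> lead_coef G = c%:A -> G.[y] = 0 ->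
  exists f, {in adj S y, forall a, sp (in_sub S) f a}.
Proof.
move=> Sk GS c0 lG Gy.
pose G' := (c^-1)%:A *: G.
have mG : G' \is monic.
  rewrite monicE lead_coefZ lG mulr_algl scalerA mulVf// scale1r //.
have G'S : G' \is a polyOver S by rewrite polyOverZ.
have G'y : G'.[y] = 0 by rewrite hornerZ Gy mulr0.
exists [seq y ^+ i | i <- iota 0 (size G')] => _ /adjP[P PS ->].
have [Q [Rm [_ RS -> sR]]] := monic_div mG G'S PS.
rewrite hornerD hornerM G'y mulr0 add0r horner_coef.
apply: sp_sum => [||i _]; [exact: rpred0|exact: rpredD|].
have lt : (i < size [seq y ^+ i | i <- iota 0 (size G')])%N.
  by rewrite size_map size_iota (leq_trans _ (ltnW sR)).
have := @sp_term (in_sub S) (rpred0 _) _ Rm`_i i _ lt.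
rewrite (nth_map 0%N) ?size_iota ?nth_iota ?(leq_trans _ (ltnW sR))// add0n.
by apply; apply: (polyOverP RS).
Qed.

Lemma list_bound (T : eqType) (s : seq T) (Q : T -> nat -> Prop) :
  (forall x, x \in s -> exists n, Q x n) ->
  exists N, forall x, x \in s -> exists n, (n <= N)%N /\ Q x n.
Proof.
elim: s => [|x s IH] h; first by exists 0%N.
have [N hN] := IH (fun y ys => h y (mem_behead (s := x :: s) ys)).
have [n hn] := h x (mem_head _ _); exists (maxn N n) => y.
rewrite inE => /orP[/eqP ->|/hN[m [mN hm]]].
  by exists n; rewrite leq_maxr.
by exists m; rewrite leq_max mN.
Qed.

Definition quasi_monic (G : {poly C}) : Prop :=
  exists2 c : k, c != 0 & lead_coef G = c%:A.

Lemma quasi_monic_neq0 G : quasi_monic G -> G != 0.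
Proof.
move=> [c c0 lG]; rewrite -lead_coef_eq0 lG scaler_eq0 oner_eq0 orbF.
exact: c0.
Qed.

(* The substitution x = x' + y^N makes the top coefficient dominate. *)
Lemma nagata_assemble (S : subringClosed C) (x y : C) (Q : {poly C}) (N0 N : nat) :
  Q != 0 ->
  (forall i, exists G : {poly C}, [/\ G \is a polyOver S, G.[y] = Q`_i,
     (size G <= N0)%N & Q`_i != 0 -> quasi_monic G]) ->
  (0 < N)%N -> (N0 <= N)%N ->
  exists G : {poly C}, [/\ G \is a polyOver (adj S (x - y ^+ N)), G.[y] = Q.[x] &
    quasi_monic G].
Proof.
move=> Q0 /choice[G hG] N_gt0 N0N; set x' := x - y ^+ N.
have Sx' : {subset S <= adj S x'}.
  by move=> a aS; apply/adjP; exists a%:P; rewrite ?polyOverC ?hornerC.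
pose L := x'%:P + 'X^N.
have LS : L \is a polyOver (adj S x').
  rewrite rpredD ?rpredX ?polyOverX// polyOverC.
  by apply/adjP; exists 'X; rewrite ?polyOverX ?hornerX.
have mL : L \is monic by rewrite /L addrC monicXnaddC.
have sL i : size (L ^+ i) = (i * N).+1.
  rewrite -[LHS]prednK ?size_poly_gt0 ?monic_neq0 ?monic_exp// size_exp.
  by rewrite /L addrC size_XnaddC// mulnC.
have [d dE] : exists d, size Q = d.+1.
  by exists (size Q).-1; rewrite prednK// size_poly_gt0.
exists (\sum_(i < size Q) G i * L ^+ i); split.
- apply: rpred_sum => i _; rewrite rpredM ?rpredX//.
  have [GS _ _ _] := hG i; apply/polyOverP => j; apply: Sx'.
  exact: (polyOverP GS).
- rewrite horner_sum horner_coef; apply: eq_bigr => i _.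
  have [_ Gy _ _] := hG i; rewrite hornerM Gy horner_exp /L.
  by rewrite hornerD hornerC hornerXn subrK.
rewrite dE big_ord_recr /=.
have Qd : Q`_d != 0 by have := lead_coefE Q; rewrite dE /= => <-; rewrite lead_coef_eq0.
have [_ _ _ /(_ Qd) qG] := hG d; have [c c0 lG] := qG.
have G0 := quasi_monic_neq0 qG.
exists c => //; rewrite addrC lead_coefDl.
  by rewrite lead_coefM (monicP (monic_exp _ mL)) mulr1.
have Ld : L ^+ d != 0 by rewrite monic_neq0 ?monic_exp.
rewrite (size_mul G0 Ld) sL addnS /=.
have sG : (0 < size (G d))%N by rewrite size_poly_gt0.
(* The term of index i < d has size at most N0 + iN, hence at most dN, while the top term has size
   above dN. *)
apply: (@leq_ltn_trans (d * N)); last by rewrite -[X in (X < _)%N]add0n ltn_add2r.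
apply: (leq_trans (size_sum _ _ _)); apply/bigmax_leqP => i _.
apply: (leq_trans (size_polyMleq _ _)); rewrite sL addnS /=.
have [_ _ sGi _] := hG i; have := ltn_ord i.
rewrite -(ltn_pmul2r N_gt0) => _.
apply: leq_trans (leq_add (leq_trans sGi N0N) (leqnn _)) _.
by rewrite -mulSn leq_mul2r ltn_ord orbT.
Qed.

(** The variable [y] is kept and the others are changed so that each [g] gets a scalar leading
    coefficient in [y]. A whole list is treated at once because the induction on [s] passes from [g]
    to all its nonzero coefficients in the first variable. *)
Lemma nagata s y (gs : seq C) :
  (forall g, g \in gs -> g \in gen (s ++ [:: y]) /\ g != 0) ->
  exists s', [/\ size s' = size s, {subset s <= gen (y :: s')} &
    forall g, g \in gs -> exists G : {poly C},
      [/\ G \is a polyOver (gen s'), G.[y] = g & quasi_monic G]].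
Proof.
elim: s gs => [|x s IH] gs hgs.
  exists [::]; split=> // g /hgs[/adjP[P PS ->] g0]; exists P; split=> //.
  have P0 : P != 0 by apply: contraNneq g0 => ->; rewrite horner0.
  have /scalarsP[c hc] : lead_coef P \in scalars by apply: (polyOverP PS).
  exists c => //; apply: contraNneq P0 => c0.
  by rewrite -lead_coef_eq0 hc c0 scale0r.
have [Q hQ] := choice (fun g : {g | g \in gs} =>
  let: ex_intro2 P h1 h2 := adjP _ _ _ (hgs _ (svalP g)).1 in
  ex_intro (fun P : {poly C} => P \is a polyOver (gen (s ++ [:: y])) /\ sval g = P.[x])
    P (conj h1 h2)).
have [gs' hgs'] : exists gs' : seq C,
    (forall a, a \in gs' -> a \in gen (s ++ [:: y]) /\ a != 0) /\
    (forall (g : {g | g \in gs}) i, (Q g)`_i != 0 -> (Q g)`_i \in gs').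
  pose coefs (g : C) : seq C :=
    if insub g is Some g' then [seq a <- Q g' : seq C | a != 0] else [::].
  exists (flatten (map coefs gs)); split.
    move=> a /flattenP[_ /mapP[g ggs ->]]; rewrite /coefs insubT.
    rewrite mem_filter => /andP[a0 aQ]; split=> //.
    have [QS _] := hQ (Sub g ggs); have /(nthP 0)[i _ <-] := aQ.
    exact: (polyOverP QS).
  move=> g i gi; apply/flattenP; exists (coefs (sval g)).
    by apply: map_f; exact: (svalP g).
  rewrite /coefs -[sval g]/(val g) valK mem_filter gi /=; apply: mem_nth.
  by rewrite ltnNge; apply: contraNN gi => /(nth_default 0) ->.
have [s' [ss sub' hG]] := IH gs' hgs'.1.
have [N0 hN0] : exists N0, forall a, a \in gs' -> exists n, (n <= N0)%N /\
    exists G : {poly C}, [/\ G \is a polyOver (gen s'), G.[y] = a, quasi_monic G & size G = n].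
  by apply: list_bound => a /hG[G [h1 h2 h3]]; exists (size G), G.
(* One exponent exceeding all degrees in [y] serves every element of [gs]. *)
pose N := maxn N0 1; exists ((x - y ^+ N) :: s'); split; first by rewrite /= ss.
  have sub : {subset gen (y :: s') <= gen (y :: (x - y ^+ N) :: s')}.
    apply: gen_sub => z; rewrite inE => /orP[/eqP ->|zs]; first exact: gen_head.
    by apply: gen_tail; apply: gen_tail; apply: gen_mem.
  move=> z; rewrite inE => /orP[/eqP ->|/sub'/sub //].
  suff : (x - y ^+ N) + y ^+ N \in gen (y :: (x - y ^+ N) :: s') by rewrite subrK.
  by rewrite rpredD ?rpredX ?gen_head//; apply: gen_tail; apply: gen_head.
move=> g ggs; have [QS gE] := hQ (Sub g ggs).
have Q0 : Q (Sub g ggs) != 0.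
  apply: contraNneq (hgs _ ggs).2 => e; rewrite e horner0 in gE.
  by rewrite -[g]/(sval (Sub g ggs : {g | g \in gs})) gE.
have [i|||G [GS Gy qG]] := @nagata_assemble (gen s') x y _ N0 N Q0 _; last 3 first.
- by rewrite leq_maxr.
- by rewrite leq_maxl.
- exists G; split=> //; by rewrite Gy -gE.
have [->|Qi] := eqVneq (Q (Sub g ggs))`_i 0.
  by exists 0; rewrite horner0 size_poly0; split=> //; apply: rpred0.
have [n [nN [G [h1 h2 h3 h4]]]] := hN0 _ (hgs'.2 _ _ Qi).
by exists G; split=> //; rewrite h4.
Qed.

End Gen.

Arguments gen : simpl never.

Section Noether.
Variables (k : fieldType) (C : idomAlgType k).
Local Notation free := (rind (pred1 (0 : C))).

Lemma not_free_reduce (x : seq C) : ~ free x ->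
  exists x' : seq C, (size x').+1 = size x /\
    exists f, {in gen x, forall a, sp (in_sub (gen x')) f a}.
Proof.
elim: x => [|z s IH] nf; first by case: nf; apply: free_nil.
have [fs|nfs] := pselect (free s); last first.
  have [s' [ss [f hf]]] := IH nfs.
  exists (z :: s'); split; first by rewrite /= ss.
  exists f => _ /adjP[P PS ->]; rewrite horner_coef.
  apply: sp_sum => [||i _]; [exact: rpred0|exact: rpredD|].
  rewrite mulrC; apply: sp_map (hf _ (polyOverP PS i)) => a aS.
  by rewrite /in_sub rpredM ?rpredX ?gen_head//; apply: gen_tail.
have [P [PS Pz P0]] : exists P : {poly C},
    [/\ P \is a polyOver (gen s), P.[z] = 0 & P != 0].
  apply: contrapT => h; apply: nf; split=> // P PS; rewrite inE => /eqP Pz.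
  by apply: contrapT => /eqP P0; apply: h; exists P.
have gen_k (t : seq C) (c : k) : c%:A \in gen t by apply: gen_scalar.
case/lastP: s {IH nf} fs PS => [|s y] fs PS.
  have /scalarsP[c hc] : lead_coef P \in scalars C by apply: (polyOverP PS).
  have c0 : c != 0.
    by apply: contraNneq P0 => c0; rewrite -lead_coef_eq0 hc c0 scale0r.
  exists [::]; split=> //.
  exact: (@adj_finite _ _ (scalars C) z P c (gen_k [::]) PS c0 hc Pz).
rewrite -cats1 in PS *.
(* Making the nonzero coefficients of [P] quasi-monic in [y] turns P(z) = 0 into an integral
   equation for [y]. *)
pose gs : seq C := [seq a <- P : seq C | a != 0].
have hgs g : g \in gs -> g \in gen (s ++ [:: y]) /\ g != 0.
  rewrite mem_filter => /andP[g0 /(nthP 0)[i _ gi]]; split=> //.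
  by rewrite -gi; apply: (polyOverP PS).
have [s' [ss sub' hG]] := nagata hgs.
have [N0 hN0] : exists N0, forall a, a \in gs -> exists n, (n <= N0)%N /\
    exists G : {poly C}, [/\ G \is a polyOver (gen s'), G.[y] = a, quasi_monic G & size G = n].
  by apply: list_bound => a /hG[G [h1 h2 h3]]; exists (size G), G.
pose N := maxn N0 1; exists ((z - y ^+ N) :: s'); split.
  by rewrite /= ss size_cat addn1.
have [|||G [GS Gy [c c0 lG]]] := @nagata_assemble _ _ (gen s') z y P N0 N P0.
- move=> i; have [->|Pi] := eqVneq P`_i 0.
    by exists 0; rewrite horner0 size_poly0; split=> //; apply: rpred0.
  have [|n [nN [G [h1 h2 h3 h4]]]] := hN0 P`_i.
    rewrite mem_filter Pi /=; apply: mem_nth.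
    by rewrite ltnNge; apply: contraNN Pi => /(nth_default 0) ->.
  by exists G; split=> //; rewrite h4.
- by rewrite leq_maxr.
- by rewrite leq_maxl.
rewrite Pz in Gy.
have [f hf] := @adj_finite _ _ (gen ((z - y ^+ N) :: s')) y G c (gen_k _) GS c0 lG Gy.
exists f => a ha; apply: hf; rewrite -[adj _ _]/(gen (y :: (z - y ^+ N) :: s')).
apply: gen_sub ha => b; rewrite inE mem_cat => /or3P[/eqP ->|bs|].
- suff : (z - y ^+ N) + y ^+ N \in gen (y :: (z - y ^+ N) :: s') by rewrite subrK.
  by rewrite rpredD ?rpredX ?gen_head//; apply: gen_tail; apply: gen_head.
- apply: gen_sub (sub' _ bs) => d; rewrite inE => /orP[/eqP ->|ds].
    exact: gen_head.
  by do 2 apply: gen_tail; apply: gen_mem.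
- rewrite inE => /eqP ->; exact: gen_head.
Qed.

Lemma finite_gen_reduce x : finite_over (gen x) -> ~ free x ->
  exists2 x', (size x' < size x)%N & finite_over (@gen _ C x').
Proof.
move=> fx /not_free_reduce[x' [ss [f hf]]]; exists x'; first by rewrite -ss.
exact: finite_over_trans hf fx.
Qed.

Lemma noether_normalization (x0 : seq C) : finite_over (gen x0) ->
  exists x : seq C, [/\ free x, finite_over (gen x) &
    forall x', finite_over (@gen _ C x') -> (size x <= size x')%N].
Proof.
move=> f0; pose Q n := `[< exists2 x : seq C, size x = n & finite_over (gen x) >].
have Qex : exists n, Q n by exists (size x0); apply/asboolP; exists x0.
case: (ex_minnP Qex) => t /asboolP[x xt fx] tmin.
have xmin x' : finite_over (@gen _ C x') -> (size x <= size x')%N.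
  by move=> fx'; rewrite xt; apply: tmin; apply/asboolP; exists x'.
exists x; split=> //; apply: contrapT => nf.
by have [x' lt fx'] := finite_gen_reduce fx nf; have := xmin _ fx'; rewrite leqNgt lt.
Qed.

Fixpoint box (b t : nat) : finType :=
  if t is t'.+1 then ('I_b * box b t')%type : finType else unit.

Lemma card_box b t : #|box b t| = (b ^ t)%N.
Proof. by elim: t => [|t IH]; rewrite ?card_unit ?card_prod ?card_ord ?IH ?expnS. Qed.

Fixpoint mon (b : nat) (s : seq C) : box b (size s) -> C :=
  match s return box b (size s) -> C with
  | [::] => fun=> 1
  | z :: s' => fun f => z ^+ f.1 * mon f.2
  end.
Arguments mon : clear implicits.

Lemma mon_gen b s f : mon b s f \in gen s.
Proof.
elim: s f => [|z s IH] f; rewrite [mon _ _ _]/=.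
  by have := gen_scalar (C := C) [::] 1; rewrite scale1r.
by rewrite rpredM ?rpredX ?(gen_head z s)//; apply: gen_tail.
Qed.

Lemma mon_indep (I : {pred C}) b s : 0 \in I -> rind I s ->
  forall c : box b (size s) -> k, \sum_f c f *: mon b s f \in I -> forall f, c f = 0.
Proof.
move=> I0; elim: s => [|z s IH] /= => [h c hc [] | [rs hz] c hc [i f]].
  by apply: h; move: hc; rewrite (bigD1 tt)//= big1 ?addr0// => -[].
have := @IH rs (fun f => c (i, f)); apply.
pose P := \poly_(j < b) (\sum_f (if insub j is Some i then c (i, f) else 0) *: mon b s f).
suff P0 : P = 0.
  have := congr1 (fun p : {poly C} => p`_i) P0; rewrite coef0 coef_poly ltn_ord.
  by under eq_bigr do rewrite valK; move=> ->.
apply: hz.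
  apply/polyOverP => j; rewrite coef_poly; case: ifP => _; last exact: rpred0.
  apply: rpred_sum => g _; rewrite -mulr_algl rpredM ?mon_gen//.
  exact: gen_scalar.
rewrite horner_poly; move: hc; congr (_ \in I).
transitivity (\sum_(i < b) \sum_f c (i, f) *: (z ^+ i * mon b s f)).
  by rewrite pair_bigA; apply: eq_bigr => -[].
apply: eq_bigr => j _; rewrite mulr_suml; apply: eq_bigr => g _.
by rewrite valK -scalerAl mulrC.
Qed.

Lemma expr_words (s : seq C) z n j : z \in s -> (j <= n)%N -> z ^+ j \in words s n.
Proof.
move=> zs; elim: n j => [|n IH] [|j] //= jn; first by rewrite inE.
  by apply: words_mem; apply: (IH 0%N).
by rewrite exprS; apply: words_mulr => //; apply: IH.
Qed.

Lemma mon_words b s f (V : seq C) : {subset s <= V} -> mon b s f \in words V (b * size s).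
Proof.
elim: s f => [|z s IH] f sV /=; first by rewrite muln0 inE.
rewrite mulnS; apply: words_mul; last first.
  by apply: IH => y ys; apply: sV; rewrite inE ys orbT.
by apply: expr_words; [apply: sV; apply: mem_head | apply: ltnW].
Qed.

(** Polynomials of degree below [b] in each generator: the span of the monomials indexed by [box],
    in a form whose bounds add under products. *)
Fixpoint inbox (b : nat) (s : seq C) (a : C) : Prop :=
  if s is z :: s' then exists P : {poly C},
    [/\ (size P <= b)%N, forall i, inbox b s' P`_i & a = P.[z]]
  else exists c : k, a = c%:A.

Lemma inbox0 b s : inbox b s 0.
Proof.
elim: s => [|z s IH] /=; first by exists 0; rewrite scale0r.
by exists 0; rewrite size_poly0 horner0; split=> // i; rewrite coef0.
Qed.

Lemma inboxD b s x y : inbox b s x -> inbox b s y -> inbox b s (x + y).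
Proof.
elim: s x y => [|z s IH] x y /=.
  by move=> [c ->] [d ->]; exists (c + d); rewrite scalerDl.
move=> [P [sP hP ->]] [Q [sQ hQ ->]]; exists (P + Q); split.
- by rewrite (leq_trans (size_polyD _ _))// geq_max sP.
- by move=> i; rewrite coefD; apply: IH.
- by rewrite hornerD.
Qed.

Lemma inbox_leq b b' s x : (b <= b')%N -> inbox b s x -> inbox b' s x.
Proof.
move=> bb'; elim: s x => [|z s IH] x //= [P [sP hP ->]].
by exists P; split=> [|i|//]; [apply: leq_trans bb' | apply: IH].
Qed.

Lemma inboxM b b' s x y : inbox b s x -> inbox b' s y -> inbox (b + b') s (x * y).
Proof.
elim: s x y => [|z s IH] x y /=.
  by move=> [c ->] [d ->]; exists (c * d); rewrite mulr_algl scalerA.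
move=> [P [sP hP ->]] [Q [sQ hQ ->]]; exists (P * Q); split.
- by rewrite (leq_trans (size_polyMleq _ _))// (leq_trans (leq_pred _))// leq_add.
- move=> i; rewrite coefM; apply: (big_ind (inbox _ s)) => [||j _].
  + exact: inbox0.
  + exact: inboxD.
  + exact: IH.
- by rewrite hornerM.
Qed.

Lemma gen_inbox s a : a \in gen s -> exists b, inbox b s a.
Proof.
elim: s a => [|z s IH] a /=; first by case/scalarsP => c ->; exists 0%N, c.
case/adjP => P PS ->.
have [b hb] := choice (fun i => IH _ (polyOverP PS i)).
pose b' := (\max_(i < size P) b i + size P)%N.
exists b', P; split=> //; first by rewrite leq_addl.
move=> i; have [lt|ge] := ltnP i (size P); last first.
  by rewrite nth_default//; apply: inbox0.
apply: inbox_leq (hb i); apply: leq_trans (leq_addr _ _).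
exact: (@bigop.leq_bigmax _ (fun i : 'I_(size P) => b i) (Ordinal lt)).
Qed.

Lemma inbox_span b s a : inbox b s a ->
  in_span (idfun : {rmorphism k -> k}) (mon b s) a.
Proof.
elim: s a => [|z s IH] a /=.
  by move=> [c ->]; exists (fun=> c); rewrite (bigD1 tt)//= big1 ?addr0// => -[].
move=> [P [sP hP ->]]; rewrite horner_coef; apply: in_span_sum => i _.
have [c ->] := IH _ (hP i); rewrite mulr_suml; apply: in_span_sum => f _.
rewrite -scalerAl; apply: (@in_spanZ _ _ (idfun : {rmorphism k -> k})).
have -> : mon b s f * z ^+ i =
    mon b (z :: s) ((widen_ord sP i, f) : box b (size (z :: s))) by rewrite mulrC.
exact: in_span_self.
Qed.

Variable R : realType.

Lemma gkdim_ge_size (s : seq C) : free s ->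
  ((size s)%:R%:E <= gkdim_alg R (GRing.in_alg C))%E.
Proof.
move=> fs; apply: le_trans (ereal_sup_ubound _); last by exists s.
rewrite -[leLHS]add0e -(growth1 R) -[leRHS]adde0.
(* Monomials of [box n] have length at most n times [size s]; the extra one keeps the dilation
   positive for empty [s]. *)
apply: (@growth_compare R _ _ 1 (size s) 0 (size s).+1 0) => // n _.
rewrite expn0 !mul1n -(card_box n (size s)).
apply: (@span_dim_ge _ _ (GRing.in_alg C) C^o _ _ (mon n s)).
  move=> c hc; apply: (mon_indep (I := pred1 0)) fs _ _; rewrite ?inE//.
  rewrite -[X in X == _]/(\sum_f c f *: mon n s f) -[X in _ == X]hc.
  by apply/eqP; apply: eq_bigr => f _; rewrite -[RHS]/(_%:A * _) mulr_algl.
move=> f; apply: wspan_word; apply: (words_leq (n := n * size s)%N).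
  by rewrite mulnC leq_mul2r leqnSn orbT.
exact: mon_words.
Qed.

(** Multiplication by a generator raises degrees in the coordinates over [e] by at most a fixed [b],
    so words of length n have coordinates of degree below b(n + 1). *)
Lemma gkdim_le_size (x : seq C) : finite_over (gen x) ->
  (gkdim_alg R (GRing.in_alg C) <= (size x)%:R%:E)%E.
Proof.
move=> [e he]; apply: ge_ereal_sup => _ [V _ <-].
have inS0 b : inbox b x 0 := inbox0 b x.
have inSD b := @inboxD b x.
have bnd c : exists b, sp (inbox b x) e c.
  have := he c; elim: (e) c => [|y e' IH] c /=; first by move=> ->; exists 0%N.
  move=> [a [aS /IH[b hb]]]; have [b' hb'] := gen_inbox aS.
  exists (b' + b)%N, a; split; first by apply: inbox_leq hb'; rewrite leq_addr.
  by apply: sp_sub hb => u; apply: inbox_leq; rewrite leq_addl.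
have [b hb] : exists b, forall z, z \in 1 :: [seq v * y | v <- 1 :: V, y <- e] ->
    sp (inbox b x) e z.
  have [b hb] := list_bound (fun z (_ : z \in 1 :: [seq v * y | v <- 1 :: V, y <- e]) => bnd z).
  exists b => z /hb[m [mb]]; apply: sp_sub => u; exact: inbox_leq.
have hw n w : w \in words V n -> sp (inbox (b * n.+1) x) e w.
  elim: n w => [|n IH] w; first by rewrite inE muln1 => /eqP ->; apply: hb; rewrite mem_head.
  move=> /wordsP[[v u] /= [hv /IH hu ->]].
  have hve y : y \in e -> sp (inbox b x) e (v * y).
    move=> ye; apply: hb; rewrite inE; apply/orP; right; apply/allpairsP.
    by exists (v, y).
  move: hu hve; move: {1 2}(e) => e'; elim: e' u => [|y e' IHe] u /=.
    by move=> -> _; rewrite mulr0; apply: sp0.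
  move=> [a [ha hu]] hve; rewrite -[u](subrK (a * y)) mulrDr.
  apply: (spD (inSD _)).
    by apply: IHe => // y' hy'; apply: hve; rewrite inE hy' orbT.
  rewrite mulrCA; apply: sp_map (hve y (mem_head _ _)) => a' ha'.
  by rewrite [(b * _)%N]mulnS addnC; apply: inboxM.
(* The factor 2 comes from n + 1 <= 2n, valid from n = 1 on. *)
suff h n : (1 <= n)%N -> (span_dim (GRing.in_alg C) (words V n : seq C^o) * n ^ 0 <=
    size e * (b * 2) ^ size x * n ^ size x * 1)%N.
  have := @growth_compare R (fun n => span_dim (GRing.in_alg C) (words V n : seq C^o))
    (fun=> 1%N) _ 0 (size x) 1 1 isT h.
  by rewrite adde0 growth1 add0e.
move=> n1.
rewrite expn0 !muln1.
apply: (@leq_trans (size e * (b * n.+1) ^ size x)); last first.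
  rewrite -mulnA -expnMn leq_mul2l; apply/orP; right.
  case: (size x) => // t; rewrite leq_exp2r// -mulnA leq_mul2l; apply/orP; right.
  by rewrite mul2n -addnn -addn1 leq_add2l.
rewrite -(card_box (b * n.+1)%N (size x)) -[size e]card_ord -card_prod.
apply: (@span_dim_le _ _ (GRing.in_alg C) C^o _ _
  (fun u : 'I_(size e) * box (b * n.+1)%N (size x) => mon _ x u.2 * e`_(u.1))).
move=> w /hw; move: (fun y (ye : y \in e) => ye).
move: {1 3}e => e'; elim: e' w => [|y e' IHe] w he' /=.
  by move=> ->; apply: in_span0.
move=> [a [ha hu]]; rewrite -[w](subrK (a * y)); apply: (@in_spanD _ _ _ C^o).
  by apply: IHe => // y' hy'; apply: he'; rewrite inE hy' orbT.
have lt : (index y e < size e)%N by rewrite index_mem he' ?mem_head.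
have [c ->] := inbox_span ha; rewrite -[y in X in _ X](nth_index 0 (he' y (mem_head _ _))).
rewrite mulr_suml; apply: (@in_span_sum _ _ _ C^o) => f _.
rewrite -scalerAl -mulr_algl; apply: (@in_spanZ _ _ (GRing.in_alg C) C^o).
exact: (@in_span_self _ _ _ C^o _
  (fun u : 'I_(size e) * box _ _ => mon _ x u.2 * e`_(u.1)) (Ordinal lt, f)).
Qed.

End Noether.

(** * Height and transcendence degree *)

Lemma chain_stable (A : pzRingType) (M : lmodType A) (N : nat -> submodClosed M) :
  (forall N : submodClosed M, fg_submod N) ->
  (forall i, {subset N i <= N i.+1}) -> exists n, {subset N n.+1 <= N n}.
Proof.
move=> fgM; move eI: (N 0%N) => I; move: I N eI.
apply: (noetherian_ind fgM) => I IH N eI inc.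
have [h|h] := pselect {subset N 1%N <= N 0%N}; first by exists 0%N.
have [||n hn] := IH (N 1%N) _ _ (N \o succn) erefl (fun i => inc i.+1).
- by rewrite -eI; apply: inc.
- by rewrite -eI.
by exists n.+1.
Qed.

Section HeightOne.
Variables (k : closedFieldType) (C : idomAlgType k).

Definition id_hom : central_hom C C :=
  @CentralHom C C (idfun : {rmorphism C -> C}) (fun c b => mulrC c b).

(** As [y] is transcendental over [S], the identity holds between polynomials, where a monic [G] is
    regular modulo [r]: the remainder of [B] by [G], times [r], is a multiple of [G] of too small
    degree. *)
Lemma monic_divide (S : subringClosed C) (y : C) (G A B : {poly C}) r :
  (forall P : {poly C}, P \is a polyOver S -> P.[y] = 0 -> P = 0) ->
  G \is monic -> G \is a polyOver S -> A \is a polyOver S ->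
  B \is a polyOver S -> r \in S -> G.[y] * A.[y] = r * B.[y] ->
  exists2 Q : {poly C}, Q \is a polyOver S & A.[y] = r * Q.[y].
Proof.
move=> ty mG GS AS BS rS e.
have eP : G * A = r *: B.
  apply/eqP; rewrite -subr_eq0; apply/eqP; apply: ty.
    by rewrite rpredB ?rpredM ?polyOverZ.
  by rewrite hornerD hornerN hornerM hornerZ e subrr.
have [Q [Rm [QS RS BE sR]]] := monic_div mG GS BS.
have e2 : G * (A - r *: Q) = r *: Rm.
  by rewrite mulrBr eP BE scalerDr -scalerAr [G * Q]mulrC addrAC subrr add0r.
exists Q => //; have [->|ne] := eqVneq A (r *: Q); first by rewrite hornerZ.
have : (size (G * (A - r *: Q))%R <= size Rm)%N by rewrite e2 size_scale_leq.
have d0 : A - r *: Q != 0 by rewrite subr_eq0.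
rewrite (size_mul (monic_neq0 mG) d0) => /leq_ltn_trans/(_ sR).
have : (0 < size (A - r *: Q)%R)%N by rewrite size_poly_gt0 subr_eq0.
by case: (size (A - r *: Q)%R) => // m _; rewrite addnS /= ltnNge leq_addr.
Qed.

Hypothesis fgC : fg_ideals C.
Variable P : prime_idealr C.
Hypothesis P_min : forall Q : prime_idealr C, (exists2 z, z \in Q & z != 0) ->
  {subset Q <= P} -> {subset P <= Q}.

Lemma prime_idealrX (I : prime_idealr C) s n : s ^+ n \in I -> s \in I.
Proof.
elim: n => [|n IH]; first by rewrite expr0 idealr1.
by rewrite exprS prime_idealrM => /orP[|/IH].
Qed.

(** Modulo [g1], [g2] is nilpotent in the localization at [P]: otherwise a nonzero prime inside [P]
    would contain [g1] but not [g2], against minimality. *)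
Lemma minimal_prime_power g1 g2 : g1 \in P -> g1 != 0 -> g2 \in P ->
  exists s N h, s \notin P /\ s * g2 ^+ N = g1 * h.
Proof.
move=> g1P g10 g2P; pose H (x : C) := exists s N, s \notin P /\ x = s * g2 ^+ N.
apply: contrapT => nH.
have [|x y|x|M [IM dM _]] := @prime_avoiding C H (mspan_submod ([:: g1] : seq C^o)) fgC.
- by exists 1, 0%N; rewrite mulr1 idealr1.
- move=> [s [N [sP ->]]] [s' [N' [sP' ->]]]; exists (s * s'), (N + N')%N.
  by rewrite prime_idealrM negb_or sP sP' exprD mulrACA.
- move=> /mspan_submodP /= [a /eqP]; rewrite subr_eq0 => /eqP -> [s [N [sP e]]].
  apply: nH; exists s, N, a; split=> //.
  by rewrite -e mulrC.
have g1M : g1 \in M.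
  by apply: IM; apply/mspan_submodP; apply: mspan_mem; rewrite mem_head.
have MP : {subset M <= P}.
  move=> z zM; apply: contrapT => /negP zP; apply: (dM z zM).
  by exists z, 0%N; rewrite mulr1.
have g2M : g2 \in M by apply: (P_min _ MP) => //; exists g1.
by apply: (dM g2 g2M); exists 1, 1%N; rewrite mul1r idealr1.
Qed.

(** Localized at [P], a power of G(y) is a multiple of [g1]: s G(y)^N = g1 h with [s] outside [P].
    Regularity of the pair in R[y] then makes every s^M divisible by g1^M up to the fixed
    denominator [sg], and the ascending chain condition forces a power of [s] into [P]. *)
Lemma height_one_contradiction (R : subringClosed C) (y : C)
    (G : {poly C}) g1 :
  (forall Q : {poly C}, Q \is a polyOver R -> Q.[y] = 0 -> Q = 0) ->
  finite_over (adj R y) ->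
  g1 \in R -> g1 \in P -> g1 != 0 ->
  G \is monic -> G \is a polyOver R -> G.[y] \in P -> False.
Proof.
move=> ty [f]; move: (adjP R y); move: (adj R y) => S SP hf g1R g1P g10 mG GR GP.
have RS : {subset R <= S}.
  by move=> a aR; apply/SP; exists a%:P; rewrite ?polyOverC ?hornerC.
have i0 : @comb_indep_in _ _ _ id_hom S [::] by [].
(* Finite over R[y] does not mean free; [sg] carries all of [C] into a free R[y]-module, where
   coordinates can be compared. *)
have [e [sg [ie _ sgS sg0 hW]]] := comb_extend_in f i0.
rewrite cats0 in ie hW.
have hC z : exists2 c, forall i, c i \in S & sg * z = @comb _ _ _ id_hom e c.
  have := hf z; elim: f hW z {hf} => [|w f IH] hW z /=.
    move=> ->; exists (fun=> 0) => [i|]; first exact: rpred0.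
    by rewrite comb0 mulr0.
  move=> [a [aS /IH[|c cS hc]]].
    by move=> v vf; apply: hW; rewrite inE vf orbT.
  have [d dS hd] := hW w (mem_head _ _).
  exists (fun i => a * d i + c i); first by move=> i; rewrite rpredD ?rpredM.
  by rewrite -combD -combZ -hd -hc -[chom _ _]/a -[chom _ _]/sg; ring.
have [s [N [h [sP e1]]]] := minimal_prime_power g1P g10 GP.
have key M : exists v, sg * s ^+ M = g1 ^+ M * v.
  have [a aS ha] := hC (s ^+ M); have [b bS hb] := hC (h ^+ M).
  have e2 : G.[y] ^+ (N * M) * s ^+ M = g1 ^+ M * h ^+ M.
    by rewrite exprM -exprMn mulrC e1 exprMn.
  have hi i : (i < size e)%N -> G.[y] ^+ (N * M) * a i = g1 ^+ M * b i.
    move=> ilt; apply/eqP; rewrite -subr_eq0; apply/eqP.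
    apply: (ie (fun i => G.[y] ^+ (N * M) * a i - g1 ^+ M * b i)) => // [j|].
      rewrite rpredB ?rpredM ?rpredX//; last exact: RS.
      by apply/SP; exists G.
    have -> : (fun i => G.[y] ^+ (N * M) * a i - g1 ^+ M * b i) =
        (fun i => G.[y] ^+ (N * M) * a i + - g1 ^+ M * b i).
      by apply/funext => j; rewrite mulNr.
    rewrite -combD -!combZ -ha -hb.
    rewrite -[chom _ _]/(G.[y] ^+ (N * M)) -[chom _ _]/(- g1 ^+ M).
    by rewrite mulrCA e2; ring.
  have hv i : exists v, (i < size e)%N -> a i = g1 ^+ M * v.
    have [ilt|] := ltnP i (size e); last by exists 0.
    have /SP[A AR aE] := aS i; have /SP[B BR bE] := bS i.
    have := hi i ilt; rewrite aE bE -horner_exp => h1.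
    have [||Q QR hQ] := monic_divide ty (monic_exp (N * M) mG) _ AR BR _ h1.
    - exact: rpredX.
    - exact: rpredX.
    by exists Q.[y].
  have [v hv'] := choice hv; exists (@comb _ _ _ id_hom e v).
  rewrite ha -[g1 ^+ M * _]/(id_hom (g1 ^+ M) * _) combZ.
  by apply: eq_bigr => i _; rewrite hv'.
have [v hv] := choice key.
(* The ideals of x with g1^n x in sg P ascend because [g1] lies in [P]. The quotient of sg s^n by
   g1^n lies in the one of index n + 1; at a stable index, cancelling [sg] leaves s^n in [P]. *)
pose Nn n : {pred C^o} := fun x : C => `[< exists2 z, z \in P & g1 ^+ n * x = sg * z >].
have Nc n : submod_closed (Nn n).
  split; first by apply/asboolP; exists 0; rewrite ?rpred0 ?mulr0.
  move=> a x z /asboolP[u uP hu] /asboolP[w wP hw]; apply/asboolP.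
  exists ((a : C) * u + w); first by rewrite rpredD ?idealMr.
  rewrite -[a *: x]/((a : C) * (x : C)) mulrDr [RHS]mulrDr -hw; congr (_ + _).
  by rewrite mulrCA hu mulrCA.
pose NN n : submodClosed C^o := HB.pack (Nn n) (GRing.isSubmodClosed.Build C C^o (Nn n)
    (GRing.submod_closed_semi (Nc n))).
have [i x|n hn] := @chain_stable _ _ NN fgC.
  move=> /asboolP[z zP hz]; apply/asboolP; exists (g1 * z); first by rewrite idealMr.
  by rewrite exprS -mulrA hz mulrCA.
have vN : (v n : C^o) \in NN n.+1.
  apply/asboolP; exists (g1 * s ^+ n); first by rewrite mulrC idealMr.
  by rewrite exprS -mulrA -hv mulrCA.
have /asboolP[z zP] := hn _ vN; rewrite -hv => /(mulfI sg0) sz.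
by move/negP: sP; apply; apply: (@prime_idealrX P s n); rewrite sz.
Qed.

(** If k[x] meets [P] in a nonzero [g], make [g] monic in the last variable [y]. By
    [height_one_contradiction] the remaining variables generate a subring meeting [P] in zero, so
    only one variable is lost. *)
Theorem height_one_rind (x : seq C) : rind (pred1 0) x -> finite_over (gen x) ->
  (forall x', finite_over (@gen _ C x') -> (size x <= size x')%N) ->
  exists y, rind P y /\ (size x <= (size y).+1)%N.
Proof.
move=> fx hx xmin.
have [triv|] := pselect (forall a, a \in gen x -> a \in P -> a = 0).
  by exists x; split; [apply: rind_of_free | apply: leqnSn].
move=> /existsNP[g /not_implyP[gx /not_implyP[gP /eqP g0]]].
have inv c : c != 0 -> (c%:A : C) \in P -> False.
  move=> c0 /(idealZ c^-1); rewrite scalerA mulVf// scale1r.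
  by rewrite idealr1.
case/lastP: x fx hx xmin gx => [|s y] fx hx xmin gx.
  case/scalarsP: gx => c gE; exfalso; apply: (inv c); last by rewrite -gE.
  by apply: contraNneq g0 => c0; rewrite gE c0 scale0r.
rewrite -cats1 in fx hx xmin gx *.
have [|s' [ss sub' /(_ g (mem_head _ _))[G [GS Gy qG]]]] := @nagata _ _ s y [:: g].
  by move=> a; rewrite inE => /eqP ->.
have sgen : {subset gen (s ++ [:: y]) <= gen (y :: s')}.
  apply: gen_sub => z; rewrite mem_cat => /orP[/sub' //|].
  by rewrite inE => /eqP ->; apply: gen_head.
have fin' : finite_over (gen (y :: s')) := finite_over_sub sgen hx.
(* The new list is as long as the shortest one over which [C] is finite, so it cannot be
   dependent. *)
have free' : rind (pred1 0) (y :: s').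
  apply: contrapT => /(finite_gen_reduce fin')[x' lt /xmin].
  by rewrite leqNgt size_cat addn1 -ss lt.
have [free_s' ty] := free'.
have [triv|] := pselect (forall a, a \in gen s' -> a \in P -> a = 0).
  exists s'; split; first exact: rind_of_free.
  by rewrite size_cat addn1 ss.
move=> /existsNP[g1 /not_implyP[g1R /not_implyP[g1P /eqP g10]]].
have [c c0 lG] := qG; exfalso.
apply: (@height_one_contradiction (gen s') y ((c^-1)%:A *: G) g1) => //.
- by move=> Q QR Qy; apply: ty => //; rewrite inE Qy.
- by rewrite monicE lead_coefZ lG mulr_algl scalerA mulVf// scale1r.
- by rewrite polyOverZ ?gen_scalar.
- by rewrite hornerZ idealMr// Gy.
Qed.

End HeightOne.

Lemma rind_sub (k : fieldType) (C : idomAlgType k) (I J : {pred C}) s :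
  {subset I <= J} -> rind J s -> rind I s.
Proof.
move=> IJ; elim: s => [|x s IH] /= => [h c /IJ /h //|[/IH hs h]].
by split=> // P PS /IJ; apply: h.
Qed.

(** If P(h) lies in [p], the constant coefficient of P lies in [J], hence is zero; as [h] is not in
    the prime [p], a factor [h] can be cancelled and the degree descends. *)
Lemma rind_cons (k : fieldType) (C : idomAlgType k) (p : prime_idealr C) (J : {pred C})
    (h : C) (y : seq C) :
  (forall a b, a \in J -> b \in J -> a + b \in J) ->
  (forall a b, b \in J -> a * b \in J) ->
  {subset p <= J} -> h \in J -> h \notin p -> rind J y -> rind p (h :: y).
Proof.
move=> JD JM pJ hJ hp ry; split; first exact: rind_sub ry.
elim/poly_ind => // P c IH /polyOverP PS.
have cS : c \in gen y by have := PS 0%N; rewrite coefD coefMX coefC add0r.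
have P'S : P \is a polyOver (gen y).
  apply/polyOverP => i; have := PS i.+1; by rewrite coefD coefMX coefC addr0.
rewrite hornerMXaddC => e.
have c0 : c = 0.
  apply: (rind_gen ry cS); rewrite -[c](addKr (P.[h] * h)).
  by apply: JD; [rewrite -mulNr JM | apply: pJ].
move: e; rewrite c0 !addr0 prime_idealrM (negPf hp) orbF => /(IH P'S) ->.
by rewrite mul0r.
Qed.

Section Transfer.
Variables (k : fieldType) (Z : idomAlgType k) (q : prime_idealr Z).
Local Notation C := (prime_quot q).
Local Notation pi := (@prime_pi k Z q).

Lemma prime_piZ (c : k) z : pi (c *: z) = c *: pi z.
Proof. by rewrite -[RHS]/(prime_scale c _) prime_scale_pi. Qed.

Fact prime_pi_zmod_morphism : zmod_morphism pi.
Proof. exact: prime_piB. Qed.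
Fact prime_pi_monoid_morphism : monoid_morphism pi.
Proof. by split; [apply: prime_pi1 | apply: prime_piM]. Qed.
HB.instance Definition _ := GRing.isZmodMorphism.Build Z C pi prime_pi_zmod_morphism.
HB.instance Definition _ := GRing.isMonoidMorphism.Build Z C pi prime_pi_monoid_morphism.

Lemma prime_pi_alg (c : k) : pi c%:A = c%:A.
Proof. by rewrite prime_piZ rmorph1. Qed.

Lemma prime_pi_eq0 z : (pi z == 0) = (z \in q).
Proof.
rewrite -(rmorph0 pi); apply/eqP/idP => [/prime_piP|h]; first by rewrite subr0.
by apply/prime_piP; rewrite subr0.
Qed.

Lemma prime_pi_surj (x : C) : exists z, x = pi z.
Proof. by exists (prime_repr x); rewrite prime_reprK. Qed.

Lemma gen_pi s a : a \in gen s -> pi a \in gen (map pi s).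
Proof.
elim: s a => [|x s IH] a.
  case/scalarsP => c ->; rewrite prime_pi_alg; exact: (gen_scalar [::]).
case/adjP => P PS ->; apply/adjP; exists (map_poly pi P); last by rewrite horner_map.
by apply/polyOverP => i; rewrite coef_map; apply: IH; apply: (polyOverP PS).
Qed.

Lemma gen_pi_lift s a : a \in gen (map pi s) -> exists2 b, b \in gen s & a = pi b.
Proof.
elim: s a => [|x s IH] a.
  case/scalarsP => c ->; exists c%:A; last by rewrite prime_pi_alg.
  exact: (gen_scalar [::]).
case/adjP => P PS ->.
have [c cS] := choice (fun i => let: ex_intro2 b h1 h2 := IH _ (polyOverP PS i) in
  ex_intro (fun b => b \in gen s /\ P`_i = pi b) b (conj h1 h2)).
exists (\poly_(i < size P) c i).[x].
  apply/adjP; exists (\poly_(i < size P) c i) => //; apply/polyOverP => i.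
  by rewrite coef_poly; case: ifP => _; [case: (cS i) | apply: rpred0].
rewrite -horner_map; congr (_.[_]); apply/polyP => i; rewrite coef_map coef_poly /=.
case: ifP => hi; first by case: (cS i).
by rewrite rmorph0 nth_default// leqNgt hi.
Qed.

Variables (I : {pred Z}) (J : {pred C}).
Hypothesis IJ : forall z, (z \in I) = (pi z \in J).

Lemma rind_lift s : 0 \in J -> rind J (map pi s) -> rind I s.
Proof.
move=> J0; elim: s => [|x s IH] /=.
  by move=> h c; rewrite IJ prime_pi_alg => /h.
move=> [/IH rs h]; split=> // P PS; rewrite IJ -horner_map => PI.
have P0 : map_poly pi P = 0.
  apply: h PI; apply/polyOverP => i; rewrite coef_map; apply: gen_pi.
  exact: (polyOverP PS).
apply/polyP => i; rewrite coef0; apply: (rind_gen rs (polyOverP PS i)).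
by rewrite IJ -[pi _](coef_map pi) P0 coef0.
Qed.

Lemma rind_map s : rind I s -> rind J (map pi s).
Proof.
elim: s => [|x s IH] /=; first by move=> h c cJ; apply: h; rewrite IJ prime_pi_alg.
move=> [/IH rs h]; split=> // P PS PJ.
have [c cS] := choice (fun i => let: ex_intro2 b h1 h2 := gen_pi_lift (polyOverP PS i) in
  ex_intro (fun b => b \in gen s /\ P`_i = pi b) b (conj h1 h2)).
pose Q := \poly_(i < size P) c i.
have PE : P = map_poly pi Q.
  apply/polyP => i; rewrite coef_map coef_poly /=; case: ifP => hi.
    by case: (cS i).
  by rewrite rmorph0 nth_default// leqNgt hi.
suff Q0 : Q = 0 by rewrite PE Q0 rmorph0.
apply: h; last by rewrite IJ -horner_map -PE.
apply/polyOverP => i.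
by rewrite coef_poly; case: ifP => _; [case: (cS i) | apply: rpred0].
Qed.

End Transfer.

Section Affine.
Variables (k : closedFieldType) (Z : idomAlgType k) (x0 : seq Z).
Hypothesis Zgen : forall a, a \in gen x0.

Lemma fg_ideals_affine : fg_ideals Z.
Proof.
suff [R [f [fgR sf]]] : exists (R : comNzRingType) (f : {rmorphism R -> Z}),
    fg_ideals R /\ forall a, a \in gen x0 -> exists r, a = f r.
  by apply: (fg_ideals_surj (f := f)) fgR => a; apply: sf.
elim: (x0) => [|x s [R [f [fgR sf]]]].
  exists k, (GRing.in_alg Z); split; first exact: fg_ideals_field.
  by move=> a /scalarsP[c ->]; exists c.
have cf : commr_rmorph f x by move=> r; apply: mulrC.
exists {poly R}, (horner_morph cf); split; first exact: hilbert_basis.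
move=> _ /adjP[P PS ->].
have [c hc] := choice (fun i => sf _ (polyOverP PS i)).
exists (\poly_(i < size P) c i); congr (_.[_]); apply/polyP => i.
rewrite coef_map coef_poly /=; case: ifP => hi; first exact: hc.
by rewrite rmorph0 nth_default// leqNgt hi.
Qed.

Lemma finite_over_affine : finite_over (gen x0).
Proof.
by exists [:: 1] => a; exists a; split; [apply: Zgen | rewrite mulr1 subrr].
Qed.

Variable q : prime_idealr Z.

Lemma quot_affine (a : prime_quot q) : a \in gen (map (@prime_pi k Z q) x0).
Proof. by have [z ->] := prime_pi_surj a; apply: gen_pi. Qed.

End Affine.

Definition trdeg (k : fieldType) (C : idomAlgType k) (I : {pred C}) (t : nat) : Prop :=
  (exists2 y, rind I y & size y = t) /\ forall y, rind I y -> (size y <= t)%N.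

Lemma trdeg_ext (k : fieldType) (C : idomAlgType k) (I J : {pred C}) t :
  I =i J -> trdeg I t -> trdeg J t.
Proof.
move=> IJ [[y ry yt] m]; split=> [|z rz]; [exists y => //|apply: m];
by [apply: rind_sub ry => a; rewrite IJ | apply: rind_sub rz => a; rewrite IJ].
Qed.

(** Gelfand-Kirillov dimension gives the invariance of the transcendence degree: it bounds every
    independent list from above and equals the size of a normalizing one. *)
Lemma trdeg_gkdim (R : realType) (k : closedFieldType) (C : idomAlgType k) (x0 : seq C) :
  (forall a, a \in gen x0) -> exists x : seq C,
    [/\ rind (pred1 0) x, trdeg (pred1 (0 : C)) (size x), finite_over (gen x),
      gkdim_alg R (GRing.in_alg C) = (size x)%:R%:E &
      forall x', finite_over (@gen _ C x') -> (size x <= size x')%N].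
Proof.
move=> Cgen; have [x [fx hx xmin]] := noether_normalization (finite_over_affine Cgen).
have gkE : gkdim_alg R (GRing.in_alg C) = (size x)%:R%:E.
  by apply/eqP; rewrite eq_le gkdim_le_size// gkdim_ge_size.
exists x; split=> //; split; first by exists x.
by move=> y /(gkdim_ge_size R); rewrite gkE lee_fin ler_nat.
Qed.

Section Height.
Variables (R : realType) (k : closedFieldType) (Z : idomAlgType k) (x0 : seq Z).
Hypothesis Zgen : forall a, a \in gen x0.

Lemma mem_pred1_pi (q : prime_idealr Z) z :
  (z \in q) = (prime_pi q z \in pred1 (0 : prime_quot q)).
Proof. by rewrite inE prime_pi_eq0. Qed.

Lemma trdeg_quot (q : prime_idealr Z) t :
  trdeg (pred1 (0 : prime_quot q)) t -> trdeg q t.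
Proof.
move=> [[y ry yt] m]; split=> [|z /(rind_map (mem_pred1_pi q))/m].
  have [z zE] := lift_seq (@prime_pi_surj _ _ q) y.
  exists z; last by rewrite -yt zE size_map.
  by apply: (rind_lift (mem_pred1_pi q)); rewrite -?zE ?inE.
by rewrite size_map.
Qed.

Lemma trdeg_exists (q : prime_idealr Z) : exists t, trdeg q t.
Proof.
have [x [_ tx _ _ _]] := trdeg_gkdim R (quot_affine Zgen (q := q)).
by exists (size x); apply: trdeg_quot.
Qed.

Lemma trdeg_drop (q q' : prime_idealr Z) t t' : {subset q <= q'} ->
  ~ {subset q' <= q} -> trdeg q t -> trdeg q' t' -> (t' < t)%N.
Proof.
move=> qq' nqq' [_ tm] [[y ry <-] _].
have [h hq' hq] : exists2 h, h \in q' & h \notin q.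
  by apply: contrapT => h; apply: nqq' => z zq'; apply: contrapT => /negP zq; apply: h; exists z.
rewrite -[(size y).+1]/(size (h :: y)); apply: tm.
apply: (rind_cons (J := q')) => //; first by move=> a b; apply: rpredD.
by move=> a b; apply: idealMr.
Qed.

Lemma trdeg_adjacent (q q' : prime_idealr Z) t t' : {subset q <= q'} ->
  (forall Q : prime_idealr Z, {subset q <= Q} -> ~ {subset Q <= q} ->
     {subset Q <= q'} -> {subset q' <= Q}) ->
  trdeg q t -> trdeg q' t' -> (t <= t'.+1)%N.
Proof.
move=> qq' adj [[y ry <-] _] [_ tm'].
pose pi := @prime_pi k Z q.
have Pmem z : (prime_repr (pi z) \in q') = (z \in q').
  have h : prime_repr (pi z) - z \in q'.
    by apply: qq'; apply/prime_piP; rewrite prime_reprK.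
  apply/idP/idP => hz; last by rewrite -[prime_repr _](subrK z) rpredD.
  by rewrite -[z](subKr (prime_repr (pi z))) rpredB.
pose S : {pred prime_quot q} := fun x => prime_repr x \in q'.
have SE z : (pi z \in S) = (z \in q') := Pmem z.
have S0 : 0 \in S by rewrite -(rmorph0 pi) SE rpred0.
have S1 : 1 \notin S by rewrite -(rmorph1 pi) SE idealr1.
have SM a : {in S &, forall u v, a * u + v \in S}.
  move=> u v; have [a' ->] := prime_pi_surj a; have [u' ->] := prime_pi_surj u.
  have [v' ->] := prime_pi_surj v; rewrite -rmorphM -rmorphD !SE => hu hv.
  by rewrite rpredD ?idealMr.
have SP : prime_idealr_closed S.
  move=> u v; have [u' ->] := prime_pi_surj u; have [v' ->] := prime_pi_surj v.
  by rewrite -rmorphM !SE prime_idealrM.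
pose P := mk_prime S0 S1 SM SP.
have PE z : (z \in q') = (pi z \in P) := esym (SE z).
(* A nonzero prime of Z/q below [P] pulls back to a prime strictly above [q] inside [q'], hence to
   [q']. *)
have Pmin (Q : prime_idealr (prime_quot q)) : (exists2 z, z \in Q & z != 0) ->
    {subset Q <= P} -> {subset P <= Q}.
  move=> [w wQ w0] QP.
  pose T : {pred Z} := fun z => pi z \in Q.
  have TE z : (z \in T) = (pi z \in Q) by [].
  have T0 : 0 \in T by rewrite TE /pi rmorph0 rpred0.
  have T1 : 1 \notin T by rewrite TE /pi rmorph1 idealr1.
  have TM a : {in T &, forall u v, a * u + v \in T}.
    by move=> u v; rewrite !TE /pi rmorphD rmorphM => hu hv; rewrite rpredD ?idealMr.
  have TP : prime_idealr_closed T.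
    by move=> u v; rewrite !TE /pi rmorphM prime_idealrM.
  pose Q' := mk_prime T0 T1 TM TP.
  have QE z : (z \in Q') = (pi z \in Q) by [].
  have sub : {subset q' <= Q'}.
    apply: adj.
    - move=> z zq; rewrite QE; have /eqP -> : pi z == 0 by rewrite prime_pi_eq0.
      exact: rpred0.
    - move=> sub; move/negP: w0; apply; have [z wE] := prime_pi_surj w.
      by rewrite wE prime_pi_eq0; apply: sub; rewrite QE -[pi z]/(prime_pi q z) -wE.
    - by move=> z; rewrite QE PE => /QP.
  by move=> u; have [z ->] := prime_pi_surj u; rewrite -PE => /sub.
have qgen := quot_affine Zgen (q := q).
have [x [fx tx hx _ xmin]] := trdeg_gkdim R qgen.
have [z [rz xz]] := height_one_rind (fg_ideals_affine qgen) Pmin fx hx xmin.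
have [z' zE] := lift_seq (@prime_pi_surj _ _ q) z.
have rz' : rind q' z'.
  by apply: (rind_lift PE); [apply: rpred0 | rewrite -zE].
apply: (@leq_trans (size x)).
  have [_ m] := tx; have := m _ (rind_map (mem_pred1_pi q) ry).
  by rewrite size_map.
apply: leq_trans xz _; rewrite ltnS zE size_map; exact: tm'.
Qed.

(** A chain of maximal length starts at zero and has no gaps, so every one of its steps lowers the
    transcendence degree by exactly one. *)
Lemma trdeg_height (p : prime_idealr Z) l t0 t : has_height p l ->
  trdeg (pred1 (0 : Z)) t0 -> trdeg p t -> (t + l)%N = t0.
Proof.
move=> [[q [qc qp]] lmax] td0 tdp.
have z0 : 0 \in pred1 (0 : Z) by rewrite inE.
have z1 : 1 \notin pred1 (0 : Z) by rewrite inE oner_neq0.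
have zM a : {in pred1 (0 : Z) &, forall u v, a * u + v \in pred1 (0 : Z)}.
  by move=> u v; rewrite !inE => /eqP -> /eqP ->; rewrite mulr0 addr0.
have zP : prime_idealr_closed (pred1 (0 : Z)).
  by move=> u v; rewrite !inE mulf_eq0.
pose zero : prime_idealr Z := mk_prime z0 z1 zM zP.
have q0 z : z \in q 0%N -> z = 0.
  move=> zq; apply: contrapT => /eqP zn.
  pose q' i := if i is j.+1 then q j else zero.
  suff : (l.+1 <= l)%N by rewrite ltnn.
  apply: (lmax _ q'); split; last exact: qp.
  case=> [_|i] /=; last exact: qc.
  split; first by move=> y; rewrite inE => /eqP ->; apply: rpred0.
  by move=> /(_ z zq); rewrite inE (negPf zn).
have adjq i : (i < l)%N -> forall Q : prime_idealr Z,
    {subset q i <= Q} -> ~ {subset Q <= q i} ->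
    {subset Q <= q i.+1} -> {subset q i.+1 <= Q}.
  move=> il Q h1 h2 h3; apply: contrapT => h4.
  (* Inserting [Q] after position i would produce a chain of length l + 1. *)
  pose q' j := if (j <= i)%N then q j else if j == i.+1 then Q else q j.-1.
  suff : (l.+1 <= l)%N by rewrite ltnn.
  apply: (lmax _ q'); split=> [j jl|]; last first.
    by rewrite /q' leqNgt (leqW il) /= eqSS gtn_eqF.
  rewrite /q'; case: (ltngtP j i) => [ji|ij|->].
  - by apply: qc; apply: ltn_trans il.
  - rewrite eqSS (gtn_eqF ij).
    case: eqP => [->|/eqP ne]; first by split.
    case: j jl ij ne => [//|j] /= jl ij ne.
    by apply: qc.
  - by rewrite eqxx.
have main i : (i <= l)%N -> forall s, trdeg (q i) s -> (s + i)%N = t0.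
  elim: i => [|i IH] il s ts.
    have [[y ry yt] m] := td0; have [[z rz zt] m'] := ts.
    rewrite addn0; apply/eqP; rewrite eqn_leq -zt -yt; apply/andP; split.
      apply: leq_trans (m z _) _; rewrite ?yt//; apply: rind_sub rz => a.
      by rewrite inE => /eqP ->; apply: rpred0.
    rewrite zt; apply: m'; apply: rind_sub ry => a /q0 ->; by rewrite inE.
  have [s' ts'] := trdeg_exists (q i); have [h1 h2] := qc i il.
  have := IH (ltnW il) _ ts'.
  have := trdeg_drop h1 h2 ts' ts; have := trdeg_adjacent h1 (adjq i il) ts' ts.
  lia.
exact: (main l (leqnn _) _ (trdeg_ext (fun z => esym (qp z)) tdp)).
Qed.

End Height.

(** * Descent along a central element *)

Section GKModules.
Variables (R : realType) (k : fieldType) (A : algType k).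
Local Notation gk M := (gkdim_mod R (GRing.in_alg A) M).
Hypothesis gk_exact : gkdim_exact R A.

Lemma gk_submod_quotmod (M : lmodType A) (N : submodClosed M) :
  gk M = maxe (gk (submod N)) (gk (quotmod N)).
Proof.
apply: (gk_exact (f := submod_incl N) (g := quotmod_lin N)).
- exact: val_inj.
- move=> v; split=> [/quotmod_lin0 vN|[u ->]]; first by exists (Submod vN).
  by apply/quotmod_lin0; case: u.
- exact: quotmod_lin_surj.
Qed.

Lemma gk_inj (M M' : lmodType A) (f : {linear M -> M'}) :
  injective f -> (gk M <= gk M')%E.
Proof.
move=> fi; rewrite (gk_exact (M := M') (f := f) (g := quotmod_lin (image_submod f)) fi).
- by rewrite le_max lexx.
- by move=> v; rewrite quotmod_lin0; split=> [/image_submodP|h]; [|apply/image_submodP].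
- exact: quotmod_lin_surj.
Qed.

Lemma gk_surj (M M' : lmodType A) (g : {linear M -> M'}) :
  Defs.surj g -> (gk M' <= gk M)%E.
Proof.
move=> gs; rewrite (gk_exact (f := submod_incl (ker_submod g)) (g := g)).
- by rewrite le_max lexx orbT.
- exact: val_inj.
- move=> v; split=> [/ker_submodP vN|[u ->]]; first by exists (Submod vN).
  by apply/ker_submodP; case: u.
- exact: gs.
Qed.

Lemma gk_first_iso (M X : lmodType A) (g : {linear M -> X}) (K : submodClosed M) :
  Defs.surj g -> (forall x, g x = 0 <-> x \in K) -> gk X = gk (quotmod K).
Proof.
move=> gs gK.
pose g' (q : quotmod K) := g (quotmod_repr q).
have g'pi x : g' (quotmod_pi K x) = g x.
  apply/eqP; rewrite -subr_eq0 -linearB; apply/eqP/gK/quotmod_piP.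
  exact: quotmod_reprK.
have lg : linear g'.
  move=> a x y; rewrite -(quotmod_reprK x) -(quotmod_reprK y).
  by rewrite -(quotmod_pi_linear K) !g'pi linearP.
apply/eqP; rewrite eq_le; apply/andP; split.
  apply: (gk_surj (g := mk_linear lg)) => y; have [x ->] := gs y.
  by exists (quotmod_pi K x); rewrite mk_linearE g'pi.
apply: (gk_inj (f := mk_linear lg)) => x y.
rewrite !mk_linearE -(quotmod_reprK x) -(quotmod_reprK y) !g'pi => e.
by apply/quotmod_piP/gK; rewrite linearB e subrr.
Qed.

(** Since [h] is injective, all factors of the chain of submodules h^i M are isomorphic to M/hM;
    were their dimension that of M, the chain would violate finite partitivity. *)
Lemma gk_mod_by_neq (h : A) (hC : forall a, h * a = a * h) (M : lmodType A) :
  gkdim_finitely_partitive R A -> fg_module M ->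
  (forall x : M, h *: x = 0 -> x = 0) -> nonzero_module (mod_by hC M) ->
  gk (mod_by hC M) <> gk M.
Proof.
move=> part fgM hi [q q0] gkE.
have [x xE] := quotmod_lin_surj q.
have xN : ~ exists y, x = h *: y.
  move=> [y yE]; move/eqP: q0; apply; rewrite xE; apply/quotmod_lin0.
  by apply/image_submodP; exists y.
have hnC n a : h ^+ n * a = a * h ^+ n.
  by elim: n => [|n IH]; rewrite ?expr0 ?mul1r ?mulr1// exprS -mulrA IH !mulrA hC.
have hni n (y : M) : h ^+ n *: y = 0 -> y = 0.
  elim: n y => [|n IH] y; first by rewrite expr0 scale1r.
  by rewrite exprS -scalerA => /hi/IH.
pose N n := image_submod (scaling (hnC n) M).
have [b hb] := part M fgM.
suff : (b.+1 <= b)%N by rewrite ltnn.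
apply: (hb b.+1 N).
  by move=> y; apply/image_submodP; exists y; rewrite /= expr0 scale1r.
move=> i _; split.
- move=> y /image_submodP[z ->]; apply/image_submodP; exists (h *: z).
  by rewrite /= scalerA exprSr.
- move=> sub; have /sub/image_submodP[y /= hy] : h ^+ i *: x \in N i.
    by apply/image_submodP; exists x.
  apply: xN; exists y; apply/eqP; rewrite -subr_eq0; apply/eqP; apply: (hni i).
  by rewrite scalerBr scalerA -exprSr -hy subrr.
have sN y : scaling (hnC i) M y \in N i by apply/image_submodP; exists y.
rewrite -gkE; apply: (gk_first_iso
  (g := (quotmod_lin [the submodClosed (submod (N i)) of @trace_submod A M (N i) (N i.+1)] \o
    corestr sN)%FUN)).
  move=> y; have [[z zN] ->] := quotmod_lin_surj y.
  have /image_submodP[w wE] := zN; exists w => /=; congr (quotmod_pi _ _).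
  by apply: val_inj.
move=> y; rewrite /=; split.
  move/(quotmod_lin0 [the submodClosed (submod (N i)) of @trace_submod A M (N i) (N i.+1)]).
  move=> /image_submodP[z /= hz]; apply/image_submodP; exists z => /=.
  apply/eqP; rewrite -subr_eq0; apply/eqP; apply: (hni i).
  by rewrite scalerBr scalerA -exprSr hz subrr.
move=> /image_submodP[z ->].
apply/(quotmod_lin0 [the submodClosed (submod (N i)) of @trace_submod A M (N i) (N i.+1)]).
by apply/image_submodP; exists z => /=; rewrite scalerA exprSr.
Qed.

Lemma grade_attained (M : lmodType A) (n m : nat) : cohen_macaulay R A ->
  gkdim_alg R (GRing.in_alg A) = n%:R%:E -> fg_module M -> nonzero_module M ->
  gk M = m%:R%:E ->
  exists i, [/\ n = (i + m)%N, Ext_neq0 M A^o i &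
    forall j, (j < i)%N -> ~ Ext_neq0 M A^o j].
Proof.
move=> CM gkA fgM nzM gkM; have := CM M fgM nzM; rewrite gkA gkM.
pose Q j := `[< Ext_neq0 M A^o j >].
have [Qex|nQ] := pselect (exists j, Q j); last first.
  (* Without any nonzero Ext the grade is +oo, which a finite dimension of [A] excludes. *)
  have E0 : [set j%:R%:E | j in [set j | Ext_neq0 M A^o j]]%classic =
      classical_sets.set0 :> set (\bar R).
    apply/seteqP; split=> [x [j hj e]|x []].
    by apply: nQ; exists j; apply/asboolP.
  by rewrite /grade E0 ereal_inf0 addye.
case: (ex_minnP Qex) => i /asboolP Qi imin.
have -> : grade R M = i%:R%:E.
  apply/eqP; rewrite eq_le; apply/andP; split.
    by apply: ereal_inf_lbound; exists i.
  apply: le_ereal_inf_tmp => _ [j Qj <-]; rewrite lee_fin ler_nat.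
  by apply: imin; apply/asboolP.
rewrite -EFinD -natrD => -[/eqP]; rewrite eqr_nat => /eqP nE.
exists i; split=> // j ji Qj.
by have := imin j (introT (asboolP _) Qj); rewrite leqNgt ji.
Qed.

End GKModules.

Section Cobounding.
Variables (A : pzRingType) (M W : lmodType A) (P : proj_resolution M).

(** [hom_coboundary] for bare functions, so that sums and central multiples of cochains need no
    linear structure attached. *)
Definition cobounds i (f : P i -> W) : Prop :=
  match i return (P i -> W) -> Prop with
  | 0%N => fun f => forall x, f x = 0
  | j.+1 => fun f => exists h : {linear P j -> W}, forall x, f x = h (res_diff P j x)
  end f.

Lemma cobounds_ext i (f g : P i -> W) : f =1 g -> cobounds f -> cobounds g.
Proof.
by case: i f g => [|i] f g e /= => [h x|[h hh]]; [rewrite -e | exists h => x; rewrite -e].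
Qed.

Lemma cobounds0 i : cobounds (fun _ : P i => 0).
Proof. by case: i => //= i; exists \0. Qed.

Lemma coboundsD i (f g : P i -> W) :
  cobounds f -> cobounds g -> cobounds (fun x => f x + g x).
Proof.
case: i f g => [|i] f g /= => [h1 h2 x|[h1 e1] [h2 e2]].
  by rewrite h1 h2 addr0.
by exists (h1 \+ h2) => x; rewrite e1 e2.
Qed.

Lemma coboundsZ i h (hC : forall a : A, h * a = a * h) (f : P i -> W) :
  cobounds f -> cobounds (fun x => h *: f x).
Proof.
case: i f => [|i] f /= => [h1 x|[h1 e1]]; first by rewrite h1 scaler0.
by exists (scaling hC W \o h1) => x; rewrite e1.
Qed.

Lemma cobounds_sum i (I : Type) (r : seq I) (F : I -> P i -> W) :
  (forall j, cobounds (F j)) -> cobounds (fun x => \sum_(j <- r) F j x).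
Proof.
move=> h; elim: r => [|j r IH].
  by apply: cobounds_ext (cobounds0 i) => x; rewrite big_nil.
by apply: cobounds_ext (coboundsD (h j) IH) => x; rewrite big_cons.
Qed.

Lemma coboundsP i (f : {linear P i -> W}) : hom_coboundary f <-> cobounds f.
Proof. by case: i f. Qed.

End Cobounding.

Section Descent.
Variables (R : realType) (k : closedFieldType).
Hypothesis k_uncountable : ~ countable [set: k].
Variables (A : algType k) (Z : idomAlgType k) (iota : central_hom Z A).
Hypothesis iota_linear : forall (c : k) (z : Z), iota (c *: z) = c *: iota z.
Variable V : seq A.
Hypothesis gV : generating (GRing.in_alg A) V.
Local Notation gk M := (gkdim_mod R (GRing.in_alg A) M).

Lemma tuples_countable r : exists l : nat -> seq {ffun 'I_r -> A},
  forall w, exists n, in_span (idfun : {rmorphism k -> k}) (fam (s := l n)) w.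
Proof.
pose d (j0 : 'I_r) (a : A) : {ffun 'I_r -> A} := [ffun j => if j == j0 then a else 0].
exists (fun n => [seq d j0 w | j0 <- enum 'I_r, w <- words V n]) => f.
have [n hn] := choice (fun j => gV (f j)).
pose N := \max_j n j; exists N.
have fE : f = \sum_j d j (f j).
  apply/ffunP => j; rewrite sum_ffunE (bigD1 j)//= ffunE eqxx big1 ?addr0// => i ij.
  by rewrite ffunE eq_sym (negPf ij).
rewrite fE; apply: in_span_sum => j _.
have [c ->] : wspan (GRing.in_alg A) V N (f j).
  by apply: wspan_leq (hn j); apply: (@bigop.leq_bigmax _ n j).
have -> : d j (\sum_t GRing.in_alg A (c t) *: (fam (s := words V N : seq A^o) t)) =
    \sum_t c t *: d j (fam (s := words V N : seq A^o) t).
  apply/ffunP => i; rewrite sum_ffunE ffunE; case: eqP => ij.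
    by apply: eq_bigr => t _; rewrite !ffunE ij eqxx -[LHS]/(_%:A * _) mulr_algl.
  by rewrite big1// => t _; rewrite !ffunE (introF eqP ij) scaler0.
apply: in_span_sum => t _; apply: (@in_spanZ _ _ (idfun : {rmorphism k -> k})).
apply: in_span_mem; apply/allpairsP; exists (j, fam (s := words V N : seq A^o) t).
by rewrite mem_enum; split=> //; apply: mem_nth.
Qed.

Hypothesis nA : forall I : submodClosed A^o, fg_submod I.

Let iC z a : iota z * a = a * iota z. Proof. exact: chomC. Qed.

(* If Ext^i(M, A) were divisible by all c - x, it would contain a copy of the
   uncountable-dimensional space k(c). *)
Lemma ext_not_divisible (M : lmodType A) (p : prime_idealr Z) (c : Z) i :
  fg_module M -> (forall z, z \notin p -> forall x : M, iota z *: x = 0 -> x = 0) ->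
  (forall x : k, c - x%:A \notin p) ->
  Ext_neq0 M A^o i ->
  (forall z, z \notin p -> ~ Ext_neq0 (mod_by (iC z) M) A^o i) ->
  exists2 z, z \notin p & Ext_neq0 (mod_by (iC z) M) A^o i.+1.
Proof.
move=> fgM inj cp [P [f [cf nf]]] nExt.
apply: contrapT => h.
have {}h z : z \notin p -> ~ Ext_neq0 (mod_by (iC z) M) A^o i.+1.
  by move=> zp hz; apply: h; exists z.
have [L hL] := free_resolution nA fgM.
have [u cu ucomp] := ext_compare A^o P L.
have [s hs] : exists s : seq (L i), forall x, mspan s x.
  by apply/fg_moduleP; have [r ->] := hL i; apply: fg_row.
(* Divisibility of the class of [f] by c - x, with quotient [e x]. *)
have E (x : k) : exists e : {linear P i -> A^o}, hom_cocycle e /\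
    cobounds (fun y => f y - iota (c - x%:A) *: e y).
  have [e ce [b cb eb]] := ext_cone_surj (inj _ (cp x)) cf (h _ (cp x)).
  exists e; split=> //; move/coboundsP: cb; apply: cobounds_ext => y.
  by rewrite eb addrC addKr.
have [e he] := choice E.
have [l hl] := tuples_countable (size s).
(* The quotient [e x], transported to the finite-rank resolution, is recorded by its values on
   generators, which lie in a space of countable dimension. *)
pose w (x : k) : {ffun 'I_(size s) -> A} := [ffun j : 'I_(size s) => e x (u i s`_j)].
have [xs [_ [a [us _ ax e0]]]] :=
  uncountable_dependent k_uncountable (fun=> tt) w hl.
have lF : linear (fun y => \sum_(x <- xs) iota (a x)%:A *: e x y : A^o).
  move=> b y y'; rewrite scaler_sumr -big_split; apply: eq_bigr => x _ /=.
  by rewrite linearP scalerDr !scalerA iC.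
pose F := mk_linear lF.
have cF : hom_cocycle F.
  move=> y; rewrite mk_linearE big1// => x _.
  by have [-> _] := he x; rewrite scaler0.
(* The relation makes [F] vanish on the generators of [L i], so its transport is zero and [F] itself
   bounds. *)
have Fcob : cobounds F.
  apply/coboundsP/(ucomp _ _ cF)/coboundsP; apply: cobounds_ext (@cobounds0 A M A^o L i) => y.
  have : mspan s y by apply: hs.
  have hF (j : nat) : (j < size s)%N -> F (u i s`_j) = 0.
    move=> jlt; have := congr1 (fun g : {ffun _ -> A} => g (Ordinal jlt)) e0.
    rewrite sum_ffunE ffunE => <-; rewrite mk_linearE; apply: eq_bigr => x _.
    rewrite !ffunE iota_linear rmorph1 -[LHS]/(_%:A * _) mulr_algl //.
  have {}hF y' : y' \in s -> F (u i y') = 0.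
    by move=> /(nthP 0)[j jlt <-]; apply: hF.
  have [FU FUE] : exists FU : {linear L i -> A^o}, FU =1 (F \o u i) by exists (F \o u i).
  rewrite -[RHS]FUE; have {}hF y' : y' \in s -> FU y' = 0 by move=> /hF; rewrite FUE.
  elim: (s) y hF => [|y' s' IH] y hF /=; first by move=> ->; rewrite linear0.
  move=> [b hb]; rewrite -[y](subrK (b *: y')) linearD [X in _ + X]linearZ /=
    (hF y') ?mem_head//.
  rewrite scaler0 addr0; apply: IH hb => z zs; apply: hF.
  by rewrite inE zs orbT.
have [v [r [v0 hr]]] := partial_fractions c us ax.
pose pi x := \prod_(y <- xs | y != x) (c - y%:A).
pose Q := \sum_(x <- xs) a x *: pi x.
have Qp : Q \notin p.
  rewrite /Q hr; apply/negP => /(idealZ v^-1); rewrite scalerA mulVf// scale1r.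
  elim: r {hr} => [|z r IH]; first by rewrite big_nil idealr1.
  by rewrite big_cons prime_idealrM (negPf (cp z)).
apply: nf; apply: (ext_cone_inj (inj _ Qp) cf (nExt _ Qp)).
apply/coboundsP.
(* Writing Q f as the sum of the a_x pi_x (f - (c - x) e_x) and of the product of all c - y times
   [F] shows that it bounds; injectivity of [Q] on Ext then contradicts the choice of [f]. *)
have c1 : cobounds (fun y =>
    \sum_(x <- xs) iota ((a x) *: pi x) *: (f y - iota (c - x%:A) *: e x y)).
  by apply: cobounds_sum => x; apply: coboundsZ (he x).2; apply: iC.
have c2 := coboundsZ (iC (\prod_(y <- xs) (c - y%:A))) Fcob.
apply: cobounds_ext (coboundsD c1 c2) => y /=.
rewrite scaler_sumr big_seq [X in _ + X]big_seq -big_split /=.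
rewrite /Q rmorph_sum scaler_suml [RHS]big_seq; apply: eq_bigr => x xx.
rewrite scalerBr !scalerA -!rmorphM addrC.
suff -> : \prod_(y0 <- xs) (c - y0%:A) * (a x)%:A = a x *: pi x * (c - x%:A).
  by rewrite addrC subrK.
rewrite (bigD1_seq x)//= -/(pi x) mulr_algr -scalerAl; congr (_ *: _).
exact: mulrC.
Qed.

Hypothesis gk_nat : gkdim_nat_valued R A.
Hypothesis gk_exact : gkdim_exact R A.
Hypothesis gk_part : gkdim_finitely_partitive R A.
Hypothesis CM : cohen_macaulay R A.
Variable n : nat.
Hypothesis gkA : gkdim_alg R (GRing.in_alg A) = n%:R%:E.

Lemma gk_descent (M : lmodType A) (p : prime_idealr Z) (c : Z) :
  fg_module M -> nonzero_module M ->
  (forall z, z \notin p -> forall x : M, iota z *: x = 0 -> x = 0) ->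
  (forall x : k, c - x%:A \notin p) ->
  exists2 z, z \notin p & (gk M <= gk (mod_by (iC z) M) + 1)%E.
Proof.
move=> fgM nzM inj cp; have [m gkM] := gk_nat nzM.
have [i [nE Ei Emin]] := grade_attained CM gkA fgM nzM gkM.
have fgQ z : fg_module (mod_by (iC z) M).
  exact: fg_image (@quotmod_lin_surj _ _ _) fgM.
have zero_or z : (forall x : mod_by (iC z) M, x = 0) \/ nonzero_module (mod_by (iC z) M).
  have [h|h] := pselect (nonzero_module (mod_by (iC z) M)); [by right|left => x].
  by apply: contrapT => /eqP x0; apply: h; exists x.
have [|z zp Ez] := ext_not_divisible fgM inj cp Ei.
  (* The dimension of M/zM is strictly smaller, so by the Cohen-Macaulay equation its grade exceeds
     i; a zero quotient has no Ext at all. *)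
  move=> z zp; have [z0|nz] := zero_or z; first exact: Ext_neq0_zero.
  have [m' gkm'] := gk_nat nz.
  have [i' [nE' _ Emin']] := grade_attained CM gkA (fgQ z) nz gkm'.
  apply: Emin'; have := gk_mod_by_neq gk_exact gk_part fgM (inj _ zp) nz.
  have : (gk (mod_by (iC z) M) <= gk M)%E.
    exact: (gk_surj gk_exact (@quotmod_lin_surj _ _ _)).
  rewrite gkm' gkM lee_fin ler_nat => le1 ne.
  have mm' : m' <> m by move=> e; apply: ne; rewrite e.
  lia.
exists z => //; have [z0|nz] := zero_or z; first by case: (Ext_neq0_zero z0 Ez).
have [m' gkm'] := gk_nat nz.
have [i' [nE' _ Emin']] := grade_attained CM gkA (fgQ z) nz gkm'.
rewrite gkM gkm' -EFinD lee_fin natr1 ler_nat.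
(* A nonzero Ext in degree i + 1 bounds the grade of M/zM, so its dimension is at least m - 1. *)
have : (i' <= i.+1)%N by rewrite leqNgt; apply/negP => /Emin'.
lia.
Qed.

End Descent.

(** * Modules killed by an ideal of Z *)

Lemma gkdim_alg_ext (R : realType) (K : fieldType) (B : pzRingType)
    (s1 s2 : {rmorphism K -> B}) : s1 =1 s2 -> gkdim_alg R s1 = gkdim_alg R s2.
Proof.
move=> e; apply/eqP; rewrite eq_le; apply/andP; split.
  exact: (@gkdim_alg_le _ _ _ s2 s1 R B s2 idfun idfun (fun c => erefl) (fun c => e c)
    (fun b => ex_intro _ b erefl) (fun a h => h)).
exact: (@gkdim_alg_le _ _ _ s1 s2 R B s1 idfun idfun (fun c => erefl) (fun c => esym (e c))
    (fun b => ex_intro _ b erefl) (fun a h => h)).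
Qed.

Lemma gkdim_alg_trivial (R : realType) (K : fieldType) (B : pzRingType)
    (s : {rmorphism K -> B}) : 1 = 0 :> B -> gkdim_alg R s = -oo%E.
Proof.
move=> e; apply/eqP; rewrite -leeNy_eq; apply: ge_ereal_sup => _ [V _ <-].
rewrite -(growth0 R); apply: growth_mono => n.
apply: (leq_trans (span_dim_le (f := (fun _ : void => 0 : B^o)) _)); last by rewrite card_void.
move=> w _; rewrite (_ : w = 0); first exact: in_span0.
by rewrite -[w]mul1r e mul0r.
Qed.

(** A polynomial over the algebraically closed [k] splits, and the prime [p] contains none of the
    factors c - x. *)
Lemma transcendental_residue (k : closedFieldType) (Z : idomAlgType k)
    (p : prime_idealr Z) (c : Z) :
  (forall x : k, c - x%:A \notin p) -> rind p [:: c].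
Proof.
move=> cp.
have sc (b : k) : b%:A \in p -> b = 0.
  move=> bp; apply: contrapT => /eqP b0; have := idealZ b^-1 bp.
  by rewrite scalerA mulVf// scale1r idealr1.
split=> // P PS PI.
have [b hb] := choice (fun i => elimT (scalarsP _) (polyOverP PS i)).
pose Q := \poly_(i < size P) b i.
have PE : P = map_poly (GRing.in_alg Z) Q.
  apply/polyP => i; rewrite coef_map coef_poly /=; case: ifP => hi; first by rewrite hb.
  by rewrite scale0r nth_default// leqNgt hi.
have [Q0|Q0] := eqVneq Q 0; first by rewrite PE Q0 rmorph0.
have [r rE] := closed_field_poly_normal Q.
exfalso; move: PI; rewrite PE rE map_polyZ hornerZ prime_idealrM => /orP[/sc/eqP|].
  by rewrite lead_coef_eq0 (negPf Q0).
rewrite rmorph_prod horner_prod.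
elim: (r) => [|x s IH]; first by rewrite big_nil idealr1.
rewrite big_cons prime_idealrM => /orP[|/IH //].
by rewrite rmorphB /= map_polyX map_polyC hornerXsubC => h; have := cp x; rewrite h.
Qed.

Section Bound.
Variables (R : realType) (k : closedFieldType).
Hypothesis k_uncountable : ~ countable [set: k].
Variables (A : algType k) (Z : idomAlgType k) (iota : central_hom Z A).
Hypothesis iota_linear : forall (c : k) (z : Z), iota (c *: z) = c *: iota z.
Variables (V : seq A) (x0 : seq Z).
Hypothesis gV : generating (GRing.in_alg A) V.
Hypothesis Zgen : forall a, a \in gen x0.
Hypothesis nA : forall I : submodClosed A^o, fg_submod I.
Hypothesis gk_nat : gkdim_nat_valued R A.
Hypothesis gk_exact : gkdim_exact R A.
Hypothesis gk_part : gkdim_finitely_partitive R A.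
Hypothesis CM : cohen_macaulay R A.
Variable n : nat.
Hypothesis gkA : gkdim_alg R (GRing.in_alg A) = n%:R%:E.
Variable g : \bar R.
Hypothesis fibre_g : forall m : idealr Z, maximal_ideal m -> gkdim_fiber R iota m = g.
Hypothesis max_ex : exists m : idealr Z, maximal_ideal m.
Local Notation gk M := (gkdim_mod R (GRing.in_alg A) M).
Let iC z a : iota z * a = a * iota z. Proof. exact: chomC. Qed.

Lemma iota_alg c : iota c%:A = c%:A.
Proof. by rewrite iota_linear rmorph1. Qed.

Lemma gk_le_fiber (I : idealr Z) (M : lmodType A) :
  (forall z, z \in I -> forall x : M, iota z *: x = 0) ->
  (gk M <= gkdim_fiber R iota I)%E.
Proof.
move=> kill; apply: (@gkdim_mod_le_alg _ _ _ R _ _ (fiber_pi iota I)) => [c|a].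
  by rewrite /= iota_alg.
rewrite -(rmorph0 (fiber_pi iota I)) => /fiber_piP; rewrite subr0.
move=> /ext_idealP[s [sI ->]] x; rewrite scaler_suml big_seq big1// => t ts.
by rewrite -scalerA kill//; apply: (allP sI).
Qed.

(** The number [t] merely bounds independent lists modulo [I], so it makes sense for the non-prime
    ideals met in the induction. Enlarging [I] keeps the bound, and enlarging a prime lowers it by
    one. *)
Lemma gk_bound (I : submodClosed Z^o) (t : nat) :
  (forall y : seq Z, rind (fun z : Z => (z : Z^o) \in I) y -> (size y <= t)%N) ->
  forall M : lmodType A, fg_module M ->
  (forall z : Z, (z : Z^o) \in I -> forall x : M, iota z *: x = 0) ->
  (gk M <= g + t%:R%:E)%E.
Proof.
have fgZ := fg_ideals_affine Zgen.
move: I t; apply: (noetherian_ind fgZ) => I IH t tI M fgM kill.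
have gt (x : \bar R) : (x <= g)%E -> (x <= g + t%:R%:E)%E.
  by move=> h; apply: le_trans h _; rewrite leeDl// lee_fin ler0n.
have base (m : idealr Z) : maximal_ideal m ->
    (forall z, z \in m -> forall x : M, iota z *: x = 0) -> (gk M <= g + t%:R%:E)%E.
  by move=> mm km; apply: gt; rewrite -(fibre_g mm); apply: gk_le_fiber.
(* A fibre at some maximal ideal is invoked even here, because [g] is known only as the dimension of
   such fibres. *)
have zero (N : lmodType A) : (forall x : N, x = 0) -> (gk N <= g)%E.
  move=> N0; have [m mm] := max_ex; rewrite -(fibre_g mm).
  by apply: gk_le_fiber => z _ x.
have step c (N : lmodType A) t' : (c : Z^o) \notin I ->
    (forall y, rind (fun z : Z => (z : Z^o) \in add_elt I c) y -> (size y <= t')%N) ->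
    fg_module N -> (forall z : Z, (z : Z^o) \in I -> forall x : N, iota z *: x = 0) ->
    (forall x : N, iota c *: x = 0) -> (gk N <= g + t'%:R%:E)%E.
  move=> cI ht fgN kI kc; apply: (IH (add_elt I c)) => //; first exact: add_elt_sub.
    by move=> h; move/negP: cI; apply; apply: h; apply: mem_add_elt.
  move=> z /add_eltP[b hb] x; rewrite -[z](subrK (b * c)) rmorphD scalerDl kI// add0r.
  by rewrite rmorphM -scalerA kc scaler0.
have rindJ c y : rind (fun z : Z => (z : Z^o) \in add_elt I c) y ->
    rind (fun z : Z => (z : Z^o) \in I) y.
  by apply: rind_sub => z; apply: add_elt_sub.
have [I1|I1] := pselect ((1 : Z^o) \in I).
  by apply/gt/zero => x; rewrite -[x]scale1r -(rmorph1 iota) kill.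
(* If [I] is not prime, split [M] into aM, killed by [b], and M/aM, killed by [a]. *)
have [[a [b [aI bI abI]]]|Iprime] := pselect (exists a b : Z,
    [/\ (a : Z^o) \notin I, (b : Z^o) \notin I & (a * b : Z^o) \in I]).
  rewrite (gk_submod_quotmod gk_exact (image_submod (scaling (iC a) M))).
  rewrite ge_max; apply/andP; split.
    apply: (step b) => //; first by move=> y /rindJ/tI.
    - exact: fg_submodule.
    - by move=> z zI [x xN]; apply: val_inj; apply: kill.
    - move=> [x xN]; apply: val_inj; have /image_submodP[w xE] := xN.
      have -> : \val (iota b *: Submod xN : submod _) = iota b *: x by [].
      by rewrite xE /= scalerA -rmorphM mulrC kill.
  apply: (step a) => //; first by move=> y /rindJ/tI.
  - exact: fg_image (@quotmod_lin_surj _ _ _) fgM.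
  - move=> z zI x; have [w ->] := quotmod_lin_surj x.
    by rewrite -linearZ [X in quotmod_lin _ X]kill// linear0.
  - move=> x; have [w ->] := quotmod_lin_surj x; rewrite -linearZ.
    by apply/quotmod_lin0/image_submodP; exists w.
pose S : {pred Z} := fun z : Z => (z : Z^o) \in I.
have S0 : 0 \in S by apply: (@rpred0 Z^o).
have S1 : 1 \notin S by apply/negP.
have SM a : {in S &, forall u v, a * u + v \in S}.
  by move=> u v hu hv; apply: (@rpredD Z^o) => //; apply: (@rpredZ Z Z^o).
have SP : prime_idealr_closed S.
  move=> u v huv; apply: contrapT => /negP; rewrite negb_or => /andP[hu hv].
  by apply: Iprime; exists u, v.
pose p := mk_prime S0 S1 SM SP.
(* When every residue is a scalar, [p] is maximal and [M] is a module over one of the given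
   fibres. *)
have [res|] := pselect (forall c : Z, exists x : k, c - x%:A \in p).
  exact: (base p (residue_maximal res)).
move=> /existsNP[c /forallNP cp].
have {}cp (x : k) : c - x%:A \notin p by apply/negP; apply: cp.
have t0 : (0 < t)%N by apply: (tI [:: c]); apply: (transcendental_residue cp).
have drop h y : h \notin p -> rind (fun z : Z => (z : Z^o) \in add_elt I h) y ->
    (size y <= t.-1)%N.
  move=> hp ry; rewrite -ltnS prednK//; apply: (tI (h :: y)).
  apply: (rind_cons (p := p) (J := fun z : Z => (z : Z^o) \in add_elt I h)) => //.
  - by move=> u v hu hv; apply: (@rpredD Z^o).
  - by move=> u v hv; apply: (@rpredZ Z Z^o).
  - by move=> z; apply: add_elt_sub.
  - exact: mem_add_elt.
pose T : {pred M} := fun x => `[< exists2 z, z \notin p & iota z *: x = 0 >].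
have Tc : submod_closed T.
  split; first by apply/asboolP; exists 1; rewrite ?scaler0// idealr1.
  move=> a x y /asboolP[z zp hz] /asboolP[w wp hw]; apply/asboolP.
  exists (z * w); first by rewrite prime_idealrM negb_or zp.
  rewrite scalerDr scalerA iC -scalerA [z * w]mulrC rmorphM -[in X in X + _]scalerA hz.
  by rewrite -rmorphM mulrC rmorphM -scalerA hw !scaler0 addr0.
pose T' : submodClosed M := HB.pack T (GRing.isSubmodClosed.Build A M T
    (GRing.submod_closed_semi Tc)).
have fgT : fg_module (submod T') by apply: fg_submodule.
have Tkill (x : submod T') : exists2 z, z \notin p & iota z *: x = 0.
  by case: x => [x xT]; have /asboolP[z zp hz] := xT; exists z => //; apply: val_inj.
have step' h (N : lmodType A) : h \notin p -> fg_module N ->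
    (forall z : Z, (z : Z^o) \in I -> forall x : N, iota z *: x = 0) ->
    (forall x : N, iota h *: x = 0) -> (gk N <= g + t.-1%:R%:E)%E.
  by move=> hp; apply: step => // y; apply: drop.
have leT : (gk (submod T') <= g + t%:R%:E)%E.
  have [s hs] := iffLR (fg_moduleP _) fgT.
  (* The torsion submodule is finitely generated, so a product of annihilators of its generators
     kills all of it. *)
  have [h hp hk] : exists2 h, h \notin p & forall x : submod T', mspan s x -> iota h *: x = 0.
    elim: (s) => [|x r [h hp IHr]] /=.
      by exists 1; rewrite ?idealr1// => x ->; rewrite scaler0.
    have [z zp zx] := Tkill x; exists (h * z) => [|y [a hy]].
      by rewrite -[_ \notin S]/(_ \notin p) prime_idealrM negb_or hp.
    rewrite -[y](subrK (a *: x)) scalerDr rmorphM -[in X in _ + X]scalerA.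
    rewrite [iota z *: (a *: x)]scalerA [iota z * a]iC -[(a * iota z) *: x]scalerA
      zx !scaler0 addr0.
    by rewrite [iota h * _]iC -scalerA IHr// scaler0.
  apply: (@le_trans _ _ (g + t.-1%:R%:E)%E).
    apply: (step' h) => // [z zI [x xT]|x]; last by apply: hk.
    by apply: val_inj; apply: kill.
  by rewrite leeD2l// lee_fin ler_nat leq_pred.
rewrite (gk_submod_quotmod gk_exact T') ge_max leT /=.
have kQ z : (z : Z^o) \in I -> forall x : quotmod T', iota z *: x = 0.
  move=> zI x; have [w ->] := quotmod_lin_surj x.
  by rewrite -linearZ [X in quotmod_lin _ X]kill// linear0.
have fgQ : fg_module (quotmod T') := fg_image (@quotmod_lin_surj _ _ _) fgM.
have [nz|z0] := pselect (nonzero_module (quotmod T')); last first.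
  by apply/gt/zero => x; apply: contrapT => /eqP nx; apply: z0; exists x.
have tf z : z \notin p -> forall x : quotmod T', iota z *: x = 0 -> x = 0.
  move=> zp x; have [w ->] := quotmod_lin_surj x; rewrite -linearZ.
  move=> /quotmod_lin0/asboolP[y yp hy]; apply/quotmod_lin0/asboolP.
  by exists (y * z); rewrite ?prime_idealrM ?negb_or ?yp// rmorphM -scalerA.
have [z zp hz] := gk_descent k_uncountable iota_linear gV nA gk_nat gk_exact gk_part CM
  gkA fgQ nz tf cp.
apply: (le_trans hz).
(* The unit lost in the descent is regained because modulo [z], which lies outside [p], independent
   lists have size at most t - 1. *)
rewrite -(prednK t0) -addn1 natrD EFinD addeA leeD2r//.
apply: (step' z) => //.
- exact: fg_image (@quotmod_lin_surj _ _ _) fgQ.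
- move=> y yI x; have [w ->] := quotmod_lin_surj x.
  by rewrite -linearZ [X in quotmod_lin _ X]kQ// linear0.
- move=> x; have [w ->] := quotmod_lin_surj x; rewrite -linearZ.
  by apply/quotmod_lin0/image_submodP; exists w.
Qed.
End Bound.

(** * Fibres of the quotient by p *)

Lemma affine_gen (k : fieldType) (C : idomAlgType k) :
  affine C <-> exists x0 : seq C, forall a, a \in gen x0.
Proof.
split=> -[s hs]; exists s; last first.
  move=> S sS a; have Sc : subring_closed (S : {pred C}).
    split=> [|x y xS yS|]; [exact: rpred1| |exact: rpredM].
    by rewrite rpredD// -scaleN1r rpredZ.
  pose S' : subringClosed C := HB.pack (S : {pred C})
    (GRing.isSubringClosed.Build C (S : {pred C}) Sc).
  by apply: (@gen_min _ _ S' s) (hs a) => // c; apply: (@rpredZ _ _ S); apply: rpred1.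
have Sc : subalg_closed (gen s : {pred C}).
  split; first exact: rpred1.
    by move=> c x y hx hy; rewrite rpredD// -mulr_algl rpredM// gen_scalar.
  by move=> x y; apply: rpredM.
pose S' : subalgClosed C := HB.pack (gen s : {pred C})
  (GRing.isSubalgClosed.Build _ _ (gen s : {pred C}) Sc).
by apply: (hs S') => x xs; apply: gen_mem.
Qed.

Lemma affine_countable (k : fieldType) (C : algType k) : affine C ->
  exists l : nat -> seq C, forall w, exists n,
    in_span (idfun : {rmorphism k -> k}) (fam (s := l n)) w.
Proof.
move=> /affine_generating[V gV]; exists (words V) => w.
have [n [c ->]] := gV w; exists n, c; apply: eq_bigr => i _.
by rewrite -[LHS]/(_%:A * _) mulr_algl.
Qed.

Section FiberLemmas.
Variables (C : comNzRingType) (B : pzRingType) (phi : central_hom C B) (I : idealr C).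

Lemma fiber_pi0 z : z \in I -> fiber_pi phi I (phi z) = 0.
Proof.
move=> zI; rewrite -(rmorph0 (fiber_pi phi I)); apply/fiber_piP/ext_idealP.
by exists [:: (z, 1)]; rewrite /= zI big_seq1 mulr1 subr0.
Qed.

Lemma fiber_ker (B' : pzRingType) (f : {rmorphism B -> B'}) a :
  (forall z, z \in I -> f (phi z) = 0) -> fiber_pi phi I a = 0 -> f a = 0.
Proof.
move=> fI; rewrite -[in X in X -> _](rmorph0 (fiber_pi phi I)) => /fiber_piP.
rewrite subr0 => /ext_idealP[s [sI ->]].
rewrite rmorph_sum big_seq big1// => t ts.
by rewrite rmorphM fI ?mul0r//; apply: (allP sI).
Qed.

Lemma fiber_pi_surj (b : fiber phi I) : exists a, b = fiber_pi phi I a.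
Proof. by exists (fiber_repr b); rewrite fiber_reprK. Qed.
End FiberLemmas.

Section FiberQuot.
Variables (R : realType) (k : fieldType) (Z : idomAlgType k) (A : pzRingType).
Variables (iota : central_hom Z A) (p : prime_idealr Z).
Local Notation phi := (quot_hom p iota).

Lemma quot_homE z : phi (prime_pi p z) = fiber_pi iota p (iota z).
Proof. exact: quot_map_pi. Qed.

Lemma generating_fiber V : generating (iota \o GRing.in_alg Z) V ->
  generating (phi \o GRing.in_alg (prime_quot p)) (map (fiber_pi iota p) V).
Proof.
move=> gV b; have [a ->] := fiber_pi_surj b; have [n [c ->]] := gV a; exists n.
rewrite rmorph_sum; apply: in_span_sum => i _; rewrite rmorphM /= -quot_homE prime_pi_alg.
apply: (@in_spanZ _ _ (phi \o GRing.in_alg (prime_quot p)) (fiber iota p)^o).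
by apply: wspan_word; rewrite words_map; apply: map_f; apply: mem_nth.
Qed.

Variables (m : idealr (prime_quot p)) (m' : idealr Z).
Hypothesis mE : forall z, (z \in m') = (prime_pi p z \in m).

(** Both rings are quotients of [A] with the same kernel m'A, and [gkdim_alg_le] compares them in
    both directions. *)
Lemma gkdim_fiber_quot : gkdim_fiber R phi m = gkdim_fiber R iota m'.
Proof.
pose s : {rmorphism k -> A} := iota \o GRing.in_alg Z.
pose f : {rmorphism A -> fiber phi m} := fiber_pi phi m \o fiber_pi iota p.
have e1 (c : k) : (fiber_pi phi m \o phi \o GRing.in_alg (prime_quot p)) c = f (s c).
  by rewrite /= -prime_pi_alg quot_map_pi.
have e2 (c : k) : (fiber_pi iota m' \o iota \o GRing.in_alg Z) c = fiber_pi iota m' (s c).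
  by [].
have pm z : z \in p -> z \in m'.
  by rewrite mE -prime_pi_eq0 => /eqP ->; apply: rpred0.
apply/eqP; rewrite eq_le; apply/andP; split.
  apply: (@gkdim_alg_le _ _ _ _ _ R A s (fiber_pi iota m') f e2 e1) => [b|a].
    have [b' ->] := fiber_pi_surj b.
    by have [a ->] := fiber_pi_surj b'; exists a.
  apply: fiber_ker => z zm; rewrite -[f _]/(fiber_pi phi m (fiber_pi iota p (iota z))).
  have <- := quot_homE z; apply: fiber_pi0; by rewrite -mE.
apply: (@gkdim_alg_le _ _ _ _ _ R A s f (fiber_pi iota m') e1 e2) => [b|a].
  exact: fiber_pi_surj.
rewrite -[in X in X -> _](rmorph0 f) => /fiber_piP; rewrite rmorph0 subr0 => /ext_idealP[t [tm tE]].
(* A lift to m'A of the witness of membership in m(A/pA); it differs from [a] by an element of pA,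
   which is contained in m'A. *)
pose b := \sum_(u <- t) iota (prime_repr u.1) * fiber_repr u.2.
have : fiber_pi iota p (a - b) = 0.
  rewrite rmorphB tE /b rmorph_sum; apply/eqP; rewrite subr_eq0; apply/eqP.
  by apply: eq_bigr => u _; rewrite [RHS]rmorphM /= -quot_map_pi prime_reprK fiber_reprK.
move=> /(fiber_ker (f := fiber_pi iota m')) => h.
have /eqP : fiber_pi iota m' (a - b) = 0 by apply: h => z /pm; apply: fiber_pi0.
rewrite rmorphB subr_eq0 => /eqP ->.
rewrite rmorph_sum big_seq big1// => u ut; rewrite rmorphM /= fiber_pi0 ?mul0r//.
by rewrite mE prime_reprK; apply: (allP tm).
Qed.
End FiberQuot.

Lemma maximal_pullback (k : fieldType) (Z : idomAlgType k) (p : prime_idealr Z)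
    (m : idealr (prime_quot p)) : maximal_ideal m ->
  exists m' : idealr Z, maximal_ideal m' /\ forall z, (z \in m') = (prime_pi p z \in m).
Proof.
move=> mm; pose S : {pred Z} := fun z => prime_pi p z \in m.
have SE z : (z \in S) = (prime_pi p z \in m) by [].
have S0 : 0 \in S by rewrite SE rmorph0 rpred0.
have S1 : 1 \notin S by rewrite SE rmorph1 idealr1.
have SM a : {in S &, forall u v, a * u + v \in S}.
  by move=> u v; rewrite !SE rmorphD rmorphM => hu hv; rewrite rpredD ?idealMr.
exists (mk_ideal S0 S1 SM); split=> // J SJ z zJ.
have pJ y : y \in p -> y \in J.
  by move=> yp; apply: SJ; rewrite SE (eqP (introT eqP (_ : prime_pi p y = 0))) ?rpred0//;
     apply/eqP; rewrite prime_pi_eq0.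
pose T : {pred prime_quot p} := fun x => prime_repr x \in J.
have TE y : (prime_pi p y \in T) = (y \in J).
  have h : prime_repr (prime_pi p y) - y \in J.
    by apply: pJ; apply/prime_piP; rewrite prime_reprK.
  apply/idP/idP => hy; last first.
    by rewrite -[_ \in T]/(prime_repr (prime_pi p y) \in J) -[prime_repr _](subrK y) rpredD.
  by rewrite -[y](subKr (prime_repr (prime_pi p y))) rpredB.
have T0 : 0 \in T by rewrite -(rmorph0 (prime_pi p)) TE rpred0.
have T1 : 1 \notin T by rewrite -(rmorph1 (prime_pi p)) TE idealr1.
have TM a : {in T &, forall u v, a * u + v \in T}.
  move=> u v; have [a' ->] := prime_pi_surj a; have [u' ->] := prime_pi_surj u.
  have [v' ->] := prime_pi_surj v; rewrite -rmorphM -rmorphD !TE => hu hv.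
  by rewrite rpredD ?idealMr.
rewrite -[z \in _]/(prime_pi p z \in m).
apply: (mm (mk_ideal T0 T1 TM)); last by rewrite -[_ \in _]/(_ \in T) TE.
by move=> x; have [y ->] := prime_pi_surj x => hy; rewrite -[_ \in _]/(_ \in T) TE SJ.
Qed.

Lemma gkdim_alg_mod (R : realType) (k : fieldType) (A : algType k) :
  gkdim_alg R (GRing.in_alg A) = gkdim_mod R (GRing.in_alg A) A^o.
Proof.
apply/eqP; rewrite eq_le; apply/andP; split.
  apply: (@gkdim_alg_le_mod _ _ _ R A _ idfun A^o 1) => // [b|a]; first by exists b.
  by rewrite -[_ *: _]/(a * 1) mulr1.
apply: (@gkdim_mod_le_alg _ _ _ R A _ idfun A^o) => // a /= -> x.
by rewrite scale0r.
Qed.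

Section GenericBounds.
Variables (R : realType) (k : closedFieldType) (C : idomAlgType k) (B : pzRingType).
Variable phi : central_hom C B.

Lemma gkdim_generic_ge0 : (forall c : C, c != 0 -> phi c <> 0) ->
  (0 <= gkdim_generic R phi)%E.
Proof.
move=> reg; apply: le_trans (ereal_sup_ubound _); last by exists [::].
rewrite -(growth1 R); apply: growth_mono => n.
apply: (leq_trans _ (@span_dim_ge _ _ (tensor_inr phi (frac_hom C)) (tensor phi (frac_hom C))^o
  _ unit (fun=> 1) _ _)); first by rewrite card_unit.
  move=> c; rewrite (bigD1 tt)//= big1 ?addr0; last by case.
  rewrite -[_ *: _]/(_ * 1) mulr1 => h [].
  apply: contrapT => /eqP c0.
  have /tensor_inl_torsion[z /reg] : tensor_inl phi 1 = 0; last by rewrite mulr1.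
  rewrite rmorph1 -(rmorph1 (tensor_inr phi (frac_hom C))) -(mulVf c0).
  by rewrite rmorphM [X in _ * X]h mulr0.
by move=> _; apply: in_span_mem; apply: (words_leq (leq0n n)); rewrite inE.
Qed.

Lemma gkdim_generic_le V x : generating (phi \o GRing.in_alg C) V ->
  rind (pred1 (0 : C)) x ->
  (gkdim_generic R phi + (size x)%:R%:E <= gkdim_alg R (phi \o GRing.in_alg C))%E.
Proof.
move=> gV rx; apply: (@gkdim_generic_add _ _ _ _ _ gV R (size x) (size x) (map phi x)
  (fun n => box n (size x)) (fun n => @mon _ _ n x)) => [n|n c hc f|n f].
- by rewrite card_box.
- by apply: (mon_indep (I := pred1 0)) rx _ _ _; rewrite inE// hc.
- by apply: wspan_word; rewrite words_map; apply: map_f; rewrite mulnC; apply: mon_words.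
Qed.
End GenericBounds.

Section QuotientFibre.
Variables (R : realType) (k : closedFieldType) (k_uncountable : ~ countable [set: k]).
Variables (A : algType k) (Z : idomAlgType k) (iota : central_hom Z A).
Hypothesis iota_linear : forall (c : k) (z : Z), iota (c *: z) = c *: iota z.
Variables (V : seq A) (x0 : seq Z).
Hypothesis gV : generating (GRing.in_alg A) V.
Hypothesis Zgen : forall a, a \in gen x0.
Hypothesis Z_regular : forall c : Z, c != 0 -> iota c <> 0.
Hypothesis Z_unruffled : unruffled R iota.

Lemma generating_iota : generating (iota \o GRing.in_alg Z) V.
Proof.
move=> b; have [n [c ->]] := gV b; exists n, c; apply: eq_bigr => i _.
by rewrite /= iota_alg.
Qed.

Variable p : prime_idealr Z.
Local Notation phi := (quot_hom p iota).

Lemma prime_quot_affine : affine (prime_quot p).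
Proof. by apply/affine_gen; exists (map (prime_pi p) x0); apply: quot_affine. Qed.

Lemma gkdim_fiber_phi (m : idealr (prime_quot p)) : maximal_ideal m ->
  gkdim_fiber R phi m = gkdim_generic R iota.
Proof.
move=> mm; have [m' [mm' m'E]] := maximal_pullback mm.
by rewrite (gkdim_fiber_quot R iota m'E); case: Z_unruffled => _; apply.
Qed.

Lemma gkdim_generic_phi : gkdim_generic R phi = gkdim_generic R iota.
Proof.
have [l hl] := affine_countable prime_quot_affine.
have [M [mM <-]] := very_generic_fibre (generating_fiber (p := p) generating_iota) R
  k_uncountable (fg_ideals_affine (quot_affine Zgen (q := p))) hl.
exact: gkdim_fiber_phi.
Qed.

(** A nonzero [z] in the kernel becomes a nonzero scalar at a generic maximal ideal avoiding it, so
    the fibre there is the zero ring, of dimension -oo. Unruffledness identifies that dimension with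
    the generic one, which is at least 0. *)
Lemma quot_hom_inj : injective phi.
Proof.
have [l hl] := affine_countable prime_quot_affine.
move=> x y /eqP; rewrite -subr_eq0 -rmorphB => /eqP.
set z := x - y => hz; apply/eqP; rewrite -subr_eq0; apply/eqP; apply: contrapT => /eqP z0.
have [M [zM res]] := generic_point k_uncountable
  (fg_ideals_affine (quot_affine Zgen (q := p))) hl (h := fun=> z) (fun=> z0).
have [c cM] := res z.
have c0 : c != 0.
  by apply: contraNneq (zM 0%N) => c0; move: cM; rewrite c0 scale0r subr0.
have fc : fiber_pi phi M (phi c%:A) = 0.
  have zc : phi (c%:A - z) = phi c%:A by rewrite rmorphB [phi z]hz subr0.
  by rewrite -zc fiber_pi0// -opprB rpredN.
have := gkdim_generic_ge0 R Z_regular.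
rewrite -(gkdim_fiber_phi (residue_maximal res)) /gkdim_fiber gkdim_alg_trivial//.
rewrite -(rmorph1 (fiber_pi phi M)) -(rmorph1 phi).
have -> : 1 = c^-1%:A * c%:A :> prime_quot p.
  by rewrite -scalerAl mul1r scalerA mulVf// scale1r.
by rewrite !rmorphM [X in _ * X]fc mulr0.
Qed.

Lemma unruffled_quot : unruffled R phi.
Proof.
split; first exact: quot_hom_inj.
by move=> m /gkdim_fiber_phi ->; rewrite gkdim_generic_phi.
Qed.
End QuotientFibre.

(** * The dimension formulas *)

Section Main.
Variables (R : realType) (k : closedFieldType) (k_uncountable : ~ countable [set: k]).
Variables (A : algType k) (Z : idomAlgType k) (iota : central_hom Z A).
Hypothesis iota_linear : forall (c : k) (z : Z), iota (c *: z) = c *: iota z.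
Variables (V : seq A) (x0 : seq Z).
Hypothesis gV : generating (GRing.in_alg A) V.
Hypothesis Zgen : forall a, a \in gen x0.
Hypothesis nA : forall I : submodClosed A^o, fg_submod I.
Hypothesis Z_regular : forall c : Z, c != 0 -> iota c <> 0.
Hypothesis gk_nat : gkdim_nat_valued R A.
Hypothesis gk_exact : gkdim_exact R A.
Hypothesis gk_part : gkdim_finitely_partitive R A.
Hypothesis Z_unruffled : unruffled R iota.
Hypothesis CM : cohen_macaulay R A.
Variable n : nat.
Hypothesis gkA : gkdim_alg R (GRing.in_alg A) = n%:R%:E.
Local Notation g := (gkdim_generic R iota).

Lemma max_exists : exists m : idealr Z, maximal_ideal m.
Proof.
have [|l hl] := @affine_countable _ Z; first by apply/affine_gen; exists x0.
have [M [_ res]] := generic_point k_uncountable (fg_ideals_affine Zgen) hl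
  (h := fun=> 1) (fun=> oner_neq0 Z).
by exists M; apply: residue_maximal.
Qed.

Let fibre_g m : maximal_ideal m -> gkdim_fiber R iota m = g.
Proof. by case: Z_unruffled => _; apply. Qed.

Lemma gkdim_total t : trdeg (pred1 (0 : Z)) t -> gkdim_alg R (GRing.in_alg A) = (g + t%:R%:E)%E.
Proof.
move=> [[x rx xt] tm]; apply/eqP; rewrite eq_le; apply/andP; split; last first.
  rewrite -xt -(gkdim_alg_ext R (s1 := iota \o GRing.in_alg Z)); last first.
    by move=> c; apply: iota_alg.
  exact: gkdim_generic_le (generating_iota iota_linear gV) rx.
rewrite gkdim_alg_mod; apply: (gk_bound k_uncountable iota_linear gV Zgen nA gk_nat gk_exact
  gk_part CM gkA fibre_g max_exists (I := mspan_submod ([::] : seq Z^o))).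
- move=> y ry; apply: tm; apply: rind_sub ry => z; rewrite inE => /eqP ->.
  exact: (@rpred0 Z^o).
- by apply/fg_moduleP; exists [:: 1] => y /=; exists y; rewrite -[_ *: _]/(y * 1) mulr1 subrr.
- by move=> z /mspan_submodP /= -> y; rewrite rmorph0 scale0r.
Qed.

Lemma gkdim_fibre_total (p : prime_idealr Z) t : trdeg (pred1 (0 : prime_quot p)) t ->
  gkdim_fiber R iota p = (g + t%:R%:E)%E.
Proof.
move=> tp; have [[x rx xt] _] := tp; have [_ tm] := trdeg_quot tp.
apply/eqP; rewrite eq_le; apply/andP; split; last first.
  rewrite -xt -(gkdim_generic_phi k_uncountable iota_linear gV Zgen Z_unruffled p).
  rewrite /gkdim_fiber -(gkdim_alg_ext R
    (s1 := quot_hom p iota \o GRing.in_alg (prime_quot p))); last first.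
    by move=> c; rewrite /= -prime_pi_alg quot_map_pi.
  exact: gkdim_generic_le (generating_fiber (generating_iota iota_linear gV)) rx.
have Ec : submod_closed (ext_ideal iota p : {pred A^o}).
  split; first exact: rpred0.
  by move=> a u v hu hv; apply: rpredD => //; apply: ext_idealMl.
pose E : submodClosed A^o := HB.pack (ext_ideal iota p : {pred A^o})
  (GRing.isSubmodClosed.Build A A^o _ (GRing.submod_closed_semi Ec)).
(* The upper bound is known for [A]-modules, so the ring A/pA is replaced by the cyclic module A/E
   with E = pA. *)
apply: (@le_trans _ _ (gkdim_mod R (GRing.in_alg A) (quotmod E))).
  apply: (@gkdim_alg_le_mod _ _ _ R A _ (fiber_pi iota p) _ (quotmod_lin E 1)).
  - by move=> c; rewrite /= iota_alg.
  - exact: fiber_pi_surj.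
  - move=> a; rewrite -linearZ => /quotmod_lin0; rewrite -[_ *: _]/(a * 1) mulr1 => aE.
    by rewrite -(rmorph0 (fiber_pi iota p)); apply/fiber_piP; rewrite subr0.
have Ic : submod_closed (p : {pred Z^o}).
  split; first exact: rpred0.
  by move=> a u v hu hv; apply: rpredD => //; apply: idealMr.
pose I : submodClosed Z^o := HB.pack (p : {pred Z^o})
  (GRing.isSubmodClosed.Build Z Z^o _ (GRing.submod_closed_semi Ic)).
apply: (gk_bound k_uncountable iota_linear gV Zgen nA gk_nat gk_exact
  gk_part CM gkA fibre_g max_exists (I := I)).
- by move=> y ry; apply: tm; apply: rind_sub ry.
- apply: fg_image (@quotmod_lin_surj _ _ E) _.
  by apply/fg_moduleP; exists [:: 1] => y /=; exists y; rewrite -[_ *: _]/(y * 1) mulr1 subrr.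
- move=> z zI y; have [w ->] := quotmod_lin_surj y; rewrite -linearZ.
  apply/quotmod_lin0/ext_idealP; exists [:: (z, w)]; rewrite /= big_seq1; split=> //.
  by rewrite andbT.
Qed.
End Main.

Theorem mainTheorem6 (R : realType) (k : closedFieldType)
    (k_uncountable : ~ countable [set: k])
    (A : algType k)
    (A_affine : affine A) (A_finrel : finitely_related A)
    (A_noetherian : noetherian_ring A)
    (Z : idomAlgType k) (iota : central_hom Z A)
    (iota_linear : forall (c : k) (z : Z), iota (c *: z) = c *: iota z)
    (iota_inj : injective iota)
    (Z_affine : affine Z)
    (Z_regular : forall (z : Z) (a : A), z != 0 -> iota z * a = 0 -> a = 0)
    (gk_nat : gkdim_nat_valued R A)
    (gk_exact : gkdim_exact R A)
    (gk_partitive : gkdim_finitely_partitive R A)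
    (n d : \bar R)
    (hn : n = gkdim_alg R (GRing.in_alg A))
    (hd : d = gkdim_alg R (GRing.in_alg Z))
    (Z_smooth : finite_gldim Z)
    (Z_unruffled : unruffled R iota)
    (p : prime_idealr Z) (l : nat) (hp : has_height p l) :
  unruffled R (quot_hom p iota)
  /\ (cohen_macaulay R A ->
      gkdim_generic R (quot_hom p iota) = (n - d)%E
      /\ gkdim_fiber R iota p = (n - l%:R%:E)%E).
Proof.
have [V gV] := affine_generating A_affine.
have [x0 Zgen] := iffLR (affine_gen Z) Z_affine.
have reg (c : Z) : c != 0 -> iota c <> 0.
  by move=> /eqP c0 h; apply: c0; apply: iota_inj; rewrite h rmorph0.
split; first exact: (unruffled_quot k_uncountable iota_linear gV Zgen reg Z_unruffled).
move=> CM; rewrite (gkdim_generic_phi k_uncountable iota_linear gV Zgen Z_unruffled).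
have nA := noetherian_fg A_noetherian.1.
(* [A] is nonzero because [iota] does not kill 1, so integrality of dimension applies to [A] as a
   module over itself. *)
have [N gkA] : exists N : nat, gkdim_alg R (GRing.in_alg A) = N%:R%:E.
  rewrite gkdim_alg_mod; apply: gk_nat; exists 1; apply/negP => /eqP h.
  apply: (reg 1 (oner_neq0 Z)); rewrite rmorph1; exact: h.
have [x [_ tx _ gkZ _]] := trdeg_gkdim R Zgen.
have [y [_ ty _ _ _]] := trdeg_gkdim R (quot_affine Zgen (q := p)).
have hl := trdeg_height R Zgen hp tx (trdeg_quot ty).
have e1 := gkdim_total k_uncountable iota_linear gV Zgen nA gk_nat gk_exact gk_partitive
  Z_unruffled CM gkA tx.
have e2 := gkdim_fibre_total k_uncountable iota_linear gV Zgen nA gk_nat gk_exact gk_partitive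
  Z_unruffled CM gkA ty.
(* Only the finite numbers d and l are cancelled, so nothing has to be known about finiteness of the
   generic dimension. *)
rewrite hn hd gkZ e1 e2; split; first by rewrite addeK.
by rewrite -hl natrD EFinD addeA addeK.
Qed.
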